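(* Let $(M^n,g)$ be a complete noncompact $n$-dimensional Riemannian manifold, $u\in C^\infty(M)$, $V=e^u$, $\lambda,\mu\in\mathbb{R}$, $D=D^{\lambda,\mu}$, and $\tau=(n+1)\lambda+\mu$. Let $\rho$ be a nonnegative function on $M$ such that $|\nabla^D\rho|=1$ and $\Delta^D\rho\ge\frac{C}{\rho}V^{\lambda-\mu}$ in the sense of distributions, where $C>1$, $\alpha<2$ and $C+\alpha-3>0$. Then for every $\phi\in C_0^\infty(M\setminus\rho^{-1}\{0\})$, $$\int_M\rho^\alpha(\Delta^D\phi)^2V^{\tau+\mu-\lambda}\,dv_g\ \ge\ \frac{(C+\alpha-3)^2(C-\alpha+1)^2}{16}\int_M\rho^{\alpha-4}\phi^2V^{\tau+\lambda-\mu}\,dv_g.$$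
   Context: $\nabla$, $\Delta=\mathrm{div}\,\nabla$, $dv_g$ denote the Levi-Civita connection/gradient, Laplacian and Riemannian volume of $g$; $\langle\cdot,\cdot\rangle=g$ and $|\cdot|$ is the norm of $g$. The affine connection $D=D^{\lambda,\mu}$ is $D_XY=\nabla_XY+\lambda\,du(X)Y+\lambda\,du(Y)X+\mu\,g(X,Y)\nabla u$. The affine gradient of a function $f$ is $\nabla^Df=V^{\mu-\lambda}\nabla f$. The affine Laplacian is $\Delta^Df=V^{\mu-\lambda}\left[\Delta f+(2\mu+n\lambda)\langle\nabla u,\nabla f\rangle\right]$; equivalently $V^\tau\Delta^Df=\mathrm{div}(V^\tau\nabla^Df)$. Distributional conditions: ''$|\nabla^D\rho|=1$ in the sense of distributions'' means that $\rho$ is locally Lipschitz and its (weak) gradient satisfies $|\nabla^D\rho|=1$ almost everywhere. ''$\Delta^D\rho\ge\frac{C}{\rho}V^{\lambda-\mu}$ in the sense of distributions'' means that $-\int_M\langle\nabla\psi,\nabla^D\rho\rangle V^\tau\,dv_g\ge\int_M\frac{C}{\rho}\psi V^{\tau+\lambda-\mu}\,dv_g$ for all nonnegative compactly supported Lipschitz $\psi$ with support in $M\setminus\rho^{-1}\{0\}$. *)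

(* Defs.v *)
From HB Require Import structures.
From mathcomp Require Import all_boot all_order all_algebra.
From mathcomp Require Import all_classical all_reals all_analysis.
Set Implicit Arguments.
Unset Strict Implicit.
Unset Printing Implicit Defensive.
Import Order.TTheory GRing.Theory Num.Theory.
Import numFieldNormedType.Exports.
Local Open Scope classical_set_scope.
Local Open Scope ring_scope.

(* This file uses MathComp and MathComp-Analysis, which have no manifolds.
   The Riemannian notions are introduced through their classical expressions
   in local coordinates; R^n is the space 'rV[R]_n of row vectors. *)

Notation borel T := (g_sigma_algebraType (@open T)).

Section Euclidean.
Context {R : realType} {n : nat}.
Implicit Type f : 'rV[R]_n -> R.

Definition partial (i : 'I_n) f : 'rV[R]_n -> R :=
  fun y => 'D_(delta_mx 0 i) f y.

Definition partials (s : seq 'I_n) f : 'rV[R]_n -> R := foldr partial f s.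

(* C^oo on an open set U: all iterated partial derivatives exist and are
   continuous on U.  The values of f outside U are irrelevant. *)
Definition smooth_on (U : set 'rV[R]_n) f : Prop :=
  forall (s : seq 'I_n) (y : 'rV[R]_n), U y ->
    {for y, continuous (partials s f)} /\
    forall i, derivable (partials s f) y (delta_mx 0 i).

(* Lebesgue measure on the Borel sets of R^n, characterized by its values on
   half-open boxes. *)
Definition is_lebesgue (leb : {measure set (borel 'rV[R]_n) -> \bar R}) : Prop :=
  forall a b : 'rV[R]_n, (forall i, a 0 i <= b 0 i) ->
    leb [set y : 'rV[R]_n | forall i, a 0 i < y 0 i <= b 0 i]
    = (\prod_i (b 0 i - a 0 i))%:E.

End Euclidean.

Section Manifold.
Context (R : realType) (n : nat).

Record chart (M : ptopologicalType) := Chart {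
  chart_dom : set M;
  coord :> M -> 'rV[R]_n;
  param : 'rV[R]_n -> M;
  open_chart_dom : open chart_dom;
  open_chart_image : open (coord @` chart_dom);
  coordK : forall x, chart_dom x -> param (coord x) = x;
  coord_continuous : forall x, chart_dom x -> {for x, continuous coord};
  param_continuous : forall y, (coord @` chart_dom) y -> {for y, continuous param} }.

Definition chart_image (M : ptopologicalType) (c : chart M) : set 'rV[R]_n :=
  c @` chart_dom c.

(* A smooth n-manifold, given by a smooth atlas (not required to be maximal).
   The structure records for each point a preferred chart of the atlas around
   it, in which tangent vectors at that point are expressed. *)
Record manifold := Manifold {
  point_of :> ptopologicalType;
  manifold_hausdorff : hausdorff_space point_of;
  manifold_second_countable : @second_countable point_of;
  atlas : set (chart point_of);
  atlas_smooth : forall c c' : chart point_of, atlas c -> atlas c' ->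
    forall k, smooth_on (c @` (chart_dom c `&` chart_dom c'))
                        (fun y => c' (param c y) 0 k);
  chart_at : point_of -> chart point_of;
  chart_at_atlas : forall x, atlas (chart_at x);
  chart_at_dom : forall x, chart_dom (chart_at x) x }.

Definition smooth (M : manifold) (f : M -> R) : Prop :=
  forall c, atlas c -> smooth_on (chart_image c) (f \o param c).

(* Row i, column k: derivative of the k-th coordinate of c' along the i-th
   coordinate of c.  A tangent vector with components v in c has components
   v *m jac c c' y in c'. *)
Definition jac (M : manifold) (c c' : chart M) (y : 'rV[R]_n) : 'M[R]_n :=
  \matrix_(i, k) partial i (fun z => c' (param c z) 0 k) y.

(* [gram c y] is the matrix (g_ij) of the metric at the point with coordinates
   y in the chart c. *)
Record metric (M : manifold) := Metric {
  gram :> chart M -> 'rV[R]_n -> 'M[R]_n;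
  gram_smooth : forall c, atlas c ->
    forall i j, smooth_on (chart_image c) (fun y => gram c y i j);
  gram_sym : forall c y, atlas c -> chart_image c y -> (gram c y)^T = gram c y;
  gram_posdef : forall c y, atlas c -> chart_image c y ->
    forall v : 'rV[R]_n, v != 0 -> 0 < (v *m gram c y *m v^T) 0 0;
  gram_change : forall (c c' : chart M) (x : M),
    atlas c -> atlas c' -> chart_dom c x -> chart_dom c' x ->
    gram c (c x) = jac c c' (c x) *m gram c' (c' x) *m (jac c c' (c x))^T }.

Section Riemannian.
Context (M : manifold) (g : metric M).
Implicit Types (c : chart M) (f : M -> R) (x : M).

(* Tangent vectors at x are rows of components in the chart [chart_at x]. *)
Definition inner x (v w : 'rV[R]_n) : R :=
  (v *m g (chart_at x) (chart_at x x) *m w^T) 0 0.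

Definition tnorm x (v : 'rV[R]_n) : R := Num.sqrt (inner x v v).

(* Components (g^ij d_j f) of the gradient in the chart c.  The value is 0 where
   f is not differentiable; for a locally Lipschitz f this is a null set
   (Rademacher) and the result is the weak gradient of f. *)
Definition grad_in c f (y : 'rV[R]_n) : 'rV[R]_n :=
  if `[< differentiable (f \o param c) y >] then
    (\row_i partial i (f \o param c) y) *m invmx (g c y)
  else 0.

Definition grad f x : 'rV[R]_n := grad_in (chart_at x) f (chart_at x x).

Definition vol_density c (y : 'rV[R]_n) : R := Num.sqrt (\det (g c y)).

Definition div_in c (X : 'rV[R]_n -> 'rV[R]_n) (y : 'rV[R]_n) : R :=
  (vol_density c y)^-1 *
  \sum_i partial i (fun z => vol_density c z * X z 0 i) y.

Definition laplacian f x : R :=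
  div_in (chart_at x) (grad_in (chart_at x) f) (chart_at x x).

(* dv_g is the Borel measure with density sqrt (det g) with respect to Lebesgue
   measure in every chart. *)
Definition is_riemannian_volume (vol : {measure set (borel M) -> \bar R}) : Prop :=
  exists2 leb : {measure set (borel 'rV[R]_n) -> \bar R}, is_lebesgue leb &
  forall (c : chart M) (A : set (borel M)),
    atlas c -> measurable A -> A `<=` chart_dom c ->
    vol A = (\int[leb]_(y in c @` A) (vol_density c y)%:E)%E.

Definition C1_curve (gamma : R -> M) : Prop :=
  continuous gamma /\
  forall c t, atlas c -> chart_dom c (gamma t) ->
    derivable (c \o gamma) t 1 /\ {for t, continuous (derive1 (c \o gamma))}.

Definition speed (gamma : R -> M) (t : R) : R :=
  tnorm (gamma t) (derive1 (chart_at (gamma t) \o gamma) t).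

Definition curve_length (gamma : R -> M) : \bar R :=
  (\int[lebesgue_measure]_(t in `[0%R, 1%R]) (speed gamma t)%:E)%E.

(* The infimum over C^1 curves is the usual one over piecewise C^1 curves:
   corners are removed by reparametrizing with zero velocity there.
   The value is +oo when x and y lie in different components. *)
Definition dist (x y : M) : \bar R :=
  ereal_inf [set curve_length gamma | gamma in
    [set gamma | [/\ C1_curve gamma, gamma 0 = x & gamma 1 = y]]].

Definition complete_metric : Prop :=
  forall s : nat -> M,
    (forall e : R, 0 < e -> exists N : nat, forall p q : nat,
       (N <= p)%N -> (N <= q)%N -> (dist (s p) (s q) < e%:E)%E) ->
    exists x : M, s @ \oo --> x.

Definition lipschitz_in (A : set M) f : Prop :=
  exists2 K : R, 0 < K & forall x y, A x -> A y ->
    (`|f x - f y|%:E <= K%:E * dist x y)%E.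

Definition locally_lipschitz f : Prop :=
  forall x, exists2 U, nbhs x U & lipschitz_in U f.

(* The support of f is compact and contained in A. *)
Definition compact_support_in (A : set M) f : Prop :=
  compact (closure [set x | f x != 0]) /\ closure [set x | f x != 0] `<=` A.

Section Affine.
Context (u : M -> R) (lambda mu : R).

Definition V x : R := expR (u x).

Definition affine_grad f x : 'rV[R]_n := V x `^ (mu - lambda) *: grad f x.

Definition affine_laplacian f x : R :=
  V x `^ (mu - lambda) *
  (laplacian f x + (2 * mu + n%:R * lambda) * inner x (grad u x) (grad f x)).

Definition tau : R := n.+1%:R * lambda + mu.

Definition affine_eikonal (vol : {measure set (borel M) -> \bar R})
    (rho : M -> R) : Prop :=
  locally_lipschitz rho /\
  {ae vol, forall x : M, tnorm x (affine_grad rho x) = 1}.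

(* affine_laplacian rho >= C / rho * V `^ (lambda - mu) in the sense of
   distributions on the complement of the zero set of rho. *)
Definition affine_laplacian_ge (vol : {measure set (borel M) -> \bar R})
    (C : R) (rho : M -> R) : Prop :=
  forall psi : M -> R,
    (forall x, 0 <= psi x) -> lipschitz_in setT psi ->
    compact_support_in (~` (rho @^-1` [set 0])) psi ->
    (\int[vol]_x (C / rho x * psi x * V x `^ (tau + lambda - mu))%:E
     <= - \int[vol]_x
           (inner x (grad psi x) (affine_grad rho x) * V x `^ tau)%:E)%E.

End Affine.
End Riemannian.
End Manifold.

(* Main.v *)
Require Import Defs.
From HB Require Import structures.
From mathcomp Require Import all_boot all_order all_algebra.
From mathcomp Require Import all_classical all_reals all_analysis.
From mathcomp Require Import measurable_realfun.
From mathcomp Require Import ring lra.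
From mathcomp Require polyrcf.

(* Put b = (C + alpha - 3) / 2, k = b (C - alpha + 1) / 2, L = affine_laplacian phi
   and t = tau.  Testing the hypothesis on rho with rho^(alpha-3) phi^2 gives
     int (rho^(alpha-3) phi <grad phi, grad rho> V^(t+mu-lambda)
            + b rho^(alpha-4) phi^2 V^(t+lambda-mu)) <= 0,
   and integrating rho^(alpha-2) phi L V^t by parts gives
     int (rho^(alpha-2) |grad phi|^2 + (alpha-2) rho^(alpha-3) phi <grad phi, grad rho>)
         V^(t+mu-lambda) = - int rho^(alpha-2) phi L V^t.
   Adding suitable multiples of both to the integral of rho^alpha L^2 V^(t+mu-lambda)
   bounds it below by k^2 int rho^(alpha-4) phi^2 V^(t+lambda-mu): the two integrands
   differ by the squares of rho^2 V^(mu-lambda) L + k phi and |rho grad phi + b phi grad rho|,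
   with positive weights.  Rademacher's theorem is not needed, since rho is
   differentiable wherever |affine_grad rho| = 1, hence off a null set. *)

Set Implicit Arguments.
Unset Strict Implicit.
Unset Printing Implicit Defensive.
Import Order.TTheory GRing.Theory Num.Theory.
Import numFieldNormedType.Exports.
Local Open Scope classical_set_scope.
Local Open Scope ring_scope.

(** * Calculus on R^n *)

(** The constants come from completing squares. Once the eikonal equation removes |grad rho|^2, the
    tested integrand is twice the cross term plus 2b times the weight. Adding 2k times the
    integration by parts and k(C - 1) times the tested inequality gives the cross term the
    coefficient 2k((alpha - 2) + (C - 1)) = 4kb, as the square of rho grad phi + b phi grad rho
    requires; comparing the terms in phi^2 then forces k = b(C - 1 - b). The assumptions on C and
    alpha make both multipliers nonnegative. The rest is regularity. The function rho is Lipschitz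
    for the Riemannian distance while calculus lives in charts, so the two notions are compared in
    both directions. Integration by parts has to accept Lipschitz functions differentiable off a
    null set: it rests on translation invariance of Lebesgue measure and on a partition of unity,
    and gluing requires the divergence to be the same in all charts. Integrability is checked
    throughout, because extended-real integrals can be split and cancelled only when finite. *)

Section EuclideanCalculus.
Context {R : realType} {n : nat}.
Implicit Types (f h : 'rV[R]_n -> R) (w y z : 'rV[R]_n) (U : set 'rV[R]_n).

Local Notation "''e_' i" := (delta_mx 0 i : 'rV[R]_n) (at level 8, i at level 2).

Lemma coord_le_norm y i : `|y 0 i| <= `|y|.
Proof.
rewrite [leRHS]/Num.Def.normr/= mx_normrE.
exact: (@le_bigmax _ _ _ 0 (fun ij : 'I_1 * 'I_n => `|y ij.1 ij.2|) (0, i)).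
Qed.

Lemma norm_le_coord y (r : R) : 0 <= r -> (forall i, `|y 0 i| <= r) -> `|y| <= r.
Proof.
move=> r0 yr; rewrite [leLHS]/Num.Def.normr/= mx_normrE.
by apply: bigmax_le => // -[i j] _ /=; rewrite (ord1 i).
Qed.

Lemma norm_lt_coord y (r : R) : 0 < r -> (forall i, `|y 0 i| < r) -> `|y| < r.
Proof.
move=> r0 yr; rewrite [ltLHS]/Num.Def.normr/= mx_normrE.
by apply: bigmax_lt => // -[i j] _ /=; rewrite (ord1 i).
Qed.

Lemma row_sum_basis y : y = \sum_i y 0 i *: 'e_i.
Proof. exact: row_sum_delta. Qed.

Lemma is_derive_line (W : normedModType R) (f : 'rV[R]_n -> W) z v (t : R) :
  derivable f (z + t *: v) v ->
  is_derive t 1 (fun s : R => f (z + s *: v)) ('D_v f (z + t *: v)).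
Proof.
move=> df.
have E : (fun h : R => h^-1 *: (((fun s : R => f (z + s *: v)) \o shift t) (h *: 1)
           - f (z + t *: v))) =
         (fun h : R => h^-1 *: ((f \o shift (z + t *: v)) (h *: v) - f (z + t *: v))).
  apply/funext => h /=; congr (_ *: (f _ - _)).
  by rewrite [h *: 1]mulr1 scalerDl addrCA.
by split; rewrite /derivable /derive E.
Qed.

Lemma coord_mvt_ge0 f z i (s : R) : 0 <= s ->
  (forall t, 0 <= t <= s -> derivable f (z + t *: 'e_i) 'e_i) ->
  exists2 c, 0 <= c <= s & f (z + s *: 'e_i) - f z = partial i f (z + c *: 'e_i) * s.
Proof.
move=> s0 df.
have D t : 0 <= t <= s ->
    is_derive t 1 (fun s : R => f (z + s *: 'e_i)) (partial i f (z + t *: 'e_i)).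
  by move=> ts; apply: is_derive_line; exact: df.
have [||c cs] := @MVT_segment R (fun s : R => f (z + s *: 'e_i))
    (fun t => partial i f (z + t *: 'e_i)) 0 s s0.
- by move=> t; rewrite in_itv /= => /andP[t0 ts]; apply: D; rewrite !ltW.
- apply: derivable_within_continuous => t; rewrite in_itv /= => ts.
  by have [] := D t ts.
rewrite scale0r addr0 subr0 => E; exists c => //.
Qed.

Lemma ball_convex y z w (r t : R) : 0 <= t <= 1 -> `|z - y| < r -> `|w - y| < r ->
  `|(z + t *: (w - z)) - y| < r.
Proof.
move=> /andP[t0 t1] zr wr.
have -> : z + t *: (w - z) - y = (1 - t) *: (z - y) + t *: (w - y).
  by apply/rowP => k; rewrite !mxE; ring.
apply: (le_lt_trans (ler_normD _ _)); rewrite !normrZ ger0_norm ?subr_ge0//.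
rewrite (ger0_norm t0).
have [->|tn0] := eqVneq t 0; first by rewrite subr0 mul0r addr0 mul1r.
have := ler_wpM2l (_ : 0 <= 1 - t) (ltW zr).
rewrite subr_ge0 => /(_ t1) A.
have tp : 0 < t by rewrite lt_neqAle eq_sym tn0.
have B : t * `|w - y| < t * r by rewrite ltr_pM2l.
by apply: (lt_le_trans (ler_ltD A B)); rewrite -mulrDl subrK mul1r.
Qed.

Lemma coord_increment f y (r a eps : R) i z (s : R) :
  (forall w, `|w - y| < r -> derivable f w 'e_i /\ `|partial i f w - a| <= eps) ->
  `|z - y| < r -> `|(z + s *: 'e_i) - y| < r ->
  `|f (z + s *: 'e_i) - f z - s * a| <= eps * `|s|.
Proof.
move=> Hf.
wlog s0 : z s / 0 <= s.
  move=> W zr sr; have [s0|s0] := leP 0 s; first exact: W.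
  have := W (z + s *: 'e_i) (- s) _ sr; rewrite oppr_ge0 ltW// => /(_ isT).
  have -> : z + s *: 'e_i + - s *: 'e_i = z by rewrite scaleNr addrK.
  move=> /(_ zr).
  rewrite normrN; congr (_ <= _); rewrite -normrN; congr (`|_|); ring.
move=> zr sr.
have I t : 0 <= t <= s -> `|z + t *: 'e_i - y| < r.
  move=> /andP[t0 ts]; have [s00|sn0] := eqVneq s 0.
    have -> : t = 0 by apply/eqP; rewrite eq_le t0 -s00 ts.
    by rewrite scale0r addr0.
  have sp : 0 < s by rewrite lt_neqAle eq_sym sn0.
  have := @ball_convex y z (z + s *: 'e_i) r (t / s) _ zr sr.
  rewrite divr_ge0//= ler_pdivrMr// mul1r => /(_ ts).
  by rewrite [z + s *: _]addrC addrK scalerA divfK.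
have [t /I/Hf[]//|c /I/Hf [_ cE] ->] := @coord_mvt_ge0 f z i s s0.
by rewrite [s * a]mulrC -mulrBl normrM ler_wpM2r.
Qed.

(* Changing the coordinates one at a time from those of [z] to those of [w]. *)
Let hybrid z w (k : nat) : 'rV[R]_n := \row_(i < n) (if (i < k)%N then w 0 i else z 0 i).

(** The step from z to w is cut into n moves along the axes. All intermediate points stay in the
    ball because the norm is the maximum of the coordinates, and each move obeys the one-variable
    mean value theorem. *)
Lemma increment f y (r eps : R) (a : 'I_n -> R) z w :
  0 < r -> 0 <= eps ->
  (forall x i, `|x - y| < r -> derivable f x 'e_i /\ `|partial i f x - a i| <= eps) ->
  `|z - y| < r -> `|w - y| < r ->
  `|f w - f z - \sum_i (w - z) 0 i * a i| <= eps * n%:R * `|w - z|.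
Proof.
move=> r0 eps0 Hf zr wr.
have Hr k : `|hybrid z w k - y| < r.
  apply: norm_lt_coord => // i; rewrite !mxE; case: ifP => _.
    by have := le_lt_trans (coord_le_norm (w - y) i) wr; rewrite !mxE.
  by have := le_lt_trans (coord_le_norm (z - y) i) zr; rewrite !mxE.
have H0 : hybrid z w 0 = z by apply/rowP => i; rewrite mxE.
have Hn : hybrid z w n = w by apply/rowP => i; rewrite mxE ltn_ord.
have HS (k : 'I_n) : hybrid z w k.+1 = hybrid z w k + (w - z) 0 k *: 'e_k.
  apply/rowP => i; rewrite !mxE ltnS leq_eqVlt eqxx/=.
  have [->|ik] := eqVneq i k; first by rewrite eqxx ltnn /= mulr1; ring.
  by rewrite -[(i == k :> nat)]/(i == k) (negbTE ik) /= mulr0 addr0.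
have -> : f w - f z = \sum_(k < n) (f (hybrid z w k.+1) - f (hybrid z w k)).
  rewrite -(big_mkord xpredT (fun k => f (hybrid z w k.+1) - f (hybrid z w k))).
  by rewrite telescope_sumr// H0 Hn.
rewrite -sumrB; apply: le_trans (ler_norm_sum _ _ _) _.
have -> : eps * n%:R * `|w - z| = \sum_(k < n) eps * `|w - z|.
  by rewrite sumr_const card_ord -mulr_natr; ring.
apply: ler_sum => k _; rewrite HS.
have H1 : `|hybrid z w k + (w - z) 0 k *: 'e_k - y| < r by rewrite -HS.
apply: le_trans (@coord_increment f y r (a k) eps k _ _ _ (Hr k) H1) _.
  by move=> x xr; exact: Hf.
by rewrite ler_wpM2l// coord_le_norm.
Qed.

End EuclideanCalculus.

(** * Differentiability and Lipschitz bounds at a point *)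

Section Differentials.
Context {R : realType}.

Lemma diff_eps (V W : normedModType R) (f : V -> W) (L : {linear V -> W}) x :
  continuous L ->
  (forall e : R, 0 < e -> \forall h \near 0, `|f (h + x) - f x - L h| <= e * `|h|) ->
  is_diff x f L.
Proof.
move=> cL fL.
have E : f \o shift x = cst (f x) + L +o_ 0 id.
  apply/eqaddoP => _/posnumP[e]; near=> h.
  have -> : (f \o shift x - (cst (f x) + L)) h = f (h + x) - f x - L h.
    by rewrite opprD addrA.
  by near: h; exact: fL.
have dL : 'd f x = L :> (V -> W) by exact: diff_unique.
have cd : continuous ('d f x) by rewrite dL.
split => //; apply/diff_locallyP; split => //.
by rewrite dL.
Unshelve. all: by end_near. Qed.

Lemma diff_epsE (V W : normedModType R) (f : V -> W) x (e : R) :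
  differentiable f x -> 0 < e ->
  \forall h \near 0, `|f (h + x) - f x - 'd f x h| <= e * `|h|.
Proof.
move=> /diff_locallyP [_] /eqaddoP + e0 => /(_ e e0).
apply: filterS => h.
have -> : (f \o shift x - (cst (f x) + 'd f x)) h = f (h + x) - f x - 'd f x h.
  by rewrite opprD addrA.
by [].
Qed.

Lemma cvg_sumr (I T : Type) (F : set_system T) {FF : Filter F} (r : seq I) (P : pred I)
    (f : I -> T -> R) (a : I -> R) :
  (forall i, P i -> f i x @[x --> F] --> a i) ->
  \sum_(i <- r | P i) f i x @[x --> F] --> \sum_(i <- r | P i) a i.
Proof. exact: (cvg_big add_continuous). Qed.

Lemma near_eq_is_diff (V W : normedModType R) (f g : V -> W) x df :
  {near x, f =1 g} -> is_diff x g df -> is_diff x f df.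
Proof.
move=> fg [dg <-].
apply: diff_eps; first exact: diff_continuous.
move=> e e0; have := diff_epsE dg e0.
have : \forall h \near 0, f (h + x) = g (h + x).
  by move: fg; rewrite (near_shift 0) => fg; apply: filterS fg => h /=; rewrite subr0.
by rewrite (nbhs_singleton fg); apply: filterS2 => h ->.
Qed.

Lemma near_eq_differentiable (V W : normedModType R) (f g : V -> W) x :
  {near x, f =1 g} -> differentiable g x -> differentiable f x.
Proof.
by move=> fg /differentiableP dg; have [] := near_eq_is_diff fg dg.
Qed.

Lemma near_eq_continuous (V W : topologicalType) (f g : V -> W) x :
  {near x, f =1 g} -> {for x, continuous g} -> {for x, continuous f}.
Proof.
move=> fg; have E : f x = g x := nbhs_singleton fg.
rewrite /prop_for /continuous_at -E => cg.
apply: cvg_trans cg; apply: near_eq_cvg.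
by apply: filterS fg => z ->.
Qed.

(** Both points vary near x. This makes the notion stable under composition and lets it bound
    derivatives at the neighbours of x as well. *)
Definition lip_at (V W : normedModType R) (f : V -> W) (x : V) :=
  exists2 K : R, 0 <= K & \forall p \near (x, x), `|f p.1 - f p.2| <= K * `|p.1 - p.2|.

Lemma near_fst (T : topologicalType) (x : T) (P : T -> Prop) :
  (\forall z \near x, P z) -> \forall p \near (x, x), P p.1.
Proof. by move=> Px; exists (P, setT) => /=; [split => //; exact: filterT|case=> ? ? []]. Qed.

Lemma near_snd (T : topologicalType) (x : T) (P : T -> Prop) :
  (\forall z \near x, P z) -> \forall p \near (x, x), P p.2.
Proof. by move=> Px; exists (setT, P) => /=; [split => //; exact: filterT|case=> ? ? []]. Qed.

Lemma near_pair (T T' : topologicalType) (f : T -> T') (x : T) (P : T' * T' -> Prop) :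
  {for x, continuous f} ->
  (\forall p \near (f x, f x), P p) -> \forall p \near (x, x), P (f p.1, f p.2).
Proof.
move=> cf [[A B] /= [A1 B1] AB].
exists (f @^-1` A, f @^-1` B) => /=; first by split; exact: cf.
by move=> [a b] /= [Aa Bb]; exact: AB.
Qed.

Lemma lip_at_continuous (V W : normedModType R) (f : V -> W) x :
  lip_at f x -> {for x, continuous f}.
Proof.
move=> [K K0 [[A B] /= [Ax Bx] AB]].
apply/cvgrPdist_le => e e0.
have K1 : 0 < K + 1 by rewrite ltr_wpDl.
have e1 : 0 < e / (K + 1) by rewrite divr_gt0.
near=> z.
apply: le_trans (AB (x, z) _) _ => /=.
  by split; [exact: nbhs_singleton|near: z].
have : `|x - z| <= e / (K + 1).
  by near: z; exact: (@cvgr_dist_le _ _ _ (nbhs x) _ id x (@cvg_id _ _) _ e1).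
rewrite ler_pdivlMr// => zx; apply: le_trans zx; rewrite mulrC ler_wpM2l//.
by rewrite lerDl.
Unshelve. all: by end_near. Qed.

Lemma near_eq_lip (V W : normedModType R) (f g : V -> W) x :
  {near x, f =1 g} -> lip_at g x -> lip_at f x.
Proof.
move=> fg [K K0 gK]; exists K => //.
have := near_fst fg; have := near_snd fg; move: gK.
by apply: filterS3 => -[a b] /= + -> ->.
Qed.

Lemma lip_at_cst (V W : normedModType R) (c : W) (x : V) : lip_at (fun=> c) x.
Proof. by exists 0 => //; near=> p; rewrite subrr normr0 mul0r. Unshelve. all: by end_near. Qed.

Lemma lip_atD (V W : normedModType R) (f g : V -> W) x :
  lip_at f x -> lip_at g x -> lip_at (fun z => f z + g z) x.
Proof.
move=> [K K0 fK] [L L0 gL]; exists (K + L); first exact: addr_ge0.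
move: fK gL; apply: filterS2 => -[a b] /= fK gL.
rewrite opprD addrACA mulrDl; apply: le_trans (ler_normD _ _) _; exact: lerD.
Qed.

Lemma norm_near_le (V W : normedModType R) (f : V -> W) x :
  {for x, continuous f} -> \forall z \near x, `|f z| <= `|f x| + 1.
Proof.
move=> cf; have /cvgr_dist_le /(_ 1 ltr01) := cf.
apply: filterS => z; rewrite distrC => fz.
by rewrite -lerBlDl (le_trans _ fz)// lerB_dist.
Qed.

Lemma lip_atM (V : normedModType R) (f g : V -> R) x :
  lip_at f x -> lip_at g x -> lip_at (fun z => f z * g z) x.
Proof.
move=> lf lg.
have /norm_near_le/near_fst bf := lip_at_continuous lf.
have /norm_near_le/near_snd bg := lip_at_continuous lg.
move: lf lg => [K K0 fK] [L L0 gL].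
exists ((`|f x| + 1) * L + (`|g x| + 1) * K); first by rewrite addr_ge0// mulr_ge0// addr_ge0.
near=> p.
have -> : f p.1 * g p.1 - f p.2 * g p.2 = f p.1 * (g p.1 - g p.2) + g p.2 * (f p.1 - f p.2) by ring.
apply: le_trans (ler_normD _ _) _; rewrite !normrM mulrDl -!mulrA.
apply: lerD; apply: ler_pM => //; first by near: p.
- by near: p.
- by near: p.
- by near: p.
Unshelve. all: by end_near. Qed.

Lemma lip_at_comp (U V W : normedModType R) (f : U -> V) (g : V -> W) x :
  lip_at f x -> lip_at g (f x) -> lip_at (g \o f) x.
Proof.
move=> lf [L L0 gL].
have gL' : \forall p \near (x, x), `|g (f p.1) - g (f p.2)| <= L * `|f p.1 - f p.2|.
  exact: near_pair (lip_at_continuous lf) gL.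
move: lf => [K K0 fK]; exists (L * K); first exact: mulr_ge0.
near=> p; rewrite /= -mulrA; apply: (@le_trans _ _ (L * `|f p.1 - f p.2|)).
  by near: p.
by rewrite ler_wpM2l//; near: p.
Unshelve. all: by end_near. Qed.

End Differentials.

(** * Functions of class C^1 on open sets *)

Section C1.
Context {R : realType} {n : nat}.
Implicit Types (f h : 'rV[R]_n -> R) (w y z : 'rV[R]_n) (U : set 'rV[R]_n).
Local Notation "''e_' i" := (delta_mx 0 i : 'rV[R]_n) (at level 8, i at level 2).

Definition C1_on U f := forall y, U y -> forall i,
  derivable f y 'e_i /\ {for y, continuous (partial i f)}.

Definition linform (a : 'I_n -> R) (h : 'rV[R]_n) : R := \sum_i h 0 i * a i.

Fact linform_is_linear a : linear (linform a).
Proof.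
move=> k x y; rewrite /linform scaler_sumr -big_split /=.
by apply: eq_bigr => i _; rewrite !mxE mulrDl [k *: _]mulrA.
Qed.
HB.instance Definition _ a := GRing.isLinear.Build R 'rV[R]_n R _ (linform a) (linform_is_linear a).

Lemma continuous_linform a : continuous (linform a).
Proof.
move=> y; apply: (@cvg_sumr R _ _ (nbhs y) _ _ xpredT (fun i (z : 'rV[R]_n) => z 0 i * a i)) => i _; apply: cvgM; last exact: cvg_cst.
exact: (@coord_continuous _ _ _ 0 i y).
Qed.

(** Strict differentiability: fixing one of the two points gives the differential, and the triangle
    inequality gives a local Lipschitz bound. *)
Lemma C1_increment U f y (eps : R) : open U -> C1_on U f -> U y -> 0 < eps ->
  \forall p \near (y, y),
  `|f p.1 - f p.2 - linform (fun i => partial i f y) (p.1 - p.2)| <= eps * `|p.1 - p.2|.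
Proof.
move=> oU Uf Uy e0.
(* The estimate of [increment] loses a factor n; adding 1 covers n = 0. *)
pose e := eps / (n%:R + 1).
have n1 : (0 : R) < n%:R + 1 by rewrite ltr_wpDl.
have e1 : 0 < e by rewrite divr_gt0.
have : \forall w \near y, U w /\ forall i, `|partial i f w - partial i f y| <= e.
  near=> w; split; first by near: w; exact: open_nbhs_nbhs.
  near: w; apply: filter_forall => i.
  have [_ /cvgr_dist_le /(_ _ e1)] := Uf y Uy i.
  by apply: filterS => w; rewrite distrC.
move=> /nbhs_ballP [r /= r0 yr].
exists (ball y r, ball y r) => /=; first by split; exact: nbhsx_ballx.
move=> [w z] /=; rewrite -!ball_normE /= ![`|y - _|]distrC => -[wr zr].
apply: le_trans (@increment R n f y r e (fun i => partial i f y) z w r0 (ltW e1) _ zr wr) _.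
  move=> x i xr; have [|Ux /(_ i)] := yr x; first by rewrite -ball_normE /= distrC.
  by split => //; have [] := Uf x Ux i.
rewrite ler_wpM2r// /e -[leRHS]mulr1 -mulrA ler_wpM2l ?(ltW e0)//.
by rewrite ler_pdivrMl// mulr1 lerDl.
Unshelve. all: by end_near. Qed.

Lemma C1_is_diff U f y : open U -> C1_on U f -> U y ->
  is_diff y f (linform (fun i => partial i f y)).
Proof.
move=> oU Uf Uy; apply: diff_eps; first exact: continuous_linform.
move=> e e0; have [[A B] /= [Ay By] AB] := C1_increment oU Uf Uy e0.
have : \forall h \near (0 : 'rV[R]_n), A (h + y).
  by move: Ay; rewrite -[X in X -> _]/(\forall h \near y, A h) (near_shift 0); apply: filterS => h /=; rewrite subr0.
apply: filterS => h Ah; have := AB (h + y, y); rewrite /= addrK; apply; split => //.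
exact: nbhs_singleton By.
Qed.

Lemma C1_differentiable U f y : open U -> C1_on U f -> U y -> differentiable f y.
Proof. by move=> oU Uf Uy; have [] := C1_is_diff oU Uf Uy. Qed.

Lemma C1_lip U f y : open U -> C1_on U f -> U y -> lip_at f y.
Proof.
move=> oU Uf Uy; pose S := \sum_i `|partial i f y|.
exists (1 + S); first by rewrite addr_ge0// sumr_ge0.
have := C1_increment oU Uf Uy ltr01; apply: filterS => p H.
rewrite -[f p.1 - f p.2](subrK (linform (fun i => partial i f y) (p.1 - p.2))).
apply: le_trans (ler_normD _ _) _; rewrite mulrDl lerD//.
apply: le_trans (ler_norm_sum _ _ _) _; rewrite mulr_suml; apply: ler_sum => i _.
by rewrite normrM mulrC ler_wpM2l// coord_le_norm.
Qed.

Lemma C1_continuous U f y : open U -> C1_on U f -> U y -> {for y, continuous f}.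
Proof. by move=> oU Uf Uy; exact/differentiable_continuous/(C1_differentiable oU Uf). Qed.

Lemma partial_diff f y v : differentiable f y -> 'd f y v = \sum_i v 0 i * partial i f y.
Proof.
move=> df; rewrite {1}(row_sum_basis v) linear_sum /=; apply: eq_bigr => i _.
by rewrite linearZ /= /partial deriveE.
Qed.

(** Difference quotients at nearby points are bounded by the Lipschitz constant, so the partial
    derivatives are locally bounded wherever they exist, without being continuous. *)
Lemma lip_partial_bound f y : lip_at f y ->
  exists K : R, \forall z \near y, forall i, derivable f z 'e_i -> `|partial i f z| <= K.
Proof.
move=> [K K0 [[A B] /= [Ay By] AB]]; exists K.
(* The point z is taken in the interior, so that z + h e_i stays in the region of the Lipschitz
   estimate for small h. *)
have : \forall z \near y, nbhs z (A `&` B).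
  by apply: nbhs_interior; exact: filterI.
apply: filterS => z zAB i df.
apply: (cvgr_to_le (cvg_norm df)).
have : \forall h \near (0 : R)^', A (h *: 'e_i + z).
  have : h *: 'e_i + z @[h --> (0 : R)] --> (0 : R) *: 'e_i + z.
    by apply: cvgD; [apply: cvgZl; exact: cvg_id|exact: cvg_cst].
  rewrite scale0r add0r => /(_ A) H; apply: nbhs_dnbhs; apply: H.
  by apply: filterS zAB => ? [].
have : \forall h \near (0 : R)^', h != 0 by exact: nbhs_dnbhs_neq.
apply: filterS2 => h h0 hA.
rewrite normrZ normfV.
rewrite ler_pdivrMl ?normr_gt0//.
have := AB (h *: 'e_i + z, z); rewrite /= addrK normrZ => H.
apply: le_trans (H _) _; first by split => //; apply: nbhs_singleton; apply: filterS zAB => ? [].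
rewrite mulrCA ler_wpM2l//; rewrite -[leRHS]mulr1 ler_wpM2l//.
by apply: norm_le_coord => // k; rewrite !mxE eqxx; case: eqP => _ /=; rewrite ?normr1 ?normr0.
Qed.

End C1.

Section C1Algebra.
Context {R : realType} {n : nat}.
Implicit Types (f h : 'rV[R]_n -> R) (w y z : 'rV[R]_n) (U : set 'rV[R]_n).
Local Notation "''e_' i" := (delta_mx 0 i : 'rV[R]_n) (at level 8, i at level 2).

Lemma near_open U y : open U -> U y -> \forall z \near y, U z.
Proof. by move=> oU Uy; exact: open_nbhs_nbhs. Qed.

Lemma near_eq_on (T : Type) (f g : 'rV[R]_n -> T) U y :
  open U -> U y -> (forall z, U z -> f z = g z) -> {near y, f =1 g}.
Proof. by move=> oU Uy fg; apply: filterS (near_open oU Uy). Qed.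

Lemma C1_on_eq f h U : open U -> (forall y, U y -> f y = h y) -> C1_on U h -> C1_on U f.
Proof.
move=> oU fh Uh y Uy i; have [dh ch] := Uh y Uy i.
have hf := near_eq_on oU Uy (fun z Uz => esym (fh z Uz)).
split; first exact: near_eq_derivable hf dh.
apply: near_eq_continuous ch; apply: filterS (near_open oU Uy) => z Uz.
by apply: near_eq_derive; apply: near_eq_on oU Uz fh.
Qed.

Lemma C1_on_cst U (c : R) : C1_on U (fun=> c).
Proof.
move=> y Uy i; split; first exact: derivable_cst.
have -> : partial i (fun _ : 'rV[R]_n => c) = cst 0.
  by apply/funext => z; exact: derive_cst.
exact: cst_continuous.
Qed.

Lemma C1_onD U f h : open U -> C1_on U f -> C1_on U h -> C1_on U (fun y => f y + h y).
Proof.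
move=> oU Uf Uh y Uy i; have [df cf] := Uf y Uy i; have [dh ch] := Uh y Uy i.
split; first exact (derivableD df dh).
apply: (@near_eq_continuous _ _ _ (fun z => partial i f z + partial i h z)); last exact (continuousD cf ch).
apply: near_eq_on oU Uy _ => z Uz.
exact (deriveD (proj1 (Uf z Uz i)) (proj1 (Uh z Uz i))).
Qed.

Lemma C1_onM U f h : open U -> C1_on U f -> C1_on U h -> C1_on U (fun y => f y * h y).
Proof.
move=> oU Uf Uh y Uy i; have [df cf] := Uf y Uy i; have [dh ch] := Uh y Uy i.
split; first exact (derivableM df dh).
apply: (@near_eq_continuous _ _ _ (fun z => f z * partial i h z + h z * partial i f z)).
  apply: near_eq_on oU Uy _ => z Uz.
  exact (deriveM (proj1 (Uf z Uz i)) (proj1 (Uh z Uz i))).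
have c1 := continuousM (C1_continuous oU Uf Uy) ch.
have c2 := continuousM (C1_continuous oU Uh Uy) cf.
exact (continuousD c1 c2).
Qed.

Lemma C1_on_sum U (I : Type) (r : seq I) (P : pred I) (F : I -> 'rV[R]_n -> R) : open U ->
  (forall k, P k -> C1_on U (F k)) -> C1_on U (fun y => \sum_(k <- r | P k) F k y).
Proof.
move=> oU UF; elim: r => [|k r IH].
  have -> : (fun y => \sum_(k <- [::] | P k) F k y) = cst 0 by apply/funext => y; rewrite big_nil.
  exact: C1_on_cst.
have -> : (fun y => \sum_(k <- (k :: r) | P k) F k y) =
    fun y => if P k then F k y + \sum_(k <- r | P k) F k y else \sum_(k <- r | P k) F k y.
  by apply/funext => y; rewrite big_cons.
case Pk : (P k); last exact: IH.
exact (C1_onD oU (UF k Pk) IH).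
Qed.

Lemma C1_on_prod U (I : Type) (r : seq I) (P : pred I) (F : I -> 'rV[R]_n -> R) : open U ->
  (forall k, P k -> C1_on U (F k)) -> C1_on U (fun y => \prod_(k <- r | P k) F k y).
Proof.
move=> oU UF; elim: r => [|k r IH].
  have -> : (fun y => \prod_(k <- [::] | P k) F k y) = cst 1 by apply/funext => y; rewrite big_nil.
  exact: C1_on_cst.
have -> : (fun y => \prod_(k <- (k :: r) | P k) F k y) =
    fun y => if P k then F k y * \prod_(k <- r | P k) F k y else \prod_(k <- r | P k) F k y.
  by apply/funext => y; rewrite big_cons.
case Pk : (P k); last exact: IH.
exact (C1_onM oU (UF k Pk) IH).
Qed.

Lemma C1_on_coord U i : C1_on U (fun y => y 0 i).
Proof.
move=> y Uy k; have D z : is_derive z 'e_k (fun x : 'rV[R]_n => x 0 i) ('e_k 0 i).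
  have did := @derivable_id _ 'rV[R]_n z 'e_k.
  split; first exact: (proj1 (derivable_mxP _ _ _) did 0 i).
  by have := derive_mx did; rewrite derive_id => /matrixP/(_ 0 i); rewrite [RHS]mxE => <-.
split; first by have [] := D y.
have -> : partial k (fun y : 'rV[R]_n => y 0 i) = cst ('e_k 0 i).
  by apply/funext => z; have [_] := D z.
exact: cst_continuous.
Qed.

Lemma partial_comp (h : R -> R) f y i : differentiable f y -> derivable h (f y) 1 ->
  derivable (h \o f) y 'e_i /\ partial i (h \o f) y = derive1 h (f y) * partial i f y.
Proof.
move=> df /derivable1_diffP dh; have dc := differentiable_comp df dh.
split; first exact: diff_derivable.
rewrite /partial !deriveE// diff_comp//= deriv1E; last exact/derivable1_diffP.
by rewrite /= [_ *: _]mulrC.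
Qed.

Lemma C1_on_comp (h : R -> R) U f : open U -> C1_on U f ->
  (forall y, U y -> derivable h (f y) 1 /\ {for f y, continuous (derive1 h)}) ->
  C1_on U (h \o f).
Proof.
move=> oU Uf Uh y Uy i; have df z (Uz : U z) := C1_differentiable oU Uf Uz.
have [dh ch] := Uh y Uy.
split; first by have [] := partial_comp i (df y Uy) dh.
apply: (@near_eq_continuous _ _ _ (fun z => derive1 h (f z) * partial i f z)).
  apply: near_eq_on oU Uy _ => z Uz.
  by have [] := partial_comp i (df z Uz) (proj1 (Uh z Uz)).
apply: continuousM; last by have [] := Uf y Uy i.
by apply: continuous_comp => //; exact: differentiable_continuous (df y Uy).
Qed.

Lemma C1_onV U f : open U -> (forall y, U y -> f y != 0) -> C1_on U f ->
  C1_on U (fun y => (f y)^-1).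
Proof.
move=> oU f0 Uf y Uy i; have [df cf] := Uf y Uy i.
have cfy := C1_continuous oU Uf Uy.
split; first exact: derivableV (f0 y Uy) df.
apply: (@near_eq_continuous _ _ _ (fun z => - (f z ^- 2) * partial i f z)).
  apply: near_eq_on oU Uy _ => z Uz.
  by apply: deriveV; [exact: f0|have [] := Uf z Uz i].
apply: continuousM => //; apply: continuousN; apply: continuousV.
  by rewrite expf_neq0// f0.
by apply: continuousM.
Qed.

Lemma smooth_on_C1 U f : smooth_on U f -> C1_on U f.
Proof.
move=> sf y Uy i; have [_ d] := sf [::] y Uy; have [c _] := sf [:: i] y Uy.
by split => //; exact: d.
Qed.

Lemma smooth_on_partial U f i : smooth_on U f -> smooth_on U (partial i f).
Proof.
by move=> sf s y Uy; have := sf (rcons s i) y Uy; rewrite /partials foldr_rcons.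
Qed.

Lemma C1_on_det U m (A : 'rV[R]_n -> 'M[R]_m) : open U ->
  (forall i j, C1_on U (fun y => A y i j)) -> C1_on U (fun y => \det (A y)).
Proof.
move=> oU UA; rewrite /determinant; apply: C1_on_sum => // s _.
apply: C1_onM => //; first exact: C1_on_cst.
by apply: C1_on_prod => // i _; exact: UA.
Qed.

(** By Cramer's formula the entries are cofactors divided by the determinant. *)
Lemma C1_on_inv U m (A : 'rV[R]_n -> 'M[R]_m) : open U ->
  (forall y, U y -> \det (A y) != 0) ->
  (forall i j, C1_on U (fun y => A y i j)) ->
  forall i j, C1_on U (fun y => invmx (A y) i j).
Proof.
move=> oU dA UA i j.
apply: (@C1_on_eq _ (fun y => (\det (A y))^-1 * \adj (A y) i j)) => //.
  by move=> y Uy; rewrite /invmx unitmxE unitfE dA// mxE.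
apply: C1_onM => //; first by apply: C1_onV => //; exact: C1_on_det.
have -> : (fun y => \adj (A y) i j) =
  fun y => (-1) ^+ (j + i) * \det (row' j (col' i (A y))).
  by apply/funext => y; rewrite mxE.
apply: C1_onM => //; first exact: C1_on_cst.
apply: C1_on_det => // k l.
have -> : (fun y => row' j (col' i (A y)) k l) = fun y => A y (lift j k) (lift i l).
  by apply/funext => y; rewrite !mxE.
exact: UA.
Qed.

End C1Algebra.

(** * Positive definite matrices *)

Section PositiveDefinite.
Context {R : realType} {n : nat}.
Implicit Types (G : 'M[R]_n) (v w : 'rV[R]_n).

Definition posdef G := forall v, v != 0 -> 0 < (v *m G *m v^T) 0 0.

Lemma posdef_ge0 G v : posdef G -> 0 <= (v *m G *m v^T) 0 0.
Proof.
move=> pG; have [->|/pG/ltW//] := eqVneq v 0; by rewrite !mul0mx mxE.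
Qed.

(* The characteristic polynomial of [- G] is monic without nonnegative root. *)
Lemma posdef_det_gt0 G : posdef G -> 0 < \det G.
Proof.
move=> pG; pose p := char_poly (- G).
have nr a : 0 <= a -> ~~ root p a.
  move=> a0; apply/negP; rewrite -eigenvalue_root_char => /eigenvalueP[v vE v0].
  have := pG v v0; have -> : v *m G = - a *: v by rewrite scaleNr -vE mulmxN opprK.
  rewrite -scalemxAl mxE mulNr oppr_gt0 ltNge mulr_ge0//.
  rewrite mxE sumr_ge0// => i _; rewrite !mxE -expr2 sqr_ge0//.
have p0 : p.[0] = \det G.
  have dN : \det (- G) = (-1) ^+ n * \det G by rewrite -scaleN1r detZ.
  by rewrite horner_coef0 char_poly_det dN mulrA -expr2 sqrr_sign mul1r.
rewrite -p0 ltNge; apply/negP => p0le.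
have [M pM] : exists M : R, forall x, M <= x -> lead_coef p <= p.[x].
  apply: polyrcf.poly_pinfty_gt_lc; rewrite (monicP (char_poly_monic _)) ltr01//.
have lc : lead_coef p = 1 by exact: (monicP (char_poly_monic _)).
have M0 : 0 <= Num.max 0 M by rewrite le_max lexx.
have [|x /andP[x0 _] rx] := @poly_ivt _ p 0 (Num.max 0 M) M0.
  rewrite p0le /=; apply: le_trans (pM _ _); first by rewrite lc ler01.
  by rewrite le_max lexx orbT.
by move/negP: (nr x x0).
Qed.


Lemma mx11_tr (A : 'M[R]_1) : A^T = A.
Proof. by apply/matrixP => i j; rewrite mxE !ord1. Qed.

Lemma posdef_sym_inner G v w : G^T = G -> (v *m G *m w^T) 0 0 = (w *m G *m v^T) 0 0.
Proof.
by move=> sG; rewrite -[v *m _ *m _]mx11_tr !trmx_mul trmxK sG mulmxA.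
Qed.

Lemma posdef_cauchy_schwarz G v w : G^T = G -> posdef G ->
  (v *m G *m w^T) 0 0 ^+ 2 <= (v *m G *m v^T) 0 0 * (w *m G *m w^T) 0 0.
Proof.
move=> sG pG; have [->|w0] := eqVneq w 0.
  by rewrite trmx0 !mulmx0 !mxE expr0n mulr0.
set a := (v *m G *m v^T) 0 0; set b := (v *m G *m w^T) 0 0; set c := (w *m G *m w^T) 0 0.
have c0 : 0 < c by exact: pG.
(* This vector is c times the component of v orthogonal to w; the scaling avoids a division. *)
have := posdef_ge0 (c *: v - b *: w) pG.
have -> : ((c *: v - b *: w) *m G *m (c *: v - b *: w)^T) 0 0 = c * (a * c - b ^+ 2).
  have -> : (c *: v - b *: w)^T = c *: v^T - b *: w^T by apply/matrixP => i j; rewrite !mxE.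
  rewrite !mulmxBl !mulmxBr -!scalemxAl -!scalemxAr.
  have -> : w *m G *m v^T = v *m G *m w^T.
    by rewrite -[LHS]mx11_tr !trmx_mul trmxK sG mulmxA.
  rewrite /a /b /c; move: (v *m G *m v^T) (v *m G *m w^T) (w *m G *m w^T) => A B C.
  by rewrite !mxE; ring.
by rewrite pmulr_rge0// subr_ge0.
Qed.

End PositiveDefinite.

(** * Integration *)

Section MeasureTransfer.
Local Open Scope ereal_scope.
Context d1 d2 (X : measurableType d1) (Y : measurableType d2) (R : realType).
Variables (mu : {measure set X -> \bar R}) (nu : {measure set Y -> \bar R}).
Variables (D : set X) (E : set Y) (p : Y -> X) (s : Y -> R).
Hypotheses (mD : measurable D) (mE : measurable E) (mp : measurable_fun E p).
Hypotheses (pE : forall y, E y -> D (p y)) (ms : measurable_fun E s).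
Hypothesis s0 : forall y, E y -> (0 <= s y)%R.
Hypothesis mu_density : forall A, measurable A -> A `<=` D ->
  mu A = \int[nu]_(y in E `&` p @^-1` A) (s y)%:E.

Import HBNNSimple.

(** The transfer for one level of a simple function; linearity and monotone limits extend it. *)
Let integral_level (A : set X) (k : R) : (0 <= k)%R -> measurable A ->
  \int[mu]_(x in D) (k * \1_A x)%:E = \int[nu]_(y in E) (k * \1_A (p y) * s y)%:E.
Proof.
move=> k0 mA.
under eq_integral do rewrite EFinM.
rewrite ge0_integralZl_EFin//; last first.
  by apply/measurable_EFinP; exact: measurable_indic.
rewrite integral_indic// setIC mu_density//; last first.
  exact: measurableI.
have -> : E `&` p @^-1` (D `&` A) = E `&` (p @^-1` A).
  by apply/seteqP; split => y /= [] => [Ey [_ Ay]|Ey Ay]//; do 2 split => //; exact: pE.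
rewrite integral_mkcondr.
have -> : (fun y => (s y)%:E) \_ (p @^-1` A) = fun y => (s y * \1_A (p y))%:E.
  by apply/funext => y; rewrite epatch_indic.
have mEA : measurable (E `&` p @^-1` A) by exact: mp.
have mi : measurable_fun E (fun y => \1_A (p y) : R).
  by apply: measurableT_comp => //; exact: measurable_indic.
have mres : measurable_fun E (fun y => (s y * \1_A (p y))%R).
  exact: measurable_funM.
rewrite -ge0_integralZl_EFin//.
- by apply: eq_integral => y _; rewrite /= -!EFinM mulrAC mulrA.
- by move=> y Ey; rewrite lee_fin mulr_ge0// s0.
- exact/measurable_EFinP.
Qed.

(** Simple approximations of f pull back along p to approximations on Y, and monotone convergence
    applies on both sides. With p the inverse of a chart, this turns the description of the volume
    on sets into a formula for integrals. *)
Lemma ge0_integral_transfer (f : X -> \bar R) : measurable_fun D f ->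
  (forall x, D x -> 0 <= f x) ->
  \int[mu]_(x in D) f x = \int[nu]_(y in E) (f (p y) * (s y)%:E).
Proof.
move=> mf f0; pose f_ := nnsfun_approx mD mf.
transitivity (limn (fun n => \int[mu]_(x in D) (f_ n x)%:E)).
  rewrite -monotone_convergence//.
  - apply: eq_integral => y /[!inE] yD; apply/esym/cvg_lim => //.
    exact: cvg_nnsfun_approx.
  - by move=> n; exact/measurable_EFinP/measurable_funTS.
  - by move=> n y _; rewrite lee_fin.
  - by move=> y _ m n mn; rewrite lee_fin; exact/lefP/nd_nnsfun_approx.
have mfp n : measurable_fun E (fun y => f_ n (p y)).
  by apply: measurableT_comp => //.
rewrite [X in limn X](_ : _ = (fun n => \int[nu]_(y in E) (f_ n (p y) * s y)%:E)).
  rewrite -monotone_convergence//; last 3 first.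
  - by move=> n; apply/measurable_EFinP/measurable_funM.
  - by move=> n y Ey; rewrite lee_fin mulr_ge0// s0.
  - move=> y Ey m n mn; rewrite lee_fin ler_wpM2r ?s0//.
    exact/lefP/nd_nnsfun_approx.
  apply: eq_integral => y /[!inE] Ey; apply/cvg_lim => //.
  under eq_fun do rewrite EFinM.
  apply: cvgeZr => //.
  by apply: cvg_nnsfun_approx => //; exact: pE.
apply/funext => n.
have mlev r : measurable (f_ n @^-1` [set r]) by [].
transitivity (\sum_(k \in range (f_ n))
    \int[mu]_(x in D) (k * \1_(f_ n @^-1` [set k]) x)%:E).
  under eq_integral do rewrite fimfunE -fsumEFin//.
  rewrite ge0_integral_fsum//.
  - by move=> y; exact/measurable_EFinP/measurable_funM.
  - by move=> y x _; rewrite nnfun_muleindic_ge0.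
transitivity (\sum_(k \in range (f_ n))
    \int[nu]_(y in E) (k * \1_(f_ n @^-1` [set k]) (p y) * s y)%:E).
  apply: eq_fsbigr => r /[!inE] -[x _ <-].
  by rewrite integral_level.
rewrite -ge0_integral_fsum//.
- apply: eq_integral => y Ey; rewrite [in RHS]fimfunE.
  rewrite fsumEFin//; congr (_%:E).
  rewrite fsbig_finite//= [in RHS]fsbig_finite//= mulr_suml.
  by [].
- move=> r; apply/measurable_EFinP/measurable_funM => //.
  apply: measurable_funM => //.
  by apply: measurableT_comp => //; exact: measurable_indic.
- move=> r y Ey; rewrite EFinM mule_ge0 ?lee_fin ?s0//.
  by have := @nnfun_muleindic_ge0 _ _ _ (f_ n) r (p y); rewrite lee_fin.
Qed.

End MeasureTransfer.

Section NullSets.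
Local Open Scope ereal_scope.
Context d (T : measurableType d) (R : realType) (mu : {measure set T -> \bar R}).

Import HBNNSimple.

(** The integral of a nonnegative function is a supremum over simple functions below it, and cutting
    such a function to the complement of N does not change its integral. Hence f may be
    arbitrary. *)
Let ge0_integral_null_setT (N : set T) (f : T -> \bar R) : measurable N -> mu N = 0 ->
  (forall x, 0 <= f x) -> \int[mu]_x f x = \int[mu]_x (f \_ (~` N)) x.
Proof.
move=> mN N0 f0; rewrite !ge0_integralTE//; last by move=> x; rewrite patchE; case: ifP.
apply/eqP; rewrite eq_le; apply/andP; split; last first.
  apply: ge_ereal_sup => _ [h hf <-]; apply: ereal_sup_ubound; exists h => //= x.
  apply: le_trans (hf x) _; rewrite patchE; case: ifPn => // _; exact: f0.
apply: ge_ereal_sup => _ [h hf <-].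
pose h' : {nnsfun T >-> R} := proj_nnsfun h (measurableC mN).
apply: (@le_trans _ _ (sintegral mu h')); last first.
  apply: ereal_sup_ubound.
  exists h' => //= x; rewrite patchE; case: ifPn => xN.
  - by rewrite mindicE xN mulr1; exact: hf.
  - by rewrite mindicE (negbTE xN) mulr0.
rewrite -!integralT_nnsfun le_eqVlt; apply/orP; left; apply/eqP.
apply: ge0_ae_eq_integral => //.
- by apply/measurable_EFinP.
- by apply/measurable_EFinP.
- by move=> x _; rewrite lee_fin.
- by move=> x _; rewrite lee_fin.
exists N; split => // x /= /not_implyP[_] /eqP xN; apply: contrapT => nN; move/negP: xN; apply.
by rewrite /= mindicE mem_set// mulr1.
Qed.

(** It moves integrals over M to the complement of the set where rho may fail to be differentiable,
    whatever the values of the integrand on that set. *)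
Lemma integral_setD_null (N D : set T) (f : T -> \bar R) : measurable N -> mu N = 0 ->
  \int[mu]_(x in D) f x = \int[mu]_(x in D `\` N) f x.
Proof.
move=> mN N0; rewrite integral_mkcond [RHS]integral_mkcond integralE [RHS]integralE.
rewrite (ge0_integral_null_setT mN N0)// (ge0_integral_null_setT (f := _^\-) mN N0)//.
by rewrite -funepos_restrict -funeneg_restrict -!patch_setI setDE [~` N `&` _]setIC.
Qed.

End NullSets.

Section Borel.
Context {R : realType} (T : ptopologicalType).
Implicit Types (D A : set (borel T)).

Lemma open_borel A : open (A : set T) -> measurable A.
Proof. by move=> oA; exact: sub_sigma_algebra. Qed.

Lemma continuous_on_borel_comp (T' : ptopologicalType) D (f : T -> T') : open (D : set T) ->
  (forall x, D x -> {for x, continuous f}) -> measurable_fun D (f : borel T -> borel T').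
Proof.
move=> oD cf; apply: (@measurability _ _ (borel T) (borel T') D f (@open T') erefl).
move=> _ [B oB <-]; apply: open_borel; rewrite openE => x [Dx Bfx].
apply: filterI; first exact: open_nbhs_nbhs.
exact: (cf x Dx B (open_nbhs_nbhs (conj oB Bfx))).
Qed.

Lemma continuous_on_borel D (f : T -> R) : open (D : set T) ->
  (forall x, D x -> {for x, continuous f}) -> measurable_fun D (f : borel T -> R).
Proof.
move=> oD cf; apply: (measurability _ (RGenOpens.measurableE R)).
move=> _ [_ [a [b ->] <-]]; apply: open_borel; rewrite openE => x [Dx Bfx].
apply: filterI; first exact: open_nbhs_nbhs.
by apply: (cf x Dx); apply: open_nbhs_nbhs; split => //; exact: interval_open.
Qed.

End Borel.

(** * Lebesgue measure on R^n *)

Section Lebesgue.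
Context {R : realType} {n : nat}.
Implicit Types (a b v y : 'rV[R]_n).
Local Notation E := (borel 'rV[R]_n).

Definition box a b : set 'rV[R]_n := [set y | forall i, a 0 i < y 0 i <= b 0 i].
Definition boxes : set (set 'rV[R]_n) :=
  [set A | exists a b, (forall i, a 0 i <= b 0 i) /\ A = box a b].

Lemma measurable_box a b : measurable (box a b : set E).
Proof.
have -> : box a b = \bigcap_(i in [set: 'I_n])
    ([set y : 'rV[R]_n | a 0 i < y 0 i] `&` ~` [set y | b 0 i < y 0 i]).
  apply/seteqP; split => y /=.
    by move=> yab i _; have /andP[? ?] := yab i; split => //=; apply/negP; rewrite -leNgt.
  by move=> H i; have [/= -> /negP] := H i I; rewrite -leNgt => ->.
apply: fin_bigcap_measurable => [|i _]; first exact: finite_finset.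
have O (c : R) : open [set y : 'rV[R]_n | c < y 0 i].
  have -> : [set y : 'rV[R]_n | c < y 0 i] = (fun y : 'rV[R]_n => y 0 i) @^-1` [set x | c < x] by [].
  apply: open_comp; last exact: open_gt.
  by move=> y _; exact: (@coord_continuous _ _ _ 0 i y).
by apply: measurableI; [|apply: measurableC]; apply: open_borel; exact: O.
Qed.

Lemma boxes_setI : setI_closed boxes.
Proof.
move=> _ _ [a [b [ab ->]]] [c [d [cd ->]]].
pose m : 'rV[R]_n := \row_i Num.max (a 0 i) (c 0 i).
(* The outer maximum keeps the corners ordered when the two boxes are disjoint; the intersection is
   then a degenerate, empty box. *)
pose M : 'rV[R]_n := \row_i Num.max (m 0 i) (Num.min (b 0 i) (d 0 i)).
exists m, M; split; first by move=> i; rewrite [M 0 i]mxE le_max lexx.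
apply/seteqP; split => y /=.
  move=> [y1 y2] i; have /andP[h1 h2] := y1 i; have /andP[h3 h4] := y2 i.
  by rewrite !mxE gt_max h1 h3 le_max le_min h2 h4 orbT.
have H' : (forall i, m 0 i < y 0 i <= M 0 i) -> forall i, a 0 i < y 0 i <= b 0 i /\ c 0 i < y 0 i <= d 0 i.
  move=> H i; have := H i; rewrite !mxE => /andP[mi].
  rewrite le_max leNgt mi /= le_min => /andP[-> ->].
  by move: mi; rewrite gt_max => /andP[-> ->].
by move=> /H' H; split => i; have [] := H i.
Qed.

Lemma row_choice (T : choiceType) (P : 'I_n -> T -> Prop) :
  (forall i, exists t, P i t) -> exists r : 'rV[T]_n, forall i, P i (r 0 i).
Proof.
move=> H; have /choice [f fP] := H.
by exists (\row_i f i) => i; rewrite mxE.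
Qed.

(** Rational corners make the union countable, as a sigma-algebra requires. *)
Lemma open_bigcup_box (O : set 'rV[R]_n) : open O ->
  O = \bigcup_(p in [set p : 'rV[rat]_n * 'rV[rat]_n |
     boxes (box (map_mx ratr p.1) (map_mx ratr p.2)) /\
     box (map_mx ratr p.1) (map_mx ratr p.2) `<=` O]) box (map_mx ratr p.1) (map_mx ratr p.2).
Proof.
move=> oO; apply/seteqP; split => [y Oy|y [p [_ pO]]]; last exact: pO.
have /nbhs_ballP [r /= r0 yr] := open_nbhs_nbhs (conj oO Oy).
have [p pP] : exists p : 'rV[rat]_n, forall i, y 0 i - r < ratr (p 0 i) < y 0 i.
  apply: (row_choice (P := fun i t => y 0 i - r < ratr t < y 0 i)) => i; have [|q /=] := @rat_in_itvoo R (y 0 i - r) (y 0 i).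
    by rewrite gtrBl.
  by rewrite in_itv /= => qP; exists q.
have [q qP] : exists q : 'rV[rat]_n, forall i, y 0 i < ratr (q 0 i) < y 0 i + r.
  apply: (row_choice (P := fun i t => y 0 i < ratr t < y 0 i + r)) => i; have [|q /=] := @rat_in_itvoo R (y 0 i) (y 0 i + r).
    by rewrite ltrDl.
  by rewrite in_itv /= => qP; exists q.
exists (p, q) => /=; last first.
  by move=> i; rewrite !mxE; have /andP[_ ->] := pP i; have /andP[/ltW -> _] := qP i.
split.
  exists (map_mx ratr p), (map_mx ratr q); split => // i; rewrite !mxE.
  by have /andP[_ /ltW h1] := pP i; have /andP[/ltW h2 _] := qP i; exact: le_trans h2.
move=> z zpq; apply: yr; rewrite -ball_normE /=; apply: norm_lt_coord => // i.
have := zpq i; rewrite !mxE; have := pP i; have := qP i.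
by move=> /andP[q1 q2] /andP[p1 p2] /andP[z1 z2]; rewrite ltr_norml; apply/andP; split; lra.
Qed.

Lemma borel_boxes : (@measurable _ E) = <<s boxes>>.
Proof.
apply/seteqP; split; last first.
  apply: smallest_sub; first exact: sigma_algebra_measurable.
  by move=> _ [a [b [_ ->]]]; exact: measurable_box.
apply: smallest_sub; first exact: smallest_sigma_algebra.
move=> O /open_bigcup_box ->; set D := (D in bigcup D _).
rewrite bigcup_mkcond.
apply: (@countable_bigcupT_measurable _ (g_sigma_algebraType boxes)) => [|p].
  exact: countableP.
case: ifPn => pD; last exact: measurable0.
by apply: sub_sigma_algebra; have [] := set_mem pD.
Qed.

Variable leb : {measure set E -> \bar R}.
Hypothesis hleb : is_lebesgue leb.

Lemma leb_box a b : (forall i, a 0 i <= b 0 i) ->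
  leb (box a b) = (\prod_i (b 0 i - a 0 i))%:E.
Proof. exact: hleb. Qed.

Lemma measurable_shift v : measurable_fun setT ((fun y => y + v) : E -> E).
Proof.
apply: (@continuous_on_borel_comp 'rV[R]_n 'rV[R]_n setT); first exact: openT.
by move=> y _; exact: (@cvgD _ _ _ (nbhs y) _ id (cst v) y v (@cvg_id _ _) (@cvg_cst _ _ _ _ _)).
Qed.

(** Only the values on boxes are prescribed. The measure and its translate agree on boxes, which are
    stable under intersection, generate the Borel sets and exhaust the space with finite measure, so
    uniqueness of measures applies. *)
Lemma leb_shift v (A : set E) : measurable A -> leb ((fun y => y + v) @^-1` A) = leb A.
Proof.
move=> mA; symmetry; pose c (k : R) : 'rV[R]_n := const_mx k.
pose g k := box (c (- k%:R)) (c k%:R).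
have cc k : forall i : 'I_n, c (- k%:R) 0 i <= c k%:R 0 i.
  by move=> i; rewrite !mxE; apply: (@le_trans _ _ 0); rewrite ?oppr_le0 ?ler0n.
apply: (@measure_unique _ R E boxes g borel_boxes boxes_setI _ _ leb
  (@measure_function_pushforward__canonical__measure_function_Measure _ _ E E R leb (fun y => y + v) (measurable_shift v))) => //.
- by move=> k; exists (c (- k%:R)), (c k%:R).
- apply/seteqP; split => // y _; exists (Num.truncn `|y|).+1 => // i; rewrite !mxE.
  have yk : `|y| < (Num.truncn `|y|).+1%:R by exact: truncnS_gt.
  have := le_lt_trans (coord_le_norm y i) yk; rewrite ltr_norml => /andP[-> /ltW //].
- move=> _ [a [b [ab ->]]].
  change (leb (box a b) = leb ((fun y => y + v) @^-1` box a b)).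
  have -> : (fun y => y + v) @^-1` box a b = box (a - v) (b - v).
    by apply/seteqP; split => y /= H i; have := H i; rewrite !mxE ltrBlDr lerBrDr.
  rewrite !leb_box//; last by move=> i; rewrite !mxE lerD2r.
  by congr (_%:E); apply: eq_bigr => i _; rewrite !mxE; ring.
- by move=> k; rewrite leb_box// ltry.
Qed.

Lemma ge0_integral_shift v (f : 'rV[R]_n -> \bar R) : measurable_fun setT (f : E -> \bar R) ->
  (forall y, 0 <= f y)%E ->
  (\int[leb]_y f ((y : 'rV[R]_n) + v)%R = \int[leb]_y f y)%E.
Proof.
move=> mf f0; have := ge0_integral_pushforward (measurable_shift v) leb measurableT mf (fun y _ => f0 y).
rewrite preimage_setT /= => <-.
by apply: eq_measure_integral => [|mf' A mA _]; [exact: measurable_shift|exact (leb_shift v mA)].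
Qed.

Lemma leb_bounded_lty (A : set E) (r : R) : measurable A -> (forall y, A y -> `|y| < r) -> (leb A < +oo)%E.
Proof.
move=> mA Ar; pose c (k : R) : 'rV[R]_n := const_mx k.
have [r0|r0] := leP r 0.
  have -> : A = set0.
    by apply/seteqP; split => // y /Ar; rewrite ltNge (le_trans r0).
  by rewrite measure0.
apply: (@le_lt_trans _ _ (leb (box (c (- r)) (c r)))); last first.
  by rewrite leb_box ?ltry// => i; rewrite !mxE ge0_cp// ltW.
apply: le_measure; rewrite ?inE//; first exact: measurable_box.
move=> y /Ar yr i; rewrite !mxE; have := le_lt_trans (coord_le_norm y i) yr.
by rewrite ltr_norml => /andP[-> /ltW ->].
Qed.

Lemma leb_ball_gt0 y (r : R) : 0 < r -> (0 < leb (ball y r : set E))%E.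
Proof.
move=> r0; pose c (k : R) : 'rV[R]_n := const_mx k.
have h : forall i, (y - c (r / 2)) 0 i <= (y + c (r / 2)) 0 i.
  by move=> i; rewrite !mxE; lra.
apply: (@lt_le_trans _ _ (leb (box (y - c (r / 2)) (y + c (r / 2))))).
  rewrite leb_box// lte_fin prodr_gt0// => i _; rewrite !mxE; lra.
apply: le_measure; rewrite ?inE//; [exact: measurable_box|apply: open_borel; exact: ball_open|].
move=> z zb; rewrite -ball_normE /=; apply: norm_lt_coord => // i.
by have := zb i; rewrite !mxE ltr_norml => /andP[h1 h2]; apply/andP; split; lra.
Qed.

End Lebesgue.

Lemma bounded_integrable d (T : measurableType d) (R : realType)
    (mu : {measure set T -> \bar R}) (D A : set T) (f : T -> R) (B : R) :
  measurable D -> measurable A -> (mu A < +oo)%E -> measurable_fun D f ->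
  (forall x, D x -> `|f x| <= B) -> (forall x, D x -> ~ A x -> f x = 0) ->
  mu.-integrable D (EFin \o f).
Proof.
move=> mD mA Aoo mf fB fA; apply/integrableP; split; first exact/measurable_EFinP.
apply: (@le_lt_trans _ _ (\int[mu]_(x in D) (`|B| * \1_A x)%:E)%E).
  apply: ge0_le_integral => //.
  - by apply/measurable_EFinP; exact: measurableT_comp.
  - by apply/measurable_EFinP/measurable_funM => //; exact: measurable_indic.
  - move=> x Dx /=; rewrite lee_fin indicE; case: (boolP (x \in A)) => xA.
      by rewrite mulr1 (le_trans (fB x Dx))// ler_norm.
    by rewrite fA// ?normr0 ?mulr0// => Ax; rewrite mem_set in xA.
under eq_integral do rewrite EFinM.
rewrite ge0_integralZl_EFin//; last by apply/measurable_EFinP; exact: measurable_indic.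
rewrite integral_indic// lte_mul_pinfty//.
by apply: le_lt_trans Aoo; apply: le_measure; rewrite ?inE//; exact: measurableI.
Qed.

(** * Vanishing of the integral of a partial derivative *)

Section PartialIntegral.
Context {R : realType} {n : nat}.
Local Notation E := (borel 'rV[R]_n).
Local Notation "''e_' i" := (delta_mx 0 i : 'rV[R]_n) (at level 8, i at level 2).
Variable leb : {measure set E -> \bar R}.
Hypothesis hleb : is_lebesgue leb.

Lemma integral_shift v (f : 'rV[R]_n -> \bar R) : measurable_fun setT (f : E -> \bar R) ->
  (\int[leb]_y f ((y : 'rV[R]_n) + v)%R = \int[leb]_y f y)%E.
Proof.
move=> mf; rewrite integralE [RHS]integralE; congr (_ - _)%E.
  rewrite -(@ge0_integral_shift _ _ leb hleb v _ (measurable_funepos mf))//.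
  by apply: eq_integral => y _; rewrite !funeposE.
rewrite -(@ge0_integral_shift _ _ leb hleb v _ (measurable_funeneg mf))//.
  by apply: eq_integral => y _; rewrite !funenegE.
Qed.

Lemma ball0E (r : R) : ball (0 : 'rV[R]_n) r = [set y | `|y| < r].
Proof. by rewrite -ball_normE; apply/seteqP; split => y /=; rewrite sub0r normrN. Qed.

Lemma integrable_bounded_support (A : set E) (f : E -> R) (B r : R) :
  measurable A -> measurable_fun A f -> (forall y, A y -> `|f y| <= B) ->
  (forall y : 'rV[R]_n, A y -> r <= `|y| -> f y = 0) -> leb.-integrable A (EFin \o f).
Proof.
move=> mA mf fB fr.
pose D : set E := [set y : 'rV[R]_n | `|y| < r].
have mb : measurable D by rewrite /D -ball0E; apply: open_borel; exact: ball_open.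
apply: (bounded_integrable mA mb _ mf fB); first exact: (leb_bounded_lty hleb mb (r := r)).
by move=> y Ay /negP; rewrite -leNgt; exact: fr.
Qed.

(* The difference quotients have integral zero by translation invariance; they
   are bounded by [L] and converge to the partial derivative. *)
Lemma integral_partial_eq0 (W : 'rV[R]_n -> R) i (N : set E) (B L delta r : R) :
  continuous W -> (forall y, `|W y| <= B) -> (forall y, r <= `|y| -> W y = 0) ->
  0 < delta -> (forall y (h : R), `|h| < delta -> `|W (y + h *: 'e_i) - W y| <= L * `|h|) ->
  measurable N -> leb N = 0 -> (forall y, ~ N y -> derivable W y 'e_i) ->
  leb.-integrable (~` N) (fun y => (partial i W y)%:E) /\
  (\int[leb]_(y in ~` N) (partial i W y)%:E = 0)%E.
Proof.
move=> cW WB Wr d0 WL mN N0 dW.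
(* These steps tend to 0, never vanish, and stay below delta, where the Lipschitz estimate for W is
   available. *)
pose h m : R := delta / 2 * harmonic m.
have h0 m : 0 < h m by rewrite mulr_gt0 ?divr_gt0// invr_gt0.
have hd m : `|h m| < delta.
  rewrite gtr0_norm// /h; apply: (@le_lt_trans _ _ (delta / 2)); last lra.
  by rewrite -[leRHS]mulr1 ler_wpM2l ?divr_ge0 ?(ltW d0)// /harmonic /= invf_le1 ?ler1n// ltr0n.
pose q m (y : E) : R := (h m)^-1 * (W ((y : 'rV[R]_n) + h m *: 'e_i) - W y).
have mW : measurable_fun setT (W : E -> R).
  by apply: (@continuous_on_borel R 'rV[R]_n setT W openT) => y _; exact: cW.
have mWs m : measurable_fun setT (fun y : E => W ((y : 'rV[R]_n) + h m *: 'e_i)).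
  by apply: (measurableT_comp mW); exact: measurable_shift.
have mq m : measurable_fun setT (q m).
  by apply: measurable_funM => //; exact: measurable_funB.
have far m (y : 'rV[R]_n) : r + delta <= `|y| -> r <= `|y + h m *: 'e_i|.
  move=> yr; have := ler_normB (y + h m *: 'e_i) (h m *: 'e_i).
  rewrite addrK => /(le_trans yr) H.
  have : `|(h m *: 'e_i : 'rV[R]_n)| <= delta.
    Unset Printing All.
    rewrite normrZ; apply: le_trans (ltW (hd m)); rewrite -[leRHS]mulr1 ler_wpM2l//.
    by apply: norm_le_coord => // k; rewrite !mxE eqxx; case: eqP => _ /=; rewrite ?normr1 ?normr0.
  by move: H; lra.
have iW : leb.-integrable setT (fun y : E => (W y)%:E).
  exact: (integrable_bounded_support measurableT mW (fun y _ => WB y) (fun y _ => Wr y)).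
have iWs m : leb.-integrable setT (fun y : E => (W ((y : 'rV[R]_n) + h m *: 'e_i))%:E).
  apply: (integrable_bounded_support (B := B) (r := r + delta) measurableT (mWs m)) => //.
  by move=> y _ yr; apply: Wr; exact: far.
have q0 m : (\int[leb]_(y in ~` N) (q m y)%:E = 0)%E.
  have -> : (\int[leb]_(y in ~` N) (q m y)%:E = \int[leb]_y (q m y)%:E)%E.
    by rewrite [RHS](integral_setD_null _ _ mN N0) setTD.
  under eq_integral do rewrite EFinM EFinB.
  rewrite integralZl//; last exact: (integrableB measurableT (iWs m) iW).
  have sh : (\int[leb]_y (W ((y : 'rV[R]_n) + h m *: 'e_i))%:E = \int[leb]_y (W y)%:E)%E.
    by apply: (@integral_shift _ (fun y => (W y)%:E)); exact/measurable_EFinP.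
  rewrite integralB_EFin//; last exact: iWs.
  transitivity (((h m)^-1)%:E * (\int[leb]_y (W y)%:E - \int[leb]_y (W y)%:E))%E.
    by congr (_ * (_ - _))%E; exact: sh.
  by rewrite subee ?mule0//; apply: integrable_fin_num.
have mNC : measurable (~` N) by exact: measurableC.
have hcvg : h @ \oo --> (0 : R)^'.
  have hc : h @ \oo --> (0 : R).
    rewrite -[X in _ --> X](mulr0 (delta / 2)).
    by apply: cvgM; [exact: cvg_cst|exact: cvg_harmonic].
  move=> P P0; have : \forall k \near \oo, (h k != 0 -> P (h k)) by exact: (hc _ P0).
  by apply: filterS => k; apply; exact: lt0r_neq0 (h0 k).
have qcvg y : ~ N y -> q ^~ y @ \oo --> partial i W y.
  move=> /dW dWy.
  have -> : q ^~ y = (fun k : R => k^-1 *: ((W \o shift y) (k *: 'e_i) - W y)) \o h.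
    by apply/funext => k; rewrite /q /= [h k *: _ + _]addrC.
  exact: cvg_comp hcvg dWy.
have mp : measurable_fun (~` N) (partial i W : E -> R).
  apply: (measurable_fun_cvg (h := q) _ qcvg).
  by move=> m; exact: measurable_funTS.
(* A shift by less than delta moves the support into the ball of radius r + delta, so L times the
   indicator of this ball dominates all the quotients. *)
pose A : set E := [set y : 'rV[R]_n | `|y| < r + delta].
have mA : measurable A by rewrite /A -ball0E; apply: open_borel; exact: ball_open.
have Aoo : (leb A < +oo)%E by exact: (leb_bounded_lty hleb mA (r := r + delta)).
have [] := @dominated_convergence _ E R leb (~` N) mNC (fun m y => (q m y)%:E)
  (fun y => (partial i W y)%:E) (fun y => (L * \1_A y)%:E).
- by move=> m; apply/measurable_EFinP/measurable_funTS.
- exact/measurable_EFinP.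
- by apply: aeW => y yN; apply: cvg_EFin; [exact: nearW|exact: qcvg].
- apply: (bounded_integrable (B := `|L|) mNC mA Aoo).
  + by apply: measurable_funM => //; exact: measurable_indic.
  + by move=> y _; rewrite indicE normrM; case: (y \in A); rewrite ?normr1 ?mulr1 ?normr0 ?mulr0.
  + by move=> y _ yA; rewrite indicE memNset// mulr0.
- apply: aeW => y m yN; rewrite lee_fin indicE; case: (boolP (y \in A)) => yA.
    rewrite mulr1 /q normrM normfV ler_pdivrMl ?normr_gt0 ?gt_eqF//.
    by rewrite mulrC; exact: WL.
  move: yA; rewrite notin_setE /A /= => /negP; rewrite -leNgt => yA.
  have W1 : W y = 0 by apply: Wr; apply: le_trans yA; rewrite lerDl ltW.
  have W2 : W ((y : 'rV[R]_n) + h m *: 'e_i) = 0 by apply: Wr; exact: far.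
  by rewrite mulr0 /q W1 W2 subrr mulr0 normr0.
move=> ip _; rewrite /=; under eq_fun do rewrite q0.
by move=> /cvg_lim; rewrite lim_cst// => ->.
Qed.

End PartialIntegral.

(** * Charts *)

Section RowValued.
Context {R : realType} {n : nat}.

Lemma cvg_row (T : Type) (F : set_system T) {FF : Filter F} (f : T -> 'rV[R]_n) (l : 'rV[R]_n) :
  (forall k, f z 0 k @[z --> F] --> l 0 k) -> f @ F --> l.
Proof.
move=> fl; apply/cvgrPdist_le => e e0.
have : \forall z \near F, forall k, `|l 0 k - f z 0 k| <= e.
  by apply: filter_forall => k; have /cvgrPdist_le /(_ e e0) := fl k.
apply: filterS => z Hz; apply: norm_le_coord; first exact: ltW.
by move=> k; rewrite !mxE.
Qed.

Lemma continuous_mulmxr m (J : 'M[R]_(m, n)) : continuous (mulmxr J : 'rV[R]_m -> 'rV[R]_n).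
Proof.
move=> v; apply: (@cvg_row _ (nbhs v)) => k /=.
have -> : (fun z : 'rV[R]_m => (z *m J) 0 k) = fun z => \sum_i z 0 i * J i k.
  by apply/funext => z; rewrite mxE.
rewrite mxE; apply: (@cvg_sumr R _ _ (nbhs v) _ _ xpredT (fun i (z : 'rV[R]_m) => z 0 i * J i k)) => i _.
by apply: cvgM; [exact: (@coord_continuous _ _ _ 0 i v)|exact: cvg_cst].
Qed.

Lemma is_diff_row m (T : 'rV[R]_m -> 'rV[R]_n) y (J : 'M[R]_(m, n)) :
  (forall k, differentiable (fun z => T z 0 k) y) ->
  (forall i k, partial i (fun z => T z 0 k) y = J i k) ->
  is_diff y T (mulmxr J).
Proof.
move=> dT JE; apply: diff_eps; first exact: continuous_mulmxr.
move=> e e0; have : \forall h \near (0 : 'rV[R]_m), forall k,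
    `|T (h + y) 0 k - T y 0 k - 'd (fun z => T z 0 k) y h| <= e * `|h|.
  exact: (filter_forall (nbhs_filter (0 : 'rV[R]_m)) (fun k => diff_epsE (dT k) e0)).
apply: filterS => h Hh; apply: norm_le_coord; first by rewrite mulr_ge0// ltW.
move=> k; have := Hh k; rewrite partial_diff// !mxE; congr (`|_ - _| <= _).
by apply: eq_bigr => i _; rewrite JE.
Qed.

Lemma lip_row (W : normedModType R) (T : W -> 'rV[R]_n) (y : W) :
  (forall k, lip_at (fun z => T z 0 k) y) -> lip_at T y.
Proof.
move=> lT; have /choice [K KP] : forall k, exists K : R, 0 <= K /\
    \forall p \near (y, y), `|T p.1 0 k - T p.2 0 k| <= K * `|p.1 - p.2|.
  by move=> k; have [K K0 H] := lT k; exists K.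
exists (\sum_k K k); first by apply: sumr_ge0 => k _; have [] := KP k.
have : \forall p \near (y, y), forall k, `|T p.1 0 k - T p.2 0 k| <= K k * `|p.1 - p.2|.
  exact: (filter_forall (nbhs_filter (y, y)) (fun k => proj2 (KP k))).
apply: filterS => p Hp; apply: norm_le_coord.
  by rewrite mulr_ge0// sumr_ge0// => k _; have [] := KP k.
move=> k; rewrite !mxE; apply: le_trans (Hp k) _; rewrite ler_wpM2r//.
rewrite (bigD1 k)//= lerDl sumr_ge0// => j _; by have [] := KP j.
Qed.

End RowValued.

Section Charts.
Context {R : realType} {n : nat} {M : manifold R n}.
Implicit Types (c : chart R n M) (x : M).

Definition overlap c c' : set 'rV[R]_n := c @` (chart_dom c `&` chart_dom c').

Lemma chart_imageE c x : chart_dom c x -> chart_image c (c x).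
Proof. by move=> cx; exists x. Qed.

Lemma paramK c y : chart_image c y -> c (param c y) = y.
Proof. by move=> [x cx <-]; rewrite coordK. Qed.

Lemma param_dom c y : chart_image c y -> chart_dom c (param c y).
Proof. by move=> [x cx <-]; rewrite coordK. Qed.

Lemma near_dom c x : chart_dom c x -> \forall z \near x, chart_dom c z.
Proof. by move=> cx; apply: open_nbhs_nbhs; split => //; exact: open_chart_dom. Qed.

Lemma near_image c y : chart_image c y -> \forall z \near y, chart_image c z.
Proof. by move=> cy; apply: near_open => //; exact: open_chart_image. Qed.

Lemma near_chart c x (P : 'rV[R]_n -> Prop) : chart_dom c x ->
  (\forall y \near c x, P y) -> \forall z \near x, P (c z).
Proof. by move=> cx; exact: (Defs.coord_continuous cx). Qed.

Lemma near_param c x (P : M -> Prop) : chart_dom c x ->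
  (\forall z \near x, P z) -> \forall y \near c x, P (param c y).
Proof.
move=> cx Px; have := param_continuous (chart_imageE cx).
by rewrite /prop_for /continuous_at coordK// => /(_ _ Px).
Qed.

Lemma overlapE c c' y : overlap c c' y <-> chart_image c y /\ chart_dom c' (param c y).
Proof.
split => [[x [cx c'x] <-]|[cy c'y]]; first by rewrite coordK//; split => //; exact: chart_imageE.
by exists (param c y); [split => //; exact: param_dom|exact: paramK].
Qed.

Lemma open_overlap c c' : open (overlap c c').
Proof.
rewrite openE => y [x [cx c'x] <-]; rewrite /interior.
have H1 := near_image (chart_imageE cx); have H2 := near_param cx (near_dom c'x).
by apply: filterS2 H1 H2 => z z1 z2; apply/overlapE; split.
Qed.

Lemma overlap_in c c' x : chart_dom c x -> chart_dom c' x -> overlap c c' (c x).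
Proof. by move=> cx c'x; exists x. Qed.

Lemma transition_C1 c c' k : atlas c -> atlas c' ->
  C1_on (overlap c c') (fun y => c' (param c y) 0 k).
Proof. by move=> ac ac'; apply: smooth_on_C1; exact: atlas_smooth. Qed.

Lemma transition_is_diff c c' y : atlas c -> atlas c' -> overlap c c' y ->
  is_diff y (fun z => c' (param c z)) (mulmxr (jac c c' y)).
Proof.
move=> ac ac' oy; apply: is_diff_row => [k|i k]; last by rewrite mxE.
exact: C1_differentiable (@open_overlap c c') (transition_C1 k ac ac') oy.
Qed.

Lemma transition_lip c c' y : atlas c -> atlas c' -> overlap c c' y ->
  lip_at (fun z => c' (param c z)) y.
Proof.
move=> ac ac' oy; apply: lip_row => k.
exact: C1_lip (@open_overlap c c') (transition_C1 k ac ac') oy.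
Qed.

(* In the chart [c], the representative of [f] factors through that in [c']. *)
Lemma transition_factor (T : Type) (f : M -> T) c c' x : chart_dom c x -> chart_dom c' x ->
  {near c x, f \o param c =1 (f \o param c') \o (fun z => c' (param c z))}.
Proof.
move=> cx c'x; have H := near_param cx (near_dom c'x).
by apply: filterS H => y yc' /=; rewrite coordK.
Qed.

Definition mdiff (f : M -> R) x := differentiable (f \o param (chart_at x)) (chart_at x x).

Definition dvec c (f : M -> R) (y : 'rV[R]_n) : 'rV[R]_n := \row_i partial i (f \o param c) y.

(** The chain rule for the transition map. It makes differentiability independent of the preferred
    chart used in [mdiff]. *)
Lemma change_is_diff (W : normedModType R) (f : M -> W) c c' x : atlas c -> atlas c' -> chart_dom c x -> chart_dom c' x ->
  differentiable (f \o param c') (c' x) ->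
  is_diff (c x) (f \o param c) (fun v => 'd (f \o param c') (c' x) (v *m jac c c' (c x))).
Proof.
move=> ac ac' cx c'x df.
apply: near_eq_is_diff (transition_factor f cx c'x) _.
have dT := transition_is_diff ac ac' (overlap_in cx c'x).
have dF : is_diff (c' (param c (c x))) (f \o param c') ('d (f \o param c') (c' x)).
  by rewrite coordK//; exact: differentiableP.
exact (is_diff_comp dT dF).
Qed.

Lemma mdiff_chart f c x : atlas c -> chart_dom c x -> mdiff f x -> differentiable (f \o param c) (c x).
Proof.
move=> ac cx df.
by have [] := change_is_diff ac (chart_at_atlas x) cx (chart_at_dom x) df.
Qed.

Lemma chart_mdiff f c x : atlas c -> chart_dom c x -> differentiable (f \o param c) (c x) -> mdiff f x.
Proof.
move=> ac cx df.
by have [] := change_is_diff (chart_at_atlas x) ac (chart_at_dom x) cx df.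
Qed.

(** The components of a differential form a covector; written as a row, it is multiplied by the
    transposed Jacobian where vectors are multiplied by the Jacobian itself in the other
    direction. *)
Lemma dvec_change f c c' x : atlas c -> atlas c' -> chart_dom c x -> chart_dom c' x ->
  mdiff f x -> dvec c f (c x) = dvec c' f (c' x) *m (jac c c' (c x))^T.
Proof.
move=> ac ac' cx c'x mf; have df' := mdiff_chart ac' c'x mf; have df := mdiff_chart ac cx mf.
apply/rowP => i; rewrite !mxE /partial deriveE//.
have [_ ->] := change_is_diff ac ac' cx c'x df'.
rewrite partial_diff//; apply: eq_bigr => k _; rewrite !mxE mulrC; congr (_ * _).
rewrite (bigD1 i)//= big1 ?addr0 => [|j ji]; rewrite !mxE eqxx ?eqxx ?mul1r//.
by rewrite (negbTE ji) mul0r.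
Qed.

Lemma mdiffD f h x : mdiff f x -> mdiff h x -> mdiff (fun z => f z + h z) x.
Proof. by move=> df dh; exact: (differentiableD df dh). Qed.

Lemma mdiffM f h x : mdiff f x -> mdiff h x -> mdiff (fun z => f z * h z) x.
Proof. by move=> df dh; exact: (differentiableM df dh). Qed.

Lemma mdiff_eq f h x : (\forall z \near x, f z = h z) -> mdiff h x -> mdiff f x.
Proof.
move=> fh; apply: near_eq_differentiable; exact: (near_param (chart_at_dom x) fh).
Qed.

Lemma smooth_mdiff f x : smooth f -> mdiff f x.
Proof.
move=> sf; apply: (C1_differentiable (@open_chart_image _ _ _ (chart_at x))).
  by apply: smooth_on_C1; apply: sf; exact: chart_at_atlas.
exact/chart_imageE/chart_at_dom.
Qed.

End Charts.

(** * The metric in charts *)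

Section ScalarFunctions.
Context {R : realType}.

Lemma lip_at_scalar (h h' : R -> R) (a : R) :
  (\forall t \near a, is_derive (t : R) 1 h (h' t)) -> {for a, continuous h'} -> lip_at h a.
Proof.
move=> dh /norm_near_le bh.
have [r /= r0 ar] : \forall t \near a, is_derive (t : R) 1 h (h' t) /\ `|h' t| <= `|h' a| + 1.
  by near=> t; split; near: t.
exists (`|h' a| + 1); first by rewrite addr_ge0.
exists (ball a r, ball a r) => /=; first by split; exact: nbhsx_ballx.
move=> [x y] /=; wlog xy : x y / x <= y.
  move=> W [xr yr]; have [xy|/ltW xy] := leP x y; first exact: W.
  by rewrite distrC (distrC x); exact: W.
rewrite -!ball_normE /= => -[xr yr].
have I t : t \in `[x, y]%R -> is_derive (t : R) 1 h (h' t) /\ `|h' t| <= `|h' a| + 1.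
  rewrite in_itv /= => /andP[xt ty]; apply: ar => /=.
  by move: xr yr; rewrite !ltr_norml => /andP[? ?] /andP[? ?]; apply/andP; split; lra.
have [t /subset_itv_oo_cc/I[]//||t /I[_ ht] E] := @MVT_segment R h h' x y xy.
  apply: derivable_within_continuous => t /I[]; by case.
by rewrite distrC E normrM (distrC x) ler_wpM2r.
Unshelve. all: by end_near. Qed.

Lemma lip_at_powR (p a : R) : 0 < a -> lip_at (fun t : R => t `^ p) a.
Proof.
move=> a0; apply: (@lip_at_scalar _ (fun t => p * t `^ (p - 1))).
  near=> t; apply: is_derive1_powR; near: t; exact: lt_nbhsr.
apply: continuousM; first exact: cst_continuous.
apply: differentiable_continuous; apply/derivable1_diffP.
by apply: derivable_powR; rewrite in_itv /= a0.
Unshelve. all: by end_near. Qed.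

Lemma C1_on_comp_scalar n (h h' : R -> R) (U : set 'rV[R]_n) (f : 'rV[R]_n -> R) : open U -> C1_on U f ->
  (forall y, U y -> (\forall t \near f y, is_derive (t : R) 1 h (h' t)) /\ {for f y, continuous h'}) ->
  C1_on U (fun y => h (f y)).
Proof.
move=> oU Uf H; apply: (C1_on_comp oU Uf) => y Uy; have [dh ch] := H y Uy.
split; first by have [] := nbhs_singleton dh.
apply: near_eq_continuous ch; apply: filterS dh => t [_ <-].
by rewrite derive1E.
Qed.

Lemma C1_on_powR n (p : R) (U : set 'rV[R]_n) (f : 'rV[R]_n -> R) : open U ->
  (forall y, U y -> 0 < f y) -> C1_on U f -> C1_on U (fun y => f y `^ p).
Proof.
move=> oU f0 Uf; apply: (C1_on_comp_scalar (h := fun t : R => t `^ p) (h' := fun t => p * t `^ (p - 1))) => // y Uy; split.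
  near=> t; apply: is_derive1_powR; near: t; apply: lt_nbhsr; exact: f0.
apply: continuousM; first exact: cst_continuous.
apply: differentiable_continuous; apply/derivable1_diffP.
by apply: derivable_powR; rewrite in_itv /= f0.
Unshelve. all: by end_near. Qed.

Lemma C1_on_sqrt n (U : set 'rV[R]_n) (f : 'rV[R]_n -> R) : open U ->
  (forall y, U y -> 0 < f y) -> C1_on U f -> C1_on U (fun y => Num.sqrt (f y)).
Proof.
move=> oU f0 Uf; apply: (C1_on_comp_scalar (h := Num.sqrt) (h' := fun t => (2 * Num.sqrt t)^-1)) => // y Uy; split.
  near=> t; apply: is_derive1_sqrt; near: t; apply: lt_nbhsr; exact: f0.
apply: continuousV; first by rewrite mulf_neq0// gt_eqF// sqrtr_gt0 f0.
by apply: continuousM; [exact: cst_continuous|exact: sqrt_continuous].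
Unshelve. all: by end_near. Qed.

Lemma C1_on_expR n (U : set 'rV[R]_n) (f : 'rV[R]_n -> R) : open U ->
  C1_on U f -> C1_on U (fun y => expR (f y)).
Proof.
move=> oU Uf; apply: (C1_on_comp_scalar (h := expR) (h' := expR)) => // y Uy; split.
  by near=> t; exact: is_derive_expR.
exact: continuous_expR.
Unshelve. all: by end_near. Qed.

End ScalarFunctions.

Section Metric.
Context {R : realType} {n : nat} {M : manifold R n} (g : metric M).
Implicit Types (c : chart R n M) (x : M) (f h k : M -> R).

Lemma gram_posdefP c y : atlas c -> chart_image c y -> posdef (g c y).
Proof. by move=> ac cy v v0; exact: gram_posdef. Qed.

Lemma gram_det_gt0 c y : atlas c -> chart_image c y -> 0 < \det (g c y).
Proof. by move=> ac cy; exact/posdef_det_gt0/gram_posdefP. Qed.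

Lemma gram_unit c y : atlas c -> chart_image c y -> g c y \in unitmx.
Proof. by move=> ac cy; rewrite unitmxE unitfE gt_eqF// gram_det_gt0. Qed.

Lemma vol_density_gt0 c y : atlas c -> chart_image c y -> 0 < vol_density g c y.
Proof. by move=> ac cy; rewrite sqrtr_gt0 gram_det_gt0. Qed.

Lemma gram_C1 c i j : atlas c -> C1_on (chart_image c) (fun y => g c y i j).
Proof. by move=> ac; apply: smooth_on_C1; exact: gram_smooth. Qed.

Lemma gram_inv_C1 c i j : atlas c -> C1_on (chart_image c) (fun y => invmx (g c y) i j).
Proof.
move=> ac; apply: C1_on_inv; first exact: open_chart_image.
  by move=> y cy; rewrite gt_eqF// gram_det_gt0.
by move=> k l; exact: gram_C1.
Qed.

Lemma vol_density_C1 c : atlas c -> C1_on (chart_image c) (vol_density g c).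
Proof.
move=> ac; apply: C1_on_sqrt; first exact: open_chart_image.
  by move=> y cy; exact: gram_det_gt0.
by apply: C1_on_det; [exact: open_chart_image|move=> i j; exact: gram_C1].
Qed.

Definition C1M f := forall c, atlas c -> C1_on (chart_image c) (f \o param c).
(** Local Lipschitz continuity read in coordinates. [locally_lipschitz_lipM] and [lipM_lipschitz]
    relate it to the Riemannian distance of the hypotheses. *)
Definition lipM f := forall c x, atlas c -> chart_dom c x -> lip_at (f \o param c) (c x).

Lemma smooth_C1M f : smooth f -> C1M f.
Proof. by move=> sf c ac; exact/smooth_on_C1/sf. Qed.

Lemma C1M_lip f : C1M f -> lipM f.
Proof.
move=> Cf c x ac cx; apply: (C1_lip (@open_chart_image _ _ _ c)) (Cf c ac) _.
exact: chart_imageE.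
Qed.

Lemma C1M_mdiff f x : C1M f -> mdiff f x.
Proof.
move=> Cf; apply: (C1_differentiable (@open_chart_image _ _ _ (chart_at x))).
  exact/Cf/chart_at_atlas.
exact/chart_imageE/chart_at_dom.
Qed.

Lemma lipM_continuous f : lipM f -> continuous f.
Proof.
move=> lf x; have cx := chart_at_dom x.
have := lip_at_continuous (lf _ _ (chart_at_atlas x) cx).
set c := chart_at x => H.
apply: (@near_eq_continuous _ _ _ ((f \o param c) \o c)).
  by apply: filterS (near_dom cx) => z cz /=; rewrite coordK.
by apply: continuous_comp => //; exact: Defs.coord_continuous.
Qed.

Lemma lipM_M f h : lipM f -> lipM h -> lipM (fun z => f z * h z).
Proof. by move=> lf lh c x ac cx; exact: (lip_atM (lf c x ac cx) (lh c x ac cx)). Qed.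

Lemma lipM_D f h : lipM f -> lipM h -> lipM (fun z => f z + h z).
Proof. by move=> lf lh c x ac cx; exact: (lip_atD (lf c x ac cx) (lh c x ac cx)). Qed.

Lemma gram_inv_sym c y : atlas c -> chart_image c y -> (invmx (g c y))^T = invmx (g c y).
Proof. by move=> ac cy; rewrite trmx_inv gram_sym. Qed.

Definition pair f h x := inner g x (grad g f x) (grad g h x).

Lemma grad_dvec f x : mdiff f x ->
  grad g f x = dvec (chart_at x) f (chart_at x x) *m invmx (g (chart_at x) (chart_at x x)).
Proof. by move=> df; rewrite /grad /grad_in asboolT. Qed.

(** Changing charts multiplies differentials by J^T and replaces the inverse Gram matrix by J^-T
    G^-1 J^-1, so all the Jacobians cancel. *)
Lemma pair_chart f h c x : atlas c -> chart_dom c x -> mdiff f x -> mdiff h x ->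
  pair f h x = (dvec c f (c x) *m invmx (g c (c x)) *m (dvec c h (c x))^T) 0 0.
Proof.
move=> ac cx df dh; rewrite /pair /inner !grad_dvec//.
set c0 := chart_at x; have ac0 : atlas c0 := chart_at_atlas x; have c0x : chart_dom c0 x := chart_at_dom x.
have u0 := gram_unit ac0 (chart_imageE c0x).
rewrite mulmxKV// trmx_mul gram_inv_sym//; last exact: chart_imageE.
rewrite (dvec_change ac0 ac c0x cx df) (dvec_change ac0 ac c0x cx dh).
have G := gram_change g ac0 ac c0x cx; set J := jac c0 c (c0 x) in G *.
have uG := gram_unit ac (chart_imageE cx).
move: u0; rewrite G unitmx_mul => /andP[]; rewrite unitmx_mul => /andP[uJ _] uJT.
have -> : invmx (J *m g c (c x) *m J^T) = invmx J^T *m invmx (g c (c x)) *m invmx J.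
  have uA : J *m g c (c x) *m J^T \in unitmx by rewrite !unitmx_mul uJ uG.
  set B := RHS; have AB : J *m g c (c x) *m J^T *m B = 1%:M.
    by rewrite /B !mulmxA mulmxK// mulmxK// mulmxV.
  by rewrite -[B](mulKmx uA) AB mulmx1.
rewrite trmx_mul trmxK !mulmxA; congr (_ 0 0).
rewrite -(mulmxA _ J^T) mulmxV// mulmx1 -!mulmxA; congr (_ *m (_ *m _)).
by rewrite mulmxA mulVmx// mul1mx.
Qed.

End Metric.

(** * The Riemannian volume *)

(** Compactness as an induction principle: a property stable under finite unions that holds on a
    neighbourhood of each point of K holds on some set containing K. *)
Lemma compact_cover_union (T : topologicalType) (K : set T) (P : set T -> Prop) :
  compact K -> P set0 -> (forall A B, P A -> P B -> P (A `|` B)) ->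
  (forall x, K x -> exists2 A, P A & nbhs x A) -> exists2 A, P A & K `<=` A.
Proof.
move=> /compact_near_coveringP Kc P0 PU PK.
(* The sets satisfying P, directed by inclusion; along this filter, containing a point becomes an
   eventual property. *)
pose F : set_system (set T) := [set Q | exists2 A, P A & forall B, P B -> A `<=` B -> Q B].
have FF : Filter F.
  split.
  - by exists set0.
  - move=> Q Q' [A PA AQ] [A' PA' AQ']; exists (A `|` A'); first exact: PU.
    by move=> B PB AB; split; [apply: AQ|apply: AQ'] => // z Az; apply: AB; [left|right].
  - by move=> Q Q' QQ' [A PA AQ]; exists A => // B PB AB; apply: QQ'; exact: AQ.
have [|A PA AK] := Kc _ F (fun A x => A x) FF.
  move=> x /PK [A PA Ax]; exists (A, [set B | A `<=` B]) => /=.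
    by split => //; exists A.
  by move=> [z B] /= [Az AB]; exact: AB.
by exists A => //; exact: AK.
Qed.

Section IntegralPositive.
Context d (T : measurableType d) (R : realType) (mu : {measure set T -> \bar R}).

Lemma integral_pos_eq0 (D : set T) (s : T -> R) : measurable D -> measurable_fun D s ->
  (forall x, D x -> 0 < s x) -> (\int[mu]_(x in D) (s x)%:E = 0)%E -> mu D = 0.
Proof.
move=> mD ms s0 int0.
have : (\int[mu]_(x in D) `|(s x)%:E| = 0)%E.
  rewrite -int0; apply: eq_integral => x /[!inE] /s0 /ltW sx.
  by rewrite gee0_abs// lee_fin.
have msE : measurable_fun D (EFin \o s) by exact/measurable_EFinP.
move=> /(ae_eq_integral_abs mu mD msE) [N [mN N0 DN]].
apply/eqP; rewrite eq_le measure_ge0 andbT -N0; apply: le_measure; rewrite ?inE// => x Dx.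
by apply: DN => /= /(_ Dx) [] sx0; have := s0 x Dx; rewrite sx0 ltxx.
Qed.

End IntegralPositive.

Section Volume.
Context {R : realType} {n : nat} {M : manifold R n} (g : metric M).
Implicit Types (c : chart R n M) (x : M) (f h k : M -> R).
Local Notation E := (borel 'rV[R]_n).
Variables (vol : {measure set (borel M) -> \bar R}) (leb : {measure set E -> \bar R}).
Hypothesis hleb : is_lebesgue leb.
Hypothesis hvol : forall (c : chart R n M) (A : set (borel M)),
    atlas c -> measurable A -> A `<=` chart_dom c ->
    vol A = (\int[leb]_(y in c @` A) (vol_density g c y)%:E)%E.

Lemma measurable_dom c : measurable (chart_dom c : set (borel M)).
Proof. by apply: open_borel; exact: open_chart_dom. Qed.

Lemma measurable_image c : measurable (chart_image c : set E).
Proof. by apply: open_borel; exact: open_chart_image. Qed.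

Lemma measurable_param c : measurable_fun (chart_image c : set E) (param c : E -> borel M).
Proof.
apply: continuous_on_borel_comp; first exact: open_chart_image.
by move=> y cy; exact: param_continuous.
Qed.

Lemma measurable_coord c : measurable_fun (chart_dom c : set (borel M)) (c : borel M -> E).
Proof.
apply: (@continuous_on_borel_comp M 'rV[R]_n); first exact: open_chart_dom.
by move=> x cx; exact: Defs.coord_continuous.
Qed.

(** Encoded as a preimage under [param], which gives measurability at once; [read_image] identifies
    it with the image used in the definition of the volume. *)
Definition read c (A : set M) : set 'rV[R]_n := chart_image c `&` param c @^-1` A.

Lemma measurable_read c (A : set (borel M)) : measurable A -> measurable (read c A : set E).
Proof. by move=> mA; exact: (measurable_param (measurable_image c) mA). Qed.

Lemma read_image c (A : set M) : A `<=` chart_dom c -> read c A = c @` A.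
Proof.
move=> Ac; apply/seteqP; split => [y [cy Ay]|y [x Ax <-]].
  by exists (param c y) => //; rewrite paramK.
by split; [exact/chart_imageE/Ac|rewrite /= coordK//; exact: Ac].
Qed.

Lemma measurable_vol_density c : atlas c -> measurable_fun (chart_image c : set E) (vol_density g c : E -> R).
Proof.
move=> ac; apply: (@continuous_on_borel R 'rV[R]_n); first exact: open_chart_image.
by move=> y cy; exact: C1_continuous (@open_chart_image _ _ _ c) (vol_density_C1 g ac) cy.
Qed.

Lemma ge0_integral_chart c (D : set (borel M)) (f : M -> \bar R) : atlas c ->
  measurable D -> D `<=` chart_dom c -> measurable_fun D (f : borel M -> \bar R) ->
  (forall x, D x -> 0 <= f x)%E ->
  (\int[vol]_(x in D) f x = \int[leb]_(y in read c D) (f (param c y) * (vol_density g c y)%:E))%E.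
Proof.
move=> ac mD Dc mf f0.
have mE := measurable_read c mD.
apply: (@ge0_integral_transfer _ _ (borel M) E R vol leb D (read c D) (param c)) => //.
- by apply: measurable_funS (measurable_param (c := c)) => //; [exact: measurable_image|move=> ? []].
- by move=> y [].
- by apply: measurable_funS (measurable_vol_density ac) => //; [exact: measurable_image|move=> ? []].
- by move=> y [cy _]; rewrite ltW// vol_density_gt0.
- move=> A mA AD; rewrite (hvol ac mA) => [|x /AD /Dc//].
  rewrite -read_image => [|x /AD /Dc//]; congr (integral _ _ _).
  by apply/seteqP; split => y [] => [cy Ay|[cy _] Ay]//; split => //; split => //; exact: AD.
Qed.

Lemma integral_chart c (D : set (borel M)) (f : M -> R) : atlas c ->
  measurable D -> D `<=` chart_dom c -> measurable_fun D (f : borel M -> R) ->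
  (\int[vol]_(x in D) (f x)%:E = \int[leb]_(y in read c D) (f (param c y) * vol_density g c y)%:E)%E.
Proof.
move=> ac mD Dc mf; rewrite integralE [RHS]integralE.
have mfE : measurable_fun D (EFin \o f : borel M -> \bar R) by exact/measurable_EFinP.
have s0 y : read c D y -> (0 <= (vol_density g c y)%:E)%E.
  by move=> [cy _]; rewrite lee_fin ltW// vol_density_gt0.
congr (_ - _)%E.
- rewrite (@ge0_integral_chart c D (funepos (EFin \o f)))//; last exact: measurable_funepos.
  apply: eq_integral => y /[!inE] /s0 sy; rewrite !funeposE /= EFinM maxe_pMl//.
  by rewrite mul0e.
- rewrite (@ge0_integral_chart c D (funeneg (EFin \o f)))//; last exact: measurable_funeneg.
  apply: eq_integral => y /[!inE] /s0 sy; rewrite !funenegE maxe_pMl// mul0e.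
  by rewrite /= -EFinM mulNr.
Qed.

(** The density is positive, so a set on which it integrates to 0 is Lebesgue null. *)
Lemma read_null c (N : set (borel M)) : atlas c -> measurable N -> vol N = 0 -> leb (read c N) = 0.
Proof.
move=> ac mN N0; have mN' := measurable_read c mN.
have mNc : measurable (N `&` chart_dom c : set (borel M)) by apply: measurableI => //; exact: measurable_dom.
apply: (@integral_pos_eq0 _ E R leb _ (vol_density g c)) => //.
- by apply: measurable_funS (measurable_vol_density ac) => //; [exact: measurable_image|move=> ? []].
- by move=> y [cy _]; exact: vol_density_gt0.
- have -> : read c N = c @` (N `&` chart_dom c).
    rewrite -read_image => [|? []//]; apply/seteqP; split => y [cy]; last by case.
    by move=> Ny; split => //; split => //; exact: param_dom.
  rewrite -hvol//; apply/eqP; rewrite eq_le measure_ge0 andbT -N0; apply: le_measure; rewrite ?inE//.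
Qed.

Lemma open_vol_gt0 (O : set M) x : open O -> O x -> (0 < vol O)%E.
Proof.
move=> oO Ox; rewrite lt_neqAle measure_ge0 andbT eq_sym; apply/eqP => O0.
set c := chart_at x; have ac : atlas c := chart_at_atlas x; have cx : chart_dom c x := chart_at_dom x.
have leb0 := read_null ac (open_borel oO) O0.
have : \forall y \near c x, read c O y.
  have H1 := near_image (chart_imageE cx); have H2 := near_param cx (open_nbhs_nbhs (conj oO Ox)).
  by apply: filterS2 H1 H2 => y; split.
move=> /nbhs_ballP [r /= r0 rO].
have := leb_ball_gt0 hleb (c x) r0; rewrite ltNge => /negP; apply.
rewrite -leb0; apply: le_measure; rewrite ?inE//.
  by apply: open_borel; exact: ball_open.
by apply: measurable_read; exact: open_borel.
Qed.

(** A small coordinate ball works: its Lebesgue measure is finite and the density is bounded on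
    it. *)
Lemma locally_finite_vol x : exists2 O, open O & O x /\ (vol O < +oo)%E.
Proof.
set c := chart_at x; have ac : atlas c := chart_at_atlas x; have cx : chart_dom c x := chart_at_dom x.
have cs := C1_continuous (@open_chart_image _ _ _ c) (vol_density_C1 g ac) (chart_imageE cx).
set B := `|vol_density g c (c x)| + 1.
have : \forall y \near c x, chart_image c y /\ `|vol_density g c y| <= B.
  have H1 := near_image (chart_imageE cx); have H2 := norm_near_le cs.
  by apply: filterS2 H1 H2.
move=> /nbhs_ballP [r /= r0 rO].
pose O := c @^-1` (ball (c x) r) `&` chart_dom c.
have oO : open O.
  rewrite openE => z [zr cz]; apply: filterI; last exact: near_dom.
  exact: (near_chart cz (open_nbhs_nbhs (conj (ball_open _ _) zr))).
exists O => //; split; first by split => //; exact: ballxx.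
rewrite (hvol ac); [|exact: open_borel|by move=> ? []].
have mr : measurable (ball (c x) r : set E) by apply: open_borel; exact: ball_open.
have -> : c @` O = ball (c x) r.
  apply/seteqP; split => [y [z [zr _] <-]//|y yr]; have [cy _] := rO y yr.
  by exists (param c y); [split; [rewrite /= paramK|exact: param_dom]|exact: paramK].
have ms : measurable_fun (ball (c x) r : set E) (vol_density g c : E -> R).
  by apply: measurable_funS (measurable_vol_density ac) => //; [exact: measurable_image|move=> ? /rO []].
have lr : (leb (ball (c x) r : set E) < +oo)%E.
  apply: (leb_bounded_lty hleb mr (r := `|c x| + r)) => y; rewrite -ball_normE /= => yr.
  have -> : y = c x - (c x - y) by rewrite opprB addrC subrK.
  by apply: le_lt_trans (ler_normB _ _) _; rewrite ltrD2l.
have := @bounded_integrable _ E R leb _ _ (vol_density g c) B mr mr lr ms.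
move=> /(_ (fun y yr => proj2 (rO y yr)) (fun y yr nyr => False_ind _ (nyr yr))).
move=> /integrableP[_]; apply: le_lt_trans; apply: ge0_le_integral => //=.
- by move=> y /rO[cy _]; rewrite lee_fin ltW// vol_density_gt0.
- exact/measurable_EFinP.
- by apply/measurable_EFinP; exact: measurableT_comp.
- by move=> y _; rewrite lee_fin ler_norm.
Qed.

End Volume.

Section MeasurablePartial.
Context {R : realType} {n : nat}.
Local Notation E := (borel 'rV[R]_n).
Local Notation "''e_' i" := (delta_mx 0 i : 'rV[R]_n) (at level 8, i at level 2).

Lemma cvg_harmonic_dnbhs : @harmonic R @ \oo --> (0 : R)^'.
Proof.
move=> P P0; have : \forall k \near \oo, (@harmonic R k != 0 -> P (harmonic k)).
  by exact: (@cvg_harmonic R _ P0).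
by apply: filterS => k; apply; rewrite /harmonic /= invr_neq0// pnatr_eq0.
Qed.

(** The derivative is a pointwise limit of measurable difference quotients; this covers functions
    such as rho whose derivatives are not continuous. *)
Lemma measurable_partial (F : 'rV[R]_n -> R) i (D : set E) :
  measurable_fun setT (F : E -> R) -> measurable D ->
  (forall y, D y -> derivable F y 'e_i) -> measurable_fun D (partial i F : E -> R).
Proof.
move=> mF mD dF.
pose q m (y : E) : R := (harmonic m)^-1 * (F ((y : 'rV[R]_n) + harmonic m *: 'e_i) - F y).
apply: (@measurable_fun_cvg _ E R D q) => [m|y Dy].
  apply: measurable_funTS; apply: measurable_funM => //; apply: measurable_funB => //.
  by apply: (measurableT_comp mF); exact: measurable_shift.
have -> : q ^~ y = (fun k : R => k^-1 *: ((F \o shift y) (k *: 'e_i) - F y)) \o harmonic.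
  by apply/funext => k; rewrite /q /= [harmonic k *: _ + _]addrC.
exact: cvg_comp cvg_harmonic_dnbhs (dF y Dy).
Qed.

End MeasurablePartial.

(** * Local measurability and boundedness off a null set *)

Section Nice.
Context {R : realType} {n : nat} {M : manifold R n}.
Implicit Types (c : chart R n M) (x : M) (f h k : M -> R).
Local Notation E := (borel 'rV[R]_n).
Local Notation "''e_' i" := (delta_mx 0 i : 'rV[R]_n) (at level 8, i at level 2).
Variables (N : set (borel M)).
Hypothesis mN : measurable N.

(** A local criterion, so that it can be checked in any chart around x. For functions vanishing
    outside a compact set it yields integrability off N. *)
Definition nice h x := exists O : set M, [/\ open O, O x,
  measurable_fun (O `\` N : set (borel M)) (h : borel M -> R) &
  exists B : R, forall z, O z -> ~ N z -> `|h z| <= B].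

Lemma niceS h (O O' : set M) : open O -> open O' -> O' `<=` O ->
  measurable_fun (O `\` N : set (borel M)) (h : borel M -> R) ->
  measurable_fun (O' `\` N : set (borel M)) (h : borel M -> R).
Proof.
move=> oO oO' O'O; apply: measurable_funS; last by move=> z [/O'O].
by apply: measurableD => //; exact: open_borel.
Qed.

Lemma nice_continuous h x (U : set M) : open U -> U x -> (forall z, U z -> {for z, continuous h}) -> nice h x.
Proof.
move=> oU Ux ch.
have : nbhs x [set z | `|h z| <= `|h x| + 1].
  have /cvgr_dist_le /(_ 1 ltr01) := ch x Ux.
  apply: filterS => z /=; rewrite distrC => fz.
  by rewrite -lerBlDl (le_trans _ fz)// lerB_dist.
rewrite nbhsE => -[ O [oO Ox] OB].
exists (U `&` O); split => //; first exact: openI.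
  apply: measurable_funS (@continuous_on_borel R M U h oU ch); first exact: open_borel.
  by move=> z [[]].
by exists (`|h x| + 1) => z [_ /OB].
Qed.

Lemma nice_cst (a : R) x : nice (fun=> a) x.
Proof. by apply: (nice_continuous openT) => // z _; exact: cst_continuous. Qed.

Lemma niceD f h x : nice f x -> nice h x -> nice (fun z => f z + h z) x.
Proof.
move=> [ O [oO Ox mf [B fB]]] [ O' [oO' Ox' mh [B' hB']]].
have oI := openI oO oO'.
exists (O `&` O'); split => //.
  by apply: measurable_funD; [apply: niceS mf|apply: niceS mh] => // z [].
exists (B + B') => z [Oz Oz'] Nz; apply: le_trans (ler_normD _ _) _; apply: lerD; [exact: fB|exact: hB'].
Qed.

Lemma niceM f h x : nice f x -> nice h x -> nice (fun z => f z * h z) x.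
Proof.
move=> [ O [oO Ox mf [B fB]]] [ O' [oO' Ox' mh [B' hB']]].
have oI := openI oO oO'.
exists (O `&` O'); split => //.
  by apply: measurable_funM; [apply: niceS mf|apply: niceS mh] => // z [].
exists (B * B') => z [Oz Oz'] Nz; rewrite normrM; apply: ler_pM => //; [exact: fB|exact: hB'].
Qed.

Lemma nice_sum (I : Type) (r : seq I) (F : I -> M -> R) x :
  (forall i, nice (F i) x) -> nice (fun z => \sum_(i <- r) F i z) x.
Proof.
move=> nF; elim: r => [|i r IH].
  have -> : (fun z : M => \sum_(i <- [::]) F i z) = fun=> 0.
    by apply/funext => z; rewrite big_nil.
  exact: nice_cst.
have -> : (fun z : M => \sum_(j <- i :: r) F j z) = fun z => F i z + \sum_(j <- r) F j z.
  by apply/funext => z; rewrite big_cons.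
exact: niceD.
Qed.

Lemma nice_eq f h x (U : set M) : open U -> U x -> (forall z, U z -> ~ N z -> f z = h z) -> nice h x -> nice f x.
Proof.
move=> oU Ux fh [ O [oO Ox mh [B hB]]]; have oI := openI oU oO.
exists (U `&` O); split => //; last first.
  by exists B => z [Uz Oz] Nz; rewrite fh//; exact: hB.
apply: (@eq_measurable_fun _ _ (borel M) R _ h); last by apply: niceS mh => // z [].
by move=> z /[!inE] -[[Uz _] Nz]; rewrite fh.
Qed.

Lemma nice_partial c f i x : atlas c -> chart_dom c x -> lipM f ->
  (forall z, ~ N z -> mdiff f z) -> nice (fun z => partial i (f \o param c) (c z)) x.
Proof.
(* Difference quotients step out of the chart image, so the representative is extended by zero to a
   measurable function on all of R^n. *)
move=> ac cx lf df; pose F := (f \o param c) \_ (chart_image c).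
have mF : measurable_fun setT (F : E -> R).
  apply/(measurable_restrictT _ _).1; first exact: measurable_image.
  apply: (@continuous_on_borel R 'rV[R]_n); first exact: open_chart_image.
  move=> y cy; rewrite -(paramK cy); apply: lip_at_continuous.
  by apply: lf => //; exact: param_dom.
have FE y : chart_image c y -> {near y, F =1 f \o param c}.
  by move=> cy; apply: filterS (near_image cy) => z cz; rewrite /F patchE mem_set.
pose D : set E := read c (~` N).
have mD : measurable D by apply: measurable_read; exact: measurableC.
have mP : measurable_fun D (partial i F : E -> R).
  apply: measurable_partial => // y [cy Ny].
  apply: (near_eq_derivable (f := f \o param c)).
    by apply: filterS (FE y cy) => z ->.
  apply: diff_derivable; rewrite -(paramK cy).
  by apply: mdiff_chart => //; [exact: param_dom|exact: df].
have [K HK] := lip_partial_bound (lf c x ac cx).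
have : nbhs x [set z | forall i, derivable (f \o param c) (c z) 'e_i -> `|partial i (f \o param c) (c z)| <= K].
  exact: (near_chart cx HK).
rewrite nbhsE => -[ O [oO Ox] OK].
have oc := @open_chart_dom _ _ _ c.
exists (chart_dom c `&` O); split => //; first exact: openI; last first.
  exists K => z [cz Oz] Nz; apply: OK => //.
  by apply: diff_derivable; apply: mdiff_chart => //; exact: df.
apply: (niceS oc (openI oc oO) (@subIsetl _ _ _)).
apply: (@eq_measurable_fun _ _ (borel M) R _ (fun z => partial i F (c z))).
  move=> z /[!inE] -[cz Nz]; apply: near_eq_derive.
  exact: FE (chart_imageE cz).
apply: (@measurable_comp _ _ _ (borel M) E R D) => //.
  by move=> _ [z [cz Nz] <-]; split; [exact: chart_imageE|rewrite /= coordK].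
apply: measurable_funS (measurable_coord (c := c)) => //; first exact: measurable_dom.
Qed.

End Nice.

Section NiceIntegrable.
Context {R : realType} {n : nat} {M : manifold R n} (g : metric M).
Implicit Types (c : chart R n M) (x : M) (f h k : M -> R).
Local Notation E := (borel 'rV[R]_n).
Variables (vol : {measure set (borel M) -> \bar R}) (leb : {measure set E -> \bar R}).
Hypothesis hleb : is_lebesgue leb.
Hypothesis hvol : forall (c : chart R n M) (A : set (borel M)),
    atlas c -> measurable A -> A `<=` chart_dom c ->
    vol A = (\int[leb]_(y in c @` A) (vol_density g c y)%:E)%E.
Variables (N : set (borel M)).
Hypothesis mN : measurable N.

(** Compactness merges the local neighbourhoods into one open set of finite volume that contains K
    and on which h is measurable and bounded off N. *)
Lemma nice_integrable (K : set M) h : compact K -> (forall x, K x -> nice N h x) ->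
  (forall x, ~ K x -> ~ N x -> h x = 0) -> vol.-integrable (~` N) (EFin \o h : borel M -> \bar R).
Proof.
move=> cK nh h0.
have closedK : closed K by apply: compact_closed => //; exact: manifold_hausdorff.
pose P (O : set M) := [/\ open O, (vol (O : set (borel M)) < +oo)%E,
  measurable_fun (O `\` N : set (borel M)) (h : borel M -> R) &
  exists B : R, forall z, O z -> ~ N z -> `|h z| <= B].
have [||x Kx| O [oO Ooo mh [B hB]] KO] := @compact_cover_union _ K P cK.
- split; [exact: open0|by rewrite measure0|by rewrite set0D; exact: measurable_fun_set0|].
  by exists 0.
- move=> O O' [oO Ooo mh [B hB]] [oO' Ooo' mh' [B' hB']]; split.
  + exact: openU.
  + apply: le_lt_trans (measureU2 _ _ _) _; [exact: open_borel|exact: open_borel|].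
    by rewrite lte_add_pinfty.
  + by rewrite setDUl; apply/measurable_funU => //; apply: measurableD => //; exact: open_borel.
  + exists (Num.max B B') => z [Oz|Oz] Nz; rewrite le_max; first by rewrite hB.
    by rewrite hB' ?orbT.
- have [ O [oO Ox mh [B hB]]] := nh x Kx.
  have [ O' oO' [Ox' Ooo']] := locally_finite_vol hleb hvol x.
  have oI := openI oO oO'.
  exists (O `&` O'); last by apply: open_nbhs_nbhs.
  split => //.
  + by apply: le_lt_trans Ooo'; apply: le_measure; rewrite ?inE//; apply: open_borel.
  + by apply: niceS mh => // z [].
  + by exists B => z [Oz _]; exact: hB.
have mO : measurable (O : set (borel M)) by exact: open_borel.
have mK : measurable (~` K : set (borel M)) by apply: open_borel; exact: closed_openC.
have mNC : measurable (~` N) by exact: measurableC.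
have NE : ~` N = (O `\` N) `|` (~` K `\` N).
  apply/seteqP; split => z /=; last by case; case.
  by move=> Nz; have [Kz|Kz] := pselect (K z); [left; split => //; exact: KO|right].
have mh' : measurable_fun (~` N) (h : borel M -> R).
  rewrite NE; apply/measurable_funU; [exact: measurableD|exact: measurableD|]; split => //.
  apply: (@eq_measurable_fun _ _ (borel M) R _ (fun=> 0)); last exact: measurable_cst.
  by move=> z /[!inE] -[Kz Nz]; rewrite h0.
apply: (bounded_integrable (B := Num.max B 0) mNC mO Ooo mh') => [z Nz|z Nz Oz].
  have [Oz|Oz] := pselect (O z); first by rewrite le_max hB.
  by rewrite h0// ?normr0 ?le_max ?lexx ?orbT// => /KO.
by rewrite h0// => /KO.
Qed.

End NiceIntegrable.

(** * Integration by parts *)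

Section CompactSupport.
Context {R : realType} {n : nat}.

(** A single k serves as bound, radius, Lipschitz constant and inverse step size, since all four
    conditions weaken as k grows. Near each point of K they hold for large k, and compactness makes
    k uniform. *)
Lemma lip_compact_support (W : 'rV[R]_n -> R) (K : set 'rV[R]_n) : compact K ->
  (forall y, ~ K y -> W y = 0) -> (forall y, lip_at W y) ->
  exists2 k : R, 0 < k & [/\ (forall y, `|W y| <= k), (forall y, k <= `|y| -> W y = 0) &
    forall y h, `|h| < k^-1 -> `|W (y + h) - W y| <= k * `|h|].
Proof.
move=> /compact_near_coveringP cK W0 lW.
pose P (k : R) (y : 'rV[R]_n) := [/\ `|W y| <= k, `|y| < k &
  forall h, `|h| < k^-1 -> `|W (y + h) - W y| <= k * `|h|].
have : \forall k \near +oo, K `<=` P k.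
  apply: cK => x Kx; have cx := lip_at_continuous (lW x).
  have [L L0 [[A B] /= [Ax Bx] AB]] := lW x.
  have : nbhs x (A `&` B) by exact: filterI.
  move=> /nbhs_ballP [r /= r0 rAB].
  have b1 : \forall z \near x, `|W z| <= `|W x| + 1 by exact: norm_near_le.
  have b2 : nbhs x (ball x (r / 2)) by apply: nbhsx_ballx; rewrite divr_gt0.
  exists ([set z | `|W z| <= `|W x| + 1] `&` ball x (r / 2),
    [set k | [/\ `|W x| + 1 <= k, `|x| + r < k, L <= k & (r / 2)^-1 <= k]]) => /=.
    split; first exact: filterI.
    near=> k; split; near: k; [apply: nbhs_pinfty_ge|apply: nbhs_pinfty_gt|apply: nbhs_pinfty_ge|apply: nbhs_pinfty_ge]; exact: num_real.
  move=> [z k] /= [[bz xz] [k1 k2 k3 k4]].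
  have r2 : 0 < (r / 2)^-1 by rewrite invr_gt0 divr_gt0.
  move: xz; rewrite -ball_normE /= => xz.
  split; first exact: le_trans k1.
    apply: lt_trans k2; have -> : z = x - (x - z) by rewrite opprB addrC subrK.
    by apply: le_lt_trans (ler_normB _ _) _; rewrite ltrD2l; apply: lt_le_trans xz _; lra.
  move=> h hk; have hr : `|h| < r / 2.
    have kp : 0 < k by exact: lt_le_trans r2 k4.
    by apply: lt_le_trans hk _; rewrite -[leRHS]invrK lef_pV2 ?posrE.
  have H := AB (z + h, z); rewrite /= [z + h - z]addrAC subrr add0r in H.
  apply: le_trans (H _) _; last by rewrite ler_wpM2r.
  split.
    suff : (A `&` B) (z + h) by case.
    apply: rAB; rewrite -ball_normE /= opprD addrA.
    apply: le_lt_trans (ler_normB _ _) _; lra.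
  suff : (A `&` B) z by case.
  by apply: rAB; rewrite -ball_normE /=; lra.
move=> KP; have [k [k0 kP]] : exists k : R, 0 < k /\ K `<=` P k.
  have : \forall k \near +oo, 0 < k /\ K `<=` P k.
    by near=> k; split; near: k; [apply: nbhs_pinfty_gt; exact: num_real|].
  by move=> /filter_ex [k kP]; exists k.
exists k => //; split.
- by move=> y; have [/kP[]//|Ky] := pselect (K y); rewrite W0// normr0 ltW.
- by move=> y; have [/kP[_ yk _]|Ky _] := pselect (K y); [rewrite leNgt yk|exact: W0].
- move=> y h hk; have [/kP[_ _]|Ky] := pselect (K y); first exact.
  (* If only y + h lies in K, the estimate is applied at that point with the increment -h. *)
  have [/kP[_ _]/(_ (- h))|Kyh] := pselect (K (y + h)).
    by rewrite normrN addrK distrC; exact.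
  by rewrite !W0// subrr normr0 mulr_ge0// ltW.
Unshelve. all: by end_near. Qed.

End CompactSupport.

Section ChartIntegrationByParts.
Context {R : realType} {n : nat} {M : manifold R n} (g : metric M).
Implicit Types (c : chart R n M) (x : M) (f h k w phi A : M -> R).
Local Notation E := (borel 'rV[R]_n).
Local Notation "''e_' i" := (delta_mx 0 i : 'rV[R]_n) (at level 8, i at level 2).

Lemma grad_inE c phi y : differentiable (phi \o param c) y ->
  grad_in g c phi y = dvec c phi y *m invmx (g c y).
Proof. by move=> df; rewrite /grad_in asboolT. Qed.

Lemma smooth_chart_differentiable c phi y : atlas c -> smooth phi -> chart_image c y ->
  differentiable (phi \o param c) y.
Proof.
move=> ac sp cy; apply: (C1_differentiable (@open_chart_image _ _ _ c)) cy.
exact: smooth_C1M.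
Qed.

Lemma grad_in_C1 c phi i : atlas c -> smooth phi ->
  C1_on (chart_image c) (fun y => grad_in g c phi y 0 i).
Proof.
move=> ac sp; have oc := @open_chart_image _ _ _ c.
apply: (@C1_on_eq _ _ _ (fun y => \sum_k partial k (phi \o param c) y * invmx (g c y) k i)) => //.
  move=> y cy; rewrite grad_inE ?mxE; last exact: smooth_chart_differentiable.
  by apply: eq_bigr => k _; rewrite mxE.
apply: C1_on_sum => // k _; apply: C1_onM => //; last exact: gram_inv_C1.
by apply: smooth_on_C1; apply: smooth_on_partial; exact: sp.
Qed.

(* [wdiv c A phi] is the divergence of [A grad phi], computed in the chart [c]. *)
Definition wdiv c A phi x : R := div_in g c (fun y => A (param c y) *: grad_in g c phi y) (c x).

Definition flux c A phi (i : 'I_n) y : R := vol_density g c y * (A (param c y) * grad_in g c phi y 0 i).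

Lemma flux_C1 c A phi i : atlas c -> C1M A -> smooth phi -> C1_on (chart_image c) (flux c A phi i).
Proof.
move=> ac CA sp; have oc := @open_chart_image _ _ _ c.
apply: C1_onM => //; first exact: vol_density_C1.
by apply: C1_onM => //; [exact: CA|exact: grad_in_C1].
Qed.

Lemma wdivE c A phi x : wdiv c A phi x = (vol_density g c (c x))^-1 * \sum_i partial i (flux c A phi i) (c x).
Proof.
congr (_ * _); apply: eq_bigr => i _; congr (partial i _ _).
by apply/funext => y; rewrite mxE.
Qed.

Lemma pairC f h x : pair g f h x = pair g h f x.
Proof.
by apply: posdef_sym_inner; apply: gram_sym; [exact: chart_at_atlas|exact/chart_imageE/chart_at_dom].
Qed.

Variables (vol : {measure set (borel M) -> \bar R}) (leb : {measure set E -> \bar R}).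
Hypothesis hleb : is_lebesgue leb.
Hypothesis hvol : forall (c : chart R n M) (A : set (borel M)),
    atlas c -> measurable A -> A `<=` chart_dom c ->
    vol A = (\int[leb]_(y in c @` A) (vol_density g c y)%:E)%E.
Variables (N : set (borel M)).
Hypotheses (mN : measurable N) (N0 : vol N = 0).

(** The integrand is the divergence of w A grad phi. Multiplied by the density it becomes a
    Euclidean divergence of compactly supported Lipschitz functions, whose terms integrate to zero
    one by one. *)
Lemma integral_chart_by_parts c w A phi (K : set M) : atlas c -> compact K -> K `<=` chart_dom c ->
  (forall z, ~ K z -> w z = 0) -> lipM w -> (forall z, ~ N z -> mdiff w z) ->
  C1M A -> smooth phi ->
  (\int[vol]_(x in chart_dom c `\` N) (A x * pair g w phi x + w x * wdiv c A phi x)%:E = 0)%E.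
Proof.
move=> ac cK Kc w0 lw dw CA sp; have oc := @open_chart_image _ _ _ c.
pose K' := c @` K.
have cK' : compact K'.
  apply: continuous_compact cK; apply: continuous_in_subspaceT => z /[!inE] /Kc cz.
  exact: Defs.coord_continuous.
have clK' : closed K' by apply: compact_closed => //; exact: norm_hausdorff.
have W0 (y : 'rV[R]_n) : chart_image c y -> ~ K' y -> w (param c y) = 0.
  by move=> cy Ky; apply: w0 => Kp; apply: Ky; exists (param c y) => //; exact: paramK.
(* The extension by zero is still locally Lipschitz: it vanishes near every point off the compact
   set K', which lies inside the chart image. *)
pose W i (y : 'rV[R]_n) := if y \in chart_image c then w (param c y) * flux c A phi i y else 0.
have WE i y : chart_image c y -> {near y, W i =1 fun y => w (param c y) * flux c A phi i y}.
  by move=> cy; apply: filterS (near_image cy) => z cz; rewrite /W mem_set.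
have Wout i y : ~ K' y -> W i y = 0.
  by move=> Ky; rewrite /W; case: ifPn => // /set_mem cy; rewrite W0// mul0r.
have Wfar i y : ~ K' y -> {near y, W i =1 fun=> 0}.
  move=> Ky; have : nbhs y (~` K') by apply: open_nbhs_nbhs; split => //; exact: closed_openC.
  by apply: filterS => z; exact: Wout.
have lW i y : lip_at (W i) y.
  have [cy|cy] := pselect (chart_image c y).
    apply: near_eq_lip (WE i y cy) _; apply: lip_atM.
      rewrite -(paramK cy); apply: lw => //; exact: param_dom.
    exact: C1_lip oc (flux_C1 i ac CA sp) cy.
  apply: near_eq_lip (Wfar i y _) (lip_at_cst _ _) => -[z Kz zy].
  by apply: cy; rewrite -zy; exact/chart_imageE/Kc.
have dwc y : chart_image c y -> ~ N (param c y) -> differentiable (w \o param c) y.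
  move=> cy Ny; rewrite -(paramK cy); apply: mdiff_chart => //; [exact: param_dom|exact: dw].
pose N' : set E := read c N.
have mN' : measurable N' by exact: measurable_read.
have N'0 : leb N' = 0 by exact: (read_null (g := g) (vol := vol)).
have dW i y : ~ N' y -> derivable (W i) y 'e_i.
  move=> Ny; have [cy|cy] := pselect (chart_image c y).
    have Npy : ~ N (param c y) by move=> Np; apply: Ny.
    apply: (near_eq_derivable (f := fun y => w (param c y) * flux c A phi i y)).
      by apply: filterS (WE i y cy) => z ->.
    apply: derivableM; first exact: diff_derivable (dwc y cy Npy).
    by have [] := flux_C1 i ac CA sp cy i.
  apply: (near_eq_derivable (f := fun=> 0)); last exact: derivable_cst.
  have Ky : ~ K' y by move=> [z Kz zy]; apply: cy; rewrite -zy; exact/chart_imageE/Kc.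
  by apply: filterS (Wfar i y Ky) => z ->.
have intW i : leb.-integrable (~` N') (fun y => (partial i (W i) y)%:E) /\
    (\int[leb]_(y in ~` N') (partial i (W i) y)%:E = 0)%E.
  have [k k0 [Wk Wr WL]] := lip_compact_support cK' (Wout i) (lW i).
  apply: (integral_partial_eq0 (B := k) (L := k) (delta := k^-1) (r := k) hleb) => //.
  - by move=> y; exact: lip_at_continuous.
  - by rewrite invr_gt0.
  - move=> y h hk.
    have E1 : `|(h *: 'e_i : 'rV[R]_n)| <= `|h|.
      rewrite normrZ -[leRHS]mulr1 ler_wpM2l//.
      by apply: norm_le_coord => // j; rewrite !mxE eqxx; case: eqP => _ /=; rewrite ?normr1 ?normr0.
    apply: le_trans (WL _ _ (le_lt_trans E1 hk)) _.
    by rewrite ler_wpM2l// ltW.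
  - exact: dW.
(* By the Leibniz rule this Euclidean divergence is the integrand times the density at points of the
   chart off N. *)
pose S y := \sum_i partial i (W i) y.
have SE x : chart_dom c x -> ~ N x ->
    S (c x) = (A x * pair g w phi x + w x * wdiv c A phi x) * vol_density g c (c x).
  move=> cx Nx; have cy := chart_imageE cx.
  have Npx : ~ N (param c (c x)) by rewrite coordK.
  have s0 := vol_density_gt0 g ac cy.
  have dphi := smooth_chart_differentiable ac sp cy.
  have PE i : partial i (W i) (c x) = w x * partial i (flux c A phi i) (c x) +
      flux c A phi i (c x) * partial i (w \o param c) (c x).
    have E1 : partial i (W i) (c x) = partial i ((w \o param c) * flux c A phi i) (c x).
      exact: near_eq_derive (WE i (c x) cy).
    rewrite E1 /partial deriveM; last by have [] := flux_C1 i ac CA sp cy i.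
      by rewrite /= coordK.
    exact: diff_derivable (dwc _ cy Npx).
  have fE : \sum_i flux c A phi i (c x) * partial i (w \o param c) (c x) =
      vol_density g c (c x) * (A x * pair g w phi x).
    rewrite pairC (pair_chart g ac cx (smooth_mdiff x sp) (dw x Nx)) mxE !mulr_sumr.
    apply: eq_bigr => i _; rewrite /flux (grad_inE dphi) coordK// !mxE; ring.
  rewrite /S (eq_bigr _ (fun i _ => PE i)) big_split /= -mulr_sumr fE wdivE.
  rewrite mulrDl addrC; congr (_ + _); first by rewrite mulrC.
  by rewrite -mulrA mulrAC mulVf ?mul1r// gt_eqF.
have iS : leb.-integrable (~` N') (fun y => (S y)%:E).
  have -> : (fun y => (S y)%:E) = (fun y => \sum_i (partial i (W i) y)%:E)%E.
    by apply/funext => y; rewrite sumEFin.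
  by apply: integrable_sum => [|i _]; [exact: measurableC|have [] := intW i].
have intS : (\int[leb]_(y in ~` N') (S y)%:E = 0)%E.
  under eq_integral do rewrite -sumEFin.
  rewrite integral_sum; [|exact: measurableC|by move=> i; have [] := intW i].
  by apply: big1 => i _; have [] := intW i.
have mD : measurable (chart_dom c `\` N : set (borel M)).
  by apply: measurableD => //; exact: measurable_dom.
have mI : measurable_fun (chart_dom c `\` N : set (borel M))
    ((fun x => A x * pair g w phi x + w x * wdiv c A phi x) : borel M -> R).
  apply: (@eq_measurable_fun _ _ (borel M) R _ (fun x => S (c x) * (vol_density g c (c x))^-1)).
    move=> x /[!inE] -[cx Nx]; rewrite SE// mulfK// gt_eqF//.
    by apply: vol_density_gt0 => //; exact: chart_imageE.
  pose D : set E := chart_image c `\` N'.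
  have mD' : measurable D by apply: measurableD => //; exact: measurable_image.
  have mSD : measurable_fun D (fun y : E => S y * (vol_density g c y)^-1).
    apply: measurable_funM.
      have mSE : measurable_fun (~` N') (S : E -> R) by apply/measurable_EFinP; exact: measurable_int iS.
      by apply: measurable_funS mSE; [exact: measurableC|move=> y []].
    have Cs : C1_on (chart_image c) (fun y => (vol_density g c y)^-1).
      apply: C1_onV => //; last exact: vol_density_C1.
      by move=> y cy; rewrite gt_eqF// vol_density_gt0.
    apply: measurable_funS (@continuous_on_borel R 'rV[R]_n (chart_image c) _ oc _).
    - exact: measurable_image.
    - by move=> y [].
    - by move=> y cy; exact: C1_continuous oc Cs cy.
  apply: (@measurable_comp _ _ _ (borel M) E R D _ _ c) mSD _ => //.
    move=> _ [z [cz Nz] <-]; split; first exact: chart_imageE.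
    by move=> [_ /=]; rewrite coordK.
  apply: measurable_funS (measurable_coord (c := c)); first exact: measurable_dom.
  by move=> z [].
rewrite (integral_chart hvol ac mD (@subDsetl _ _ _) mI).
rewrite -intS.
have -> : read c (chart_dom c `\` N) = ~` N' `&` chart_image c.
  apply/seteqP; split => y [].
    by move=> cy [_ Ny]; split => // -[].
  by move=> Ny cy; split => //; split; [exact: param_dom|move=> Np; exact: Ny].
(* The Euclidean integral also runs over points outside the chart image, where S vanishes because
   every W i is zero nearby. *)
rewrite integral_mkcondr; apply: eq_integral => y /[!inE] Ny; rewrite patchE.
case: ifPn => [/set_mem cy|/negP cy].
  congr (_%:E); rewrite -[in RHS](paramK cy) SE ?paramK//; first exact: param_dom.
  by move=> Np; apply: Ny.
rewrite /S big1// => i _; have Ky : ~ K' y.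
  by move=> [z Kz zy]; apply: cy; apply: mem_set; rewrite -zy; exact/chart_imageE/Kc.
have -> : partial i (W i) y = partial i (fun=> 0) y by exact: near_eq_derive (Wfar i y Ky).
exact: derive_cst.
Qed.

End ChartIntegrationByParts.

(** * Rules for gradients and for Lipschitz functions *)

Section GradientCalculus.
Context {R : realType} {n : nat} {M : manifold R n} (g : metric M).
Implicit Types (c : chart R n M) (x : M) (f h k w phi A : M -> R).

Lemma innerDl x (v v' w : 'rV[R]_n) : inner g x (v + v') w = inner g x v w + inner g x v' w.
Proof. by rewrite /inner !mulmxDl mxE. Qed.

Lemma innerZl x a (v w : 'rV[R]_n) : inner g x (a *: v) w = a * inner g x v w.
Proof. by rewrite /inner -!scalemxAl mxE. Qed.

Lemma innerC x (v w : 'rV[R]_n) : inner g x v w = inner g x w v.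
Proof.
by apply: posdef_sym_inner; apply: gram_sym; [exact: chart_at_atlas|exact/chart_imageE/chart_at_dom].
Qed.

Lemma innerDr x (v w w' : 'rV[R]_n) : inner g x v (w + w') = inner g x v w + inner g x v w'.
Proof. by rewrite innerC innerDl !(innerC _ v). Qed.

Lemma innerZr x a (v w : 'rV[R]_n) : inner g x v (a *: w) = a * inner g x v w.
Proof. by rewrite innerC innerZl innerC. Qed.

Lemma inner_ge0 x (v : 'rV[R]_n) : 0 <= inner g x v v.
Proof.
by apply: posdef_ge0; apply: gram_posdefP; [exact: chart_at_atlas|exact/chart_imageE/chart_at_dom].
Qed.

Lemma grad_eq f h x : (\forall z \near x, f z = h z) -> mdiff h x -> grad g f x = grad g h x.
Proof.
move=> fh dh; rewrite !grad_dvec//; last exact: mdiff_eq fh dh.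
congr (_ *m _); apply/rowP => i; rewrite !mxE; apply: near_eq_derive.
exact: (near_param (chart_at_dom x) fh).
Qed.

Lemma mdiff_cst (a : R) x : mdiff (fun _ : M => a) x.
Proof. exact: differentiable_cst. Qed.

Lemma grad_cst (a : R) x : grad g (fun=> a) x = 0.
Proof.
rewrite grad_dvec; last exact: mdiff_cst.
rewrite [X in X *m _](_ : _ = 0) ?mul0mx//; apply/rowP => i; rewrite !mxE.
exact: derive_cst.
Qed.

Lemma grad_near0 f x : (\forall z \near x, f z = 0) -> grad g f x = 0.
Proof. by move=> f0; rewrite (grad_eq f0 (mdiff_cst 0 x)) grad_cst. Qed.

Lemma mdiff_derivable f x i : mdiff f x ->
  derivable (f \o param (chart_at x)) (chart_at x x) (delta_mx 0 i).
Proof. exact: diff_derivable. Qed.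

Lemma gradD f h x : mdiff f x -> mdiff h x -> grad g (fun z => f z + h z) x = grad g f x + grad g h x.
Proof.
move=> df dh; rewrite !grad_dvec//; last exact: mdiffD.
rewrite -mulmxDl; congr (_ *m _); apply/rowP => i; rewrite !mxE.
exact (deriveD (mdiff_derivable (i := i) df) (mdiff_derivable (i := i) dh)).
Qed.

Lemma gradM f h x : mdiff f x -> mdiff h x ->
  grad g (fun z => f z * h z) x = f x *: grad g h x + h x *: grad g f x.
Proof.
move=> df dh; rewrite !grad_dvec//; last exact: mdiffM.
rewrite !scalemxAl -mulmxDl; congr (_ *m _); apply/rowP => i; rewrite !mxE.
have := deriveM (mdiff_derivable (i := i) df) (mdiff_derivable (i := i) dh).
by rewrite /= !coordK//; exact: chart_at_dom.
Qed.

Lemma differentiable_powR (p : R) (f : 'rV[R]_n -> R) y : differentiable f y -> 0 < f y ->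
  differentiable (fun z => f z `^ p) y /\
  forall i, partial i (fun z => f z `^ p) y = p * f y `^ (p - 1) * partial i f y.
Proof.
move=> df f0; have [dp pE] := is_derive1_powR p f0.
have dp' : differentiable (fun t : R => t `^ p) (f y) by exact/derivable1_diffP.
split; first exact: (differentiable_comp df dp').
move=> i; have [_] := partial_comp i df dp.
by rewrite derive1E pE.
Qed.

Lemma mdiff_powR p f x : mdiff f x -> 0 < f x -> mdiff (fun z => f z `^ p) x.
Proof.
move=> df f0; have [|//] := differentiable_powR p df.
by rewrite /= coordK//; exact: chart_at_dom.
Qed.

Lemma grad_powR p f x : mdiff f x -> 0 < f x ->
  grad g (fun z => f z `^ p) x = (p * f x `^ (p - 1)) *: grad g f x.
Proof.
move=> df f0; rewrite !grad_dvec//; last exact: mdiff_powR.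
rewrite scalemxAl; congr (_ *m _); apply/rowP => i; rewrite !mxE.
have f0' : 0 < (f \o param (chart_at x)) (chart_at x x).
  by rewrite /= coordK//; exact: chart_at_dom.
have [_ /(_ i)] := differentiable_powR p df f0'.
by rewrite /= coordK//; exact: chart_at_dom.
Qed.

(** The condition of [lipM] at one point, so that it can be proved by cases on whether x lies in a
    compact set carrying the function. *)
Definition lipx f x := forall c, atlas c -> chart_dom c x -> lip_at (f \o param c) (c x).

Lemma lipMP f : lipM f <-> forall x, lipx f x.
Proof. by split => [lf x c|lf c x]; [exact: lf|exact: lf]. Qed.

Lemma lipxM f h x : lipx f x -> lipx h x -> lipx (fun z => f z * h z) x.
Proof. by move=> lf lh c ac cx; exact: (lip_atM (lf c ac cx) (lh c ac cx)). Qed.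

Lemma lipx_eq f h x : (\forall z \near x, f z = h z) -> lipx h x -> lipx f x.
Proof. by move=> fh lh c ac cx; apply: near_eq_lip (lh c ac cx); exact: (near_param cx fh). Qed.

Lemma lipx_cst (a : R) x : lipx (fun=> a) x.
Proof. by move=> c ac cx; exact: lip_at_cst. Qed.

Lemma lipx_powR p f x : lipx f x -> 0 < f x -> lipx (fun z => f z `^ p) x.
Proof.
move=> lf f0 c ac cx; apply: (lip_at_comp (f := f \o param c) (g := fun t => t `^ p)).
  exact: lf.
by apply: lip_at_powR; rewrite /= coordK.
Qed.

Lemma lip_change f c c' x : atlas c -> atlas c' -> chart_dom c x -> chart_dom c' x ->
  lip_at (f \o param c') (c' x) -> lip_at (f \o param c) (c x).
Proof.
move=> ac ac' cx c'x lf; apply: near_eq_lip (transition_factor f cx c'x) _.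
apply: lip_at_comp; first exact: transition_lip ac ac' (overlap_in cx c'x).
by rewrite coordK.
Qed.

Lemma off_closed_near0 (K : set M) f x : closed K -> (forall z, ~ K z -> f z = 0) -> ~ K x ->
  \forall z \near x, f z = 0.
Proof.
move=> cK f0 Kx; have : nbhs x (~` K) by apply: open_nbhs_nbhs; split => //; exact: closed_openC.
by apply: filterS => z; exact: f0.
Qed.

End GradientCalculus.

(** * Cutoff functions *)

Section Bumps.
Context {R : realType} {n : nat}.

Lemma is_derive_sqr_pos_part (t : R) :
  is_derive t 1 (fun s : R => Num.max 0 s ^+ 2) (2 * Num.max 0 t).
Proof.
set l := 2 * Num.max 0 t; pose f s : R := Num.max 0 s ^+ 2.
have C : (fun h : R => h^-1 *: ((f \o shift t) (h *: 1) - f t)) @ 0^' --> l.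
  apply/cvgrPdist_le => e e0; near=> h.
  have h0 : h != 0 by near: h; exact: nbhs_dnbhs_neq.
  have he : `|h| <= e by near: h; exact: dnbhs0_le.
  have -> : l - h^-1 *: ((f \o shift t) (h *: 1) - f t) = h^-1 * (h * l - (f (h + t) - f t)).
    by rewrite [RHS]mulrBr mulKf// /= -[h *: 1]/(h * 1) mulr1.
  rewrite normrM normfV ler_pdivrMl ?normr_gt0//.
  (* The squared positive part differs from its linearization at t by at most h^2, whatever the
     signs of t and h + t. *)
  apply: (@le_trans _ _ (`|h| ^+ 2)); last by rewrite expr2 ler_wpM2l.
  rewrite -normrX [`|h ^+ 2|]ger0_norm ?sqr_ge0// ler_norml /f /l.
  by case: (leP 0 (h + t)) => h1; case: (leP 0 t) => h2; apply/andP; split; nra.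
by split; [apply/cvg_ex; exists l|exact: cvg_lim].
Unshelve. all: by end_near. Qed.

(** Squaring the positive part removes its kink, so the cutoff is of class C^1, as much as the
    integration by parts asks of it. *)
Definition bump_rV (y0 : 'rV[R]_n) (r : R) (y : 'rV[R]_n) : R :=
  Num.max 0 (r ^+ 2 - \sum_i (y 0 i - y0 0 i) ^+ 2) ^+ 2.

Lemma bump_rV_C1 y0 r : C1_on setT (bump_rV y0 r).
Proof.
apply: (C1_on_comp_scalar (h := fun s : R => Num.max 0 s ^+ 2) (h' := fun t => 2 * Num.max 0 t)).
- exact: openT.
- apply: C1_onD; [exact: openT|exact: C1_on_cst|].
  have -> : (fun y : 'rV[R]_n => - \sum_i (y 0 i - y0 0 i) ^+ 2) =
            fun y => \sum_i (-1) * ((y 0 i + - y0 0 i) * (y 0 i + - y0 0 i)).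
    by apply/funext => y; rewrite -sumrN; apply: eq_bigr => i _; ring.
  apply: C1_on_sum => [|i _]; first exact: openT.
  have C : C1_on setT (fun y : 'rV[R]_n => y 0 i + - y0 0 i).
    by apply: C1_onD; [exact: openT|exact: C1_on_coord|exact: C1_on_cst].
  by apply: C1_onM; [exact: openT|exact: C1_on_cst|apply: C1_onM => //; exact: openT].
- move=> y _; split; first by near=> t; exact: is_derive_sqr_pos_part.
  apply: continuousM; first exact: cst_continuous.
  exact: (@continuous_max R R (fun=> 0) id _ (@cst_continuous _ _ _ _) (fun _ H => H)).
Unshelve. all: by end_near. Qed.

Lemma bump_rV_center y0 (r : R) : 0 < r -> 0 < bump_rV y0 r y0.
Proof.
move=> r0; rewrite /bump_rV big1 => [|i _]; last by rewrite subrr expr0n.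
by rewrite subr0 exprn_gt0// lt_max exprn_gt0 ?orbT.
Qed.

Lemma bump_rV_support y0 (r : R) y : 0 < r -> bump_rV y0 r y != 0 -> `|y - y0| < r.
Proof.
move=> r0; rewrite /bump_rV sqrf_eq0 => H.
have {}H : \sum_i (y 0 i - y0 0 i) ^+ 2 < r ^+ 2.
  by rewrite ltNge; apply: contra H => H; rewrite max_l ?subr_le0.
apply: norm_lt_coord => // i; rewrite !mxE.
rewrite -(@ltr_pXn2r _ 2) ?nnegrE ?(ltW r0)// -normrX ger0_norm ?sqr_ge0//.
apply: le_lt_trans H; rewrite (bigD1 i)//= lerDl sumr_ge0// => j _; exact: sqr_ge0.
Qed.

End Bumps.

Section ManifoldBumps.
Context {R : realType} {n : nat} {M : manifold R n}.
Implicit Types (c : chart R n M) (x : M) (f h k w phi A : M -> R).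

Lemma compact_closedM (K : set M) : compact K -> closed K.
Proof. by move=> cK; apply: compact_closed => //; exact: manifold_hausdorff. Qed.

Lemma bump_exists c x (O : set M) : atlas c -> chart_dom c x -> open O -> O x ->
  exists b : M -> R, [/\ (forall z, 0 <= b z), 0 < b x, lipM b, (forall z, mdiff b z) &
    exists K, [/\ compact K, K `<=` O, K `<=` chart_dom c & forall z, ~ K z -> b z = 0]].
Proof.
move=> ac cx oO Ox; set y0 := c x.
have : \forall y \near y0, chart_image c y /\ O (param c y).
  have H1 := near_image (chart_imageE cx); have H2 := near_param cx (open_nbhs_nbhs (conj oO Ox)).
  by apply: filterS2 H1 H2.
(* Halving the radius keeps the closed ball, which is compact, inside the open ball where the
   conditions hold. *)
move=> /nbhs_ballP [r' /= r'0 r'P]; pose r := r' / 2.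
have r0 : 0 < r by rewrite divr_gt0.
pose Q := [set y : 'rV[R]_n | `|y - y0| <= r].
have QP y : Q y -> chart_image c y /\ O (param c y).
  move=> Qy; apply: r'P; rewrite -ball_normE /= distrC; apply: le_lt_trans Qy _.
  by rewrite /r; lra.
have cQ : compact Q.
  apply: bounded_closed_compact.
    exists (r + `|y0|); split; first exact: num_real.
    move=> B rB y Qy; apply: ltW; apply: le_lt_trans rB.
    by rewrite -[y](subrK y0); apply: le_trans (ler_normD _ _) _; rewrite lerD2r.
  have -> : Q = (fun y => `|y - y0|) @^-1` [set t | t <= r] by [].
  apply: closed_comp; last exact: closed_le.
  move=> y _; apply: continuous_comp; last exact: norm_continuous.
  by apply: continuousB; [move=> ?; exact|exact: cst_continuous].
pose K := param c @` Q.
have cK : compact K.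
  apply: continuous_compact cQ; apply: continuous_in_subspaceT => y /[!inE] /QP[cy _].
  exact: param_continuous.
have Kc : K `<=` chart_dom c by move=> _ [y /QP[cy _] <-]; exact: param_dom.
have KO : K `<=` O by move=> _ [y /QP[_ Oy] <-].
pose b z := if z \in chart_dom c then bump_rV y0 r (c z) else 0.
have b0 z : ~ K z -> b z = 0.
  move=> Kz; rewrite /b; case: ifPn => // /set_mem cz.
  apply/eqP; apply: contrapT => /negP /(bump_rV_support r0) /ltW zr.
  by apply: Kz; exists (c z) => //; exact: coordK.
have bc z : chart_dom c z -> {near c z, b \o param c =1 bump_rV y0 r}.
  move=> cz; apply: filterS (near_image (chart_imageE cz)) => y cy.
  by rewrite /b /= mem_set ?paramK//; exact: param_dom.
exists b; split.
- by move=> z; rewrite /b; case: ifP => // _; exact: sqr_ge0.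
- by rewrite /b mem_set//; exact: bump_rV_center.
- apply/lipMP => z; have [cz|cz] := pselect (chart_dom c z).
    move=> c' ac' c'z; apply: (lip_change ac' ac c'z cz).
    apply: near_eq_lip (bc z cz) _.
    exact: C1_lip openT (@bump_rV_C1 _ _ y0 r) I.
  apply: (lipx_eq (h := fun=> 0)); last exact: lipx_cst.
  by apply: off_closed_near0 (compact_closedM cK) b0 _ => /Kc.
- move=> z; have [cz|cz] := pselect (chart_dom c z).
    apply: (chart_mdiff ac cz); apply: near_eq_differentiable (bc z cz) _.
    exact: C1_differentiable openT (@bump_rV_C1 _ _ y0 r) I.
  apply: (mdiff_eq (h := fun=> 0)); last exact: mdiff_cst.
  by apply: off_closed_near0 (compact_closedM cK) b0 _ => /Kc.
- by exists K; split.
Qed.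

End ManifoldBumps.

(** * The divergence of A grad phi and integration by parts on M *)

Section GlobalIntegrationByParts.
Context {R : realType} {n : nat} {M : manifold R n} (g : metric M).
Implicit Types (c : chart R n M) (x : M) (f h k w phi A : M -> R).
Local Notation E := (borel 'rV[R]_n).

Lemma continuous_chart c x (F : 'rV[R]_n -> R) : chart_dom c x ->
  {for c x, continuous F} -> {for x, continuous (F \o c)}.
Proof. by move=> cx cF; apply: continuous_comp => //; exact: Defs.coord_continuous. Qed.

Lemma continuous_wdiv c A phi x : atlas c -> C1M A -> smooth phi -> chart_dom c x ->
  {for x, continuous (wdiv g c A phi)}.
Proof.
move=> ac CA sp cx; have oc := @open_chart_image _ _ _ c; have cy := chart_imageE cx.
have -> : wdiv g c A phi = (fun y => (vol_density g c y)^-1 *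
    \sum_i partial i (flux g c A phi i) y) \o c by apply/funext => z; rewrite wdivE.
apply: continuous_chart => //; apply: continuousM.
  apply: continuousV; first by rewrite gt_eqF// vol_density_gt0.
  exact: C1_continuous oc (vol_density_C1 g ac) cy.
apply: (@cvg_sumr R _ _ (nbhs (c x)) _ _ xpredT (fun i => partial i (flux g c A phi i))) => i _.
by have [] := flux_C1 g i ac CA sp cy i.
Qed.

Lemma nice_wdiv (N : set (borel M)) (mN : measurable N) c A phi x : atlas c -> C1M A -> smooth phi -> chart_dom c x ->
  nice N (wdiv g c A phi) x.
Proof.
move=> ac CA sp cx; apply: (nice_continuous N (@open_chart_dom _ _ _ c) cx) => z cz.
exact: continuous_wdiv.
Qed.

Lemma nice_lip (N : set (borel M)) (mN : measurable N) f x : lipM f -> nice N f x.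
Proof. by move=> lf; apply: (nice_continuous N openT) => // z _; exact: lipM_continuous. Qed.

(** Near x and off N, [pair] is a polynomial in first derivatives and inverse Gram entries of one
    fixed chart. *)
Lemma nice_pair (N : set (borel M)) (mN : measurable N) f h x : lipM f -> lipM h ->
  (forall z, ~ N z -> mdiff f z) -> (forall z, ~ N z -> mdiff h z) -> nice N (pair g f h) x.
Proof.
move=> lf lh df dh; set c := chart_at x.
have ac : atlas c := chart_at_atlas x; have cx : chart_dom c x := chart_at_dom x.
apply: (nice_eq mN (@open_chart_dom _ _ _ c) cx (h := fun z => \sum_i
   (\sum_k partial k (f \o param c) (c z) * invmx (g c (c z)) k i) * partial i (h \o param c) (c z))).
  move=> z cz Nz; rewrite (pair_chart g ac cz (df z Nz) (dh z Nz)) mxE.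
  apply: eq_bigr => i _; rewrite !mxE; congr (_ * _); apply: eq_bigr => k _.
  by rewrite mxE.
apply: nice_sum => // i; apply: niceM => //; last exact: nice_partial.
apply: nice_sum => // k; apply: niceM => //; first exact: nice_partial.
apply: (nice_continuous N (@open_chart_dom _ _ _ c) cx) => z cz.
apply: (@continuous_chart c z (fun y => invmx (g c y) k i)) => //.
exact: C1_continuous (@open_chart_image _ _ _ c) (gram_inv_C1 g k i ac) (chart_imageE cz).
Qed.

Lemma pair_near0 f h x : (\forall z \near x, f z = 0) -> pair g f h x = 0.
Proof. by move=> f0; rewrite /pair grad_near0// /inner !mul0mx mxE. Qed.

Lemma nice_ibp (N : set (borel M)) (mN : measurable N) c w A phi x : atlas c -> chart_dom c x ->
  lipM w -> (forall z, ~ N z -> mdiff w z) -> C1M A -> smooth phi ->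
  nice N (fun x => A x * pair g w phi x + w x * wdiv g c A phi x) x.
Proof.
move=> ac cx lw dw CA sp; apply: niceD => //; apply: niceM => //.
- exact/nice_lip/C1M_lip.
- by apply: nice_pair => //; [exact/C1M_lip/smooth_C1M|move=> z _; exact: smooth_mdiff].
- exact: nice_lip.
- exact: nice_wdiv.
Qed.

Variables (vol : {measure set (borel M) -> \bar R}) (leb : {measure set E -> \bar R}).
Hypothesis hleb : is_lebesgue leb.
Hypothesis hvol : forall (c : chart R n M) (A : set (borel M)),
    atlas c -> measurable A -> A `<=` chart_dom c ->
    vol A = (\int[leb]_(y in c @` A) (vol_density g c y)%:E)%E.

Lemma integral_by_parts_in_chart (N : set (borel M)) c w A phi (K : set M) :
  measurable N -> vol N = 0 -> atlas c -> compact K -> K `<=` chart_dom c ->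
  (forall z, ~ K z -> w z = 0) -> lipM w -> (forall z, ~ N z -> mdiff w z) ->
  C1M A -> smooth phi ->
  (\int[vol]_(x in ~` N) (A x * pair g w phi x + w x * wdiv g c A phi x)%:E = 0)%E.
Proof.
move=> mN N0 ac cK Kc w0 lw dw CA sp.
rewrite -(integral_chart_by_parts hleb hvol mN N0 ac cK Kc w0 lw dw CA sp).
rewrite setDE setIC integral_mkcondr; apply: eq_integral => x _; rewrite patchE.
case: ifPn => // /negP cx; have Kx : ~ K x by move=> /Kc /mem_set.
rewrite pair_near0; last exact: off_closed_near0 (compact_closedM cK) w0 Kx.
by rewrite w0// mul0r mulr0 addr0.
Qed.

(* Both charts compute the same distribution, hence the same continuous function:
   no Jacobi formula for the derivative of a determinant is needed. *)
Lemma wdiv_le c c' A phi x : atlas c -> atlas c' -> chart_dom c x -> chart_dom c' x ->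
  C1M A -> smooth phi -> wdiv g c A phi x <= wdiv g c' A phi x.
Proof.
move=> ac ac' cx c'x CA sp; rewrite leNgt; apply/negP => lt.
pose d z := wdiv g c A phi z - wdiv g c' A phi z.
have cd z : chart_dom c z -> chart_dom c' z -> {for z, continuous d}.
  by move=> cz c'z; apply: continuousB; exact: continuous_wdiv.
have dx : 0 < d x by rewrite subr_gt0.
have : nbhs x [set z | [/\ chart_dom c z, chart_dom c' z & 0 < d z]].
  have H1 := near_dom cx; have H2 := near_dom c'x.
  have H3 : \forall z \near x, 0 < d z by apply: (cvgr_gt (d x) (cd x cx c'x)).
  by apply: filterS3 H1 H2 H3.
rewrite nbhsE => -[ O [oO Ox] OP].
(* The bump b lives where d > 0. Integration by parts in each chart makes the integral of b d
   vanish, while b d is positive on a nonempty open set, which has positive volume. *)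
have [b [b0 bx lb db [K [cK KO Kc bK]]]] := bump_exists ac cx oO Ox.
have Kc' : K `<=` chart_dom c' by move=> z /KO/OP[].
have m0 : measurable (set0 : set (borel M)) by exact: measurable0.
have I1 := integral_by_parts_in_chart m0 (measure0 vol) ac cK Kc bK lb (fun z _ => db z) CA sp.
have I2 := integral_by_parts_in_chart m0 (measure0 vol) ac' cK Kc' bK lb (fun z _ => db z) CA sp.
have mT : measurable (~` set0 : set (borel M)) by rewrite setC0.
have iI : vol.-integrable (~` set0) (EFin \o (fun z => A z * pair g b phi z + b z * wdiv g c' A phi z) : borel M -> \bar R).
  apply: (nice_integrable hleb hvol m0 cK) => z Kz.
    by apply: nice_ibp => //; exact: Kc'.
  by move=> _; rewrite pair_near0 ?bK// ?mul0r ?mulr0 ?addr0//; exact: off_closed_near0 (compact_closedM cK) bK Kz.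
have ibd : vol.-integrable (~` set0) (EFin \o (fun z => b z * d z) : borel M -> \bar R).
  apply: (nice_integrable hleb hvol m0 cK) => z Kz; last by rewrite bK// mul0r.
  apply: niceM => //; first exact: nice_lip.
  apply: (nice_continuous set0 oO (KO z Kz)) => y /OP[cy c'y _]; exact: cd.
have int0 : (\int[vol]_(z in ~` set0) (b z * d z)%:E = 0)%E.
  have E1 : (\int[vol]_(z in ~` set0) (A z * pair g b phi z + b z * wdiv g c A phi z)%:E =
     \int[vol]_(z in ~` set0) ((A z * pair g b phi z + b z * wdiv g c' A phi z)%:E + (b z * d z)%:E))%E.
    by apply: eq_integral => z _; rewrite -EFinD; congr (_%:E); rewrite /d; ring.
  by move: E1; rewrite I1 integralD_EFin// I2 add0e => <-.
have bd0 z : 0 <= b z * d z.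
  have [/KO/OP[_ _ dz]|Kz] := pselect (K z); first by rewrite mulr_ge0// ltW.
  by rewrite bK// mul0r.
pose U := O `&` b @^-1` [set t | 0 < t].
have oU : open U.
  by apply: openI => //; apply: open_comp; [move=> z _; exact: lipM_continuous|exact: open_gt].
have mU := open_borel oU.
have mbd : measurable_fun (~` set0 : set (borel M)) ((fun z => b z * d z) : borel M -> R).
  by apply/measurable_EFinP; exact: measurable_int ibd.
have mbdU : measurable_fun (U : set (borel M)) ((fun z => b z * d z) : borel M -> R).
  by apply: measurable_funS mbd => //; rewrite setC0.
have := open_vol_gt0 hleb hvol oU (conj Ox bx).
rewrite (@integral_pos_eq0 _ (borel M) R vol U (fun z => b z * d z)) ?ltxx//.
  by move=> z [/OP[_ _ dz] bz]; exact: mulr_gt0.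
apply/eqP; rewrite eq_le; apply/andP; split; last by apply: integral_ge0 => z _; rewrite lee_fin.
rewrite -int0; apply: ge0_subset_integral => //.
- exact/measurable_EFinP.
- by move=> z _; rewrite lee_fin.
- by rewrite setC0.
Qed.

Lemma wdiv_chart_indep c c' A phi x : atlas c -> atlas c' -> chart_dom c x -> chart_dom c' x ->
  C1M A -> smooth phi -> wdiv g c A phi x = wdiv g c' A phi x.
Proof. by move=> *; apply/eqP; rewrite eq_le !wdiv_le. Qed.

(** The chart changes with x; [wdiv_chart_indep] makes this agree on a whole chart domain with the
    expression in that chart, which is how it inherits continuity. *)
Definition gdiv A phi x := wdiv g (chart_at x) A phi x.

Lemma gdiv_chart c A phi x : atlas c -> chart_dom c x -> C1M A -> smooth phi ->
  gdiv A phi x = wdiv g c A phi x.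
Proof.
move=> ac cx CA sp; apply: wdiv_chart_indep => //; [exact: chart_at_atlas|exact: chart_at_dom].
Qed.

Lemma nice_gdiv (N : set (borel M)) (mN : measurable N) A phi x : C1M A -> smooth phi -> nice N (gdiv A phi) x.
Proof.
move=> CA sp; have ac := chart_at_atlas x; have cx := chart_at_dom x.
apply: (nice_eq mN (@open_chart_dom _ _ _ (chart_at x)) cx (h := wdiv g (chart_at x) A phi)).
  by move=> z cz _; exact: gdiv_chart.
exact: nice_wdiv.
Qed.

Variables (N : set (borel M)).
Hypotheses (mN : measurable N) (N0 : vol N = 0).
Variables (K : set M) (A phi : M -> R).
Hypotheses (cK : compact K) (CA : C1M A) (sp : smooth phi).

(** Powers of rho enter the functions w, which are therefore only Lipschitz, and differentiable off
    N. *)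
Definition admissible w := [/\ lipM w, forall z, ~ N z -> mdiff w z & forall z, ~ K z -> w z = 0].

Definition ibp_integrand w z := A z * pair g w phi z + w z * gdiv A phi z.

Lemma ibp_integrable w : admissible w ->
  vol.-integrable (~` N) (EFin \o ibp_integrand w : borel M -> \bar R).
Proof.
move=> [lw dw w0]; apply: (nice_integrable hleb hvol mN cK) => z Kz.
  apply: niceD => //; apply: niceM => //.
  - exact/nice_lip/C1M_lip.
  - by apply: nice_pair => //; [exact/C1M_lip/smooth_C1M|move=> y _; exact: smooth_mdiff].
  - exact: nice_lip.
  - exact: nice_gdiv.
move=> _; rewrite /ibp_integrand pair_near0 ?w0// ?mul0r ?mulr0 ?addr0//.
exact: off_closed_near0 (compact_closedM cK) w0 Kz.
Qed.

Lemma ibp_integrandD w w' z : mdiff w z -> mdiff w' z ->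
  ibp_integrand (fun z => w z + w' z) z = ibp_integrand w z + ibp_integrand w' z.
Proof.
move=> dw dw'; rewrite /ibp_integrand /pair gradD// innerDl; ring.
Qed.

Lemma admissibleD w w' : admissible w -> admissible w' -> admissible (fun z => w z + w' z).
Proof.
move=> [lw dw w0] [lw' dw' w'0]; split; first exact: lipM_D.
- by move=> z Nz; apply: mdiffD; [exact: dw|exact: dw'].
- by move=> z Kz; rewrite w0// w'0// addr0.
Qed.

Lemma admissible0 : admissible (fun=> 0).
Proof. by split => // [c x ac cx|z _]; [exact: lip_at_cst|exact: mdiff_cst]. Qed.

Lemma ibp_sum (s : seq (M -> R)) :
  (forall i, (i < size s)%N -> admissible (nth (fun=> 0) s i) /\
    (\int[vol]_(z in ~` N) (ibp_integrand (nth (fun=> 0%R) s i) z)%:E = 0)%E) ->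
  admissible (fun z => \sum_(w <- s) w z) /\
  (\int[vol]_(z in ~` N) (ibp_integrand (fun z => \sum_(w <- s) w z)%R z)%:E = 0)%E.
Proof.
elim: s => [_|w s IH H].
  have -> : (fun z : M => \sum_(w <- [::]) (w : M -> R) z) = fun=> 0.
    by apply/funext => z; rewrite big_nil.
  split; first exact: admissible0.
  apply: integral0_eq => z _; rewrite /ibp_integrand pair_near0 ?mul0r ?mulr0 ?addr0//.
  exact: nearW.
have -> : (fun z : M => \sum_(w <- w :: s) w z) = fun z => w z + \sum_(w <- s) w z.
  by apply/funext => z; rewrite big_cons.
have [aw iw] := H 0%N isT.
have [as_ is_] := IH (fun i => H i.+1).
split; first exact: admissibleD.
transitivity (\int[vol]_(z in ~` N) ((ibp_integrand w z)%:E + (ibp_integrand (fun z => \sum_(w <- s) w z) z)%:E))%E.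
  apply: eq_integral => z /[!inE] Nz; rewrite -EFinD ibp_integrandD//.
  - by case: aw => _ + _; exact.
  - by case: as_ => _ + _; exact.
rewrite integralD_EFin//; [|exact: measurableC|exact: ibp_integrable|exact: ibp_integrable].
by rewrite iw is_ adde0.
Qed.

Definition bump_like (b : M -> R) := [/\ forall z, 0 <= b z, lipM b, forall z, mdiff b z &
  exists c L, [/\ atlas c, compact L, L `<=` chart_dom c & forall z, ~ L z -> b z = 0]].

Lemma bump_cover : exists s : seq {b | bump_like b}, forall z, K z -> 0 < \sum_(b <- s) sval b z.
Proof.
pose P (O : set M) := exists s : seq {b | bump_like b}, forall z, O z -> 0 < \sum_(b <- s) sval b z.
have [||x Kx|O [s sP] KO] := @compact_cover_union _ K P cK.
- by exists [::].
- move=> O O' [s sP] [s' s'P]; exists (s ++ s') => z; rewrite big_cat /=.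
  have ge0 (t : seq {b | bump_like b}) : 0 <= \sum_(b <- t) sval b z.
    by apply: sumr_ge0 => -[b [b0 ? ? ?]] _; exact: b0.
  by case=> [/sP|/s'P] h; [exact: ltr_wpDr|exact: ltr_wpDl].
- have [b [b0 bx lb db [L [cL _ Lc bL]]]] := bump_exists (chart_at_atlas x) (chart_at_dom x) openT (I : setT x).
  have gb : bump_like b.
    by split => //; exists (chart_at x), L; split => //; exact: chart_at_atlas.
  exists (b @^-1` [set t | 0 < t]).
    by exists [:: exist _ b gb] => z /= bz; rewrite big_seq1.
  apply: open_nbhs_nbhs; split => //.
  by apply: open_comp; [move=> z _; exact: lipM_continuous|exact: open_gt].
- by exists s => z /KO /sP.
Qed.

(** A partition of unity: with S the sum of finitely many bumps, positive on K, w is the sum of the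
    pieces b (w / S), each supported in a single chart. *)
Theorem weighted_integration_by_parts w : admissible w ->
  (\int[vol]_(z in ~` N) (ibp_integrand w z)%:E = 0)%E.
Proof.
move=> [lw dw w0]; have [s sP] := bump_cover.
pose S z := \sum_(b <- s) sval b z.
have lS : lipM S.
  rewrite /S; elim: (s) => [|b t IH].
    have -> : (fun z : M => \sum_(b <- [::]) sval (b : {b | bump_like b}) z) = fun=> 0.
      by apply/funext => z; rewrite big_nil.
    by move=> c x ac cx; exact: lip_at_cst.
  have -> : (fun z : M => \sum_(b <- b :: t) sval b z) = fun z => sval b z + \sum_(b <- t) sval b z.
    by apply/funext => z; rewrite big_cons.
  by apply: lipM_D => //; case: b => b [].
have dS z : mdiff S z.
  rewrite /S; elim: (s) => [|b t IH].
    have -> : (fun z : M => \sum_(b <- [::]) sval (b : {b | bump_like b}) z) = fun=> 0.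
      by apply/funext => y; rewrite big_nil.
    exact: mdiff_cst.
  have -> : (fun z : M => \sum_(b <- b :: t) sval b z) = fun z => sval b z + \sum_(b <- t) sval b z.
    by apply/funext => y; rewrite big_cons.
  by apply: mdiffD => //; case: b => b [? ? + ?]; exact.
(* On K, where S > 0, this is w / S; off K, where S may vanish, it is 0 because w is. *)
pose q z := w z * S z `^ (-1).
have q0 z : ~ K z -> q z = 0 by move=> Kz; rewrite /q w0// mul0r.
have clK := compact_closedM cK.
have lq : lipM q.
  apply/lipMP => z; have [Kz|Kz] := pselect (K z).
    apply: lipxM; first by move/lipMP: lw; exact.
    by apply: lipx_powR; [move/lipMP: lS; exact|exact: sP].
  by apply: (lipx_eq (h := fun=> 0)); [exact: off_closed_near0 clK q0 Kz|exact: lipx_cst].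
have dq z : ~ N z -> mdiff q z.
  move=> Nz; have [Kz|Kz] := pselect (K z).
    by apply: mdiffM; [exact: dw|apply: mdiff_powR => //; exact: sP].
  by apply: (mdiff_eq (h := fun=> 0)); [exact: off_closed_near0 clK q0 Kz|exact: mdiff_cst].
have wE : w = fun z => \sum_(b <- [seq (fun z => sval b z * q z) | b <- s]) b z.
  apply/funext => z; rewrite big_map /= -mulr_suml -/(S z) /q.
  have [Kz|Kz] := pselect (K z); last by rewrite w0// mul0r mulr0.
  have Sz := sP z Kz.
  by rewrite powR_inv1 ?ltW// mulrCA mulfV ?mulr1// gt_eqF.
rewrite wE; apply: (proj2 (ibp_sum _)) => i; rewrite size_map => si.
(* The list is nonempty here and supplies the default element for [nth_map]. *)
have [b0 _] : exists b : {b | bump_like b}, True by case: (s) si => // b; exists b.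
rewrite (nth_map b0)//; case: (nth b0 s i) => b [bge0 lb db [c [L [ac cL Lc bL]]]] /=.
have ab : admissible (fun z => b z * q z).
  split; first exact: lipM_M.
  - by move=> z Nz; apply: mdiffM; [exact: db|exact: dq].
  - by move=> z Kz; rewrite q0// mulr0.
split => //.
have [lb' db' _] := ab.
have L0 z : ~ L z -> b z * q z = 0 by move=> Lz; rewrite bL// mul0r.
(* On L, [gdiv] is the divergence computed in the chart of the bump; off L the piece vanishes, so
   the second terms agree there too. *)
rewrite -(integral_by_parts_in_chart mN N0 ac cL Lc L0 lb' db' CA sp).
apply: eq_integral => z /[!inE] Nz; congr (_%:E); congr (_ + _).
have [Lz|Lz] := pselect (L z); last by rewrite L0// !mul0r.
by congr (_ * _); apply: gdiv_chart => //; exact: Lc.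
Qed.

End GlobalIntegrationByParts.

(** * The Riemannian distance *)

Section LocallyIncreasing.
Context {R : realType}.

(** A supremum argument without continuity of h: at the supremum of the t with h 0 <= h t, the
    comparison with points on the left puts it in the set, and that with points on the right
    excludes a supremum below 1. *)
Lemma locally_increasing (h : R -> R) :
  (forall t : R, 0 <= t <= 1 -> \forall r \near t, (t <= r -> h t <= h r) /\ (r <= t -> h r <= h t)) ->
  h 0 <= h 1.
Proof.
move=> H; pose T := [set t : R | 0 <= t <= 1 /\ h 0 <= h t].
have T0 : T 0 by split => //; rewrite lexx ler01.
have Tsup : has_sup T by split; [exists 0|exists 1 => t [/andP[]]].
pose s := sup T.
have s0 : 0 <= s by exact: ub_le_sup (proj2 Tsup) _ T0.
have s1 : s <= 1 by apply: ge_sup; [exists 0|move=> t [/andP[]]].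
have /H : 0 <= s <= 1 by rewrite s0.
move=> /nbhs_ballP [d /= d0 sd].
have hs : h 0 <= h s.
  have [t Tt ts] := sup_adherent d0 Tsup.
  have ts' : t <= s by exact: ub_le_sup (proj2 Tsup) _ Tt.
  have tb : ball s d t by rewrite -ball_normE /= ger0_norm ?subr_ge0//; move: ts; rewrite -/s; lra.
  by have [_ /(_ ts')] := sd t tb; exact: le_trans (proj2 Tt).
have [s1'|s1'] := eqVneq s 1; first by rewrite -s1'.
have slt : s < 1 by rewrite lt_neqAle s1'.
pose r := Num.min (s + d / 2) 1.
have sr : s < r by rewrite lt_min slt andbT; lra.
have [/(_ (ltW sr)) hr _] : (s <= r -> h s <= h r) /\ (r <= s -> h r <= h s).
  apply: sd; rewrite -ball_normE /= ltr0_norm ?subr_lt0//.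
  have rle : r <= s + d / 2 by rewrite ge_min lexx.
  by lra.
have : r <= s.
  apply: ub_le_sup (proj2 Tsup) _ _; split; last exact: le_trans hr.
  by rewrite ge_min lexx orbT andbT (le_trans s0)// ltW.
by rewrite leNgt sr.
Qed.

Lemma integral01_increment (s : R -> R) : continuous s -> exists F : R -> R,
  (\int[lebesgue_measure]_(t in `[0%R, 1%R]) (s t)%:E = (F 1 - F 0)%:E)%E /\
  forall t : R, 0 <= t <= 1 -> is_derive t 1 F (s t).
Proof.
move=> cs; pose mu := @lebesgue_measure R.
have is_ (a b : R) : mu.-integrable `[a, b] (EFin \o s).
  by apply: continuous_compact_integrable; [exact: segment_compact|exact: continuous_subspaceT].
(* Starting at -1 makes 0 an interior point, so that F has a two-sided derivative at both ends of
   the unit interval. *)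
pose F x := (\int[mu]_(t in `[(-1)%R, x]) s t)%R.
exists F; split; last first.
  move=> t /andP[t0 t1].
  have t2 : t < 2 by apply: le_lt_trans t1 _; rewrite ltr1n.
  have tm : -1 < t by apply: lt_le_trans t0; rewrite ltrN10.
  have [dF FE] := continuous_FTC1_closed t2 (is_ (-1) 2) tm (cs t).
  by split; [exact: dF|rewrite -derive1E].
have c1 : (BLeft (-1) <= BRight (0 : R))%O by rewrite bnd_simp lerN10.
have c2 : (BRight (0 : R) <= BRight (1 : R))%O by rewrite bnd_simp ler01.
have := Rintegral_itvB (is_ (-1) 1) c1 c2.
rewrite -/(F 1) -/(F 0) => ->.
rewrite Rintegral_itv_obnd_cbnd; last first.
  by apply: integrableS (is_ 0 1) => //; apply: subset_itv; rewrite bnd_simp.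
by rewrite /Rintegral fineK//; apply: integrable_fin_num => //; exact: is_.
Qed.

(* A Dini-derivative version of the mean value inequality. *)
Lemma increment_le_integral (f s : R -> R) (k : R) : 0 <= k -> continuous s ->
  (forall t : R, 0 <= t <= 1 -> forall e : R, 0 < e ->
     \forall r \near t, `|f r - f t| <= k * (s t + e) * `|r - t|) ->
  (`|f 1 - f 0|%:E <= k%:E * \int[lebesgue_measure]_(t in `[0%R, 1%R]) (s t)%:E)%E.
Proof.
move=> k0 cs fs; have [F [-> dF]] := integral01_increment cs.
rewrite -EFinM lee_fin.
(* The sign sg treats both halves of the absolute value. One e is the slack in the hypothesis on f,
   the other the linearization error of F, hence 2ke. *)
suff H (sg : R) (e : R) : `|sg| = 1 -> 0 < e -> sg * (f 1 - f 0) <= k * (F 1 - F 0) + 2 * k * e.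
  have H' (sg : R) : `|sg| = 1 -> sg * (f 1 - f 0) <= k * (F 1 - F 0).
    move=> sg1; apply/ler_addgt0Pr => e e0.
    have [k00|kn0] := eqVneq k 0.
      have := H sg e sg1 e0; rewrite k00 !(mul0r, mulr0) addr0 => H0.
      by apply: le_trans H0 _; rewrite add0r ltW.
    have kp : 0 < k by rewrite lt_neqAle eq_sym kn0.
    have := H sg (e / (2 * k)) sg1; rewrite divr_gt0 ?mulr_gt0// => /(_ isT).
    by rewrite mulrC [2 * k * _]mulrC divfK// mulf_neq0.
  have H1 := H' 1 (normr1 _); have H2 := H' (-1).
  rewrite normrN normr1 in H2; have {}H2 := H2 erefl.
  by rewrite ler_norml; apply/andP; split; move: H1 H2; rewrite mul1r mulN1r; lra.
move=> sg1 e0; pose h t := k * F t + 2 * k * e * t - sg * f t.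
suff : h 0 <= h 1 by rewrite /h; lra.
apply: locally_increasing => t t01.
have [dFt FE] := dF t t01; have := fs t t01 e e0.
have dFt' : differentiable F t by exact/derivable1_diffP.
have : \forall r \near t, `|F r - F t - s t * (r - t)| <= e * `|r - t|.
  have := diff_epsE dFt' e0; rewrite (near_shift t) /= sub0r.
  apply: filterS => r; rewrite /= subrK.
  suff -> : 'd F t (r - t) = s t * (r - t) by [].
  by rewrite -FE deriveE// -[r - t in LHS]mulr1 [LHS]linearZ mulrC.
apply: filterS2 => r Fr fr.
have S1 : sg * (f r - f t) <= `|f r - f t|.
  by apply: le_trans (ler_norm _) _; rewrite normrM sg1 mul1r.
have S2 : - (sg * (f r - f t)) <= `|f r - f t|.
  by apply: le_trans (ler_norm _) _; rewrite normrN normrM sg1 mul1r.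
split => tr.
  have rt : 0 <= r - t by rewrite subr_ge0.
  rewrite (ger0_norm rt) in Fr fr.
  have kF : k * (s t * (r - t) - e * (r - t)) <= k * (F r - F t).
    by rewrite ler_wpM2l//; move: Fr; rewrite ler_norml => /andP[]; lra.
  by rewrite /h; move: kF fr S1; nra.
have rt : r - t <= 0 by rewrite subr_le0.
rewrite (ler0_norm rt) in Fr fr.
have kF : k * (F r - F t) <= k * (s t * (r - t) - e * (r - t)).
  by rewrite ler_wpM2l//; move: Fr; rewrite ler_norml => /andP[]; lra.
by rewrite /h; move: kF fr S2; nra.
Qed.

End LocallyIncreasing.

(** * Speed of curves, and the metric compared with the coordinate norm *)

Section Curves.
Context {R : realType} {n : nat} {M : manifold R n} (g : metric M).
Implicit Types (c : chart R n M) (x : M) (f h w phi A : M -> R) (k : 'I_n) (gamma : R -> M).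

Lemma velocity_change c c' gamma (t : R) : atlas c -> atlas c' ->
  chart_dom c (gamma t) -> chart_dom c' (gamma t) -> {for t, continuous gamma} ->
  derivable (c \o gamma) t 1 -> derivable (c' \o gamma) t 1 /\
  derive1 (c' \o gamma) t = derive1 (c \o gamma) t *m jac c c' (c (gamma t)).
Proof.
move=> ac ac' ct c't cg dc.
have dc' : is_diff t (c \o gamma) ('d (c \o gamma) t) by apply: differentiableP; exact/derivable1_diffP.
have dT := transition_is_diff ac ac' (overlap_in ct c't).
have E : {near t, c' \o gamma =1 (fun z => c' (param c z)) \o (c \o gamma)}.
  have H : \forall s \near t, chart_dom c (gamma s) by exact: (cg _ (near_dom ct)).
  by apply: filterS H => s cs; rewrite /= coordK.
have [D V] := near_eq_is_diff E (is_diff_comp dc' dT).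
split; first exact/derivable1_diffP.
rewrite derive1E' // V /= derive1E'//.
Qed.

(** The preferred chart in [speed] may jump along the curve. Computing in one fixed chart gives the
    same value and makes continuity visible. *)
Lemma speed_chart c gamma (t : R) : atlas c -> chart_dom c (gamma t) -> {for t, continuous gamma} ->
  derivable (c \o gamma) t 1 ->
  speed g gamma t = Num.sqrt ((derive1 (c \o gamma) t *m g c (c (gamma t)) *m (derive1 (c \o gamma) t)^T) 0 0).
Proof.
move=> ac ct cg dc; rewrite /speed /tnorm /inner.
have ac' := chart_at_atlas (gamma t); have c't := chart_at_dom (gamma t).
have [_ ->] := velocity_change ac ac' ct c't cg dc.
by rewrite (gram_change g ac ac' ct c't) trmx_mul !mulmxA.
Qed.

Lemma speed_ge0 gamma t : 0 <= speed g gamma t.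
Proof. exact: sqrtr_ge0. Qed.

Lemma quad_sum (v : 'rV[R]_n) (G : 'M[R]_n) :
  (v *m G *m v^T) 0 0 = \sum_j (\sum_i v 0 i * G i j) * v 0 j.
Proof. by rewrite mxE; apply: eq_bigr => j _; rewrite !mxE. Qed.

Lemma continuous_gram c x i j : atlas c -> chart_dom c x -> {for c x, continuous (fun y => g c y i j)}.
Proof.
move=> ac cx.
exact: C1_continuous (@open_chart_image _ _ _ c) (gram_C1 g i j ac) (chart_imageE cx).
Qed.

Lemma speed_continuous gamma : C1_curve gamma -> continuous (speed g gamma).
Proof.
move=> [cg dg] t; set c := chart_at (gamma t).
have ac : atlas c := chart_at_atlas (gamma t); have ct : chart_dom c (gamma t) := chart_at_dom (gamma t).
have [dc cdc] := dg c t ac ct.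
pose v := derive1 (c \o gamma).
apply: (@near_eq_continuous _ _ _ (fun r => Num.sqrt (\sum_j (\sum_i v r 0 i * g c (c (gamma r)) i j) * v r 0 j))).
  have H : \forall s \near t, chart_dom c (gamma s) by exact: (cg t _ (near_dom ct)).
  apply: filterS H => s cs; have [ds _] := dg c s ac cs.
  by rewrite (speed_chart ac cs (cg s) ds) quad_sum.
have cv i : {for t, continuous (fun r => v r 0 i)}.
  apply: (@continuous_comp _ _ _ v (fun z : 'rV[R]_n => z 0 i)); first exact: cdc.
  exact: (@coord_continuous _ _ _ 0 i).
have cG i j : {for t, continuous (fun r => g c (c (gamma r)) i j)}.
  apply: (@continuous_comp _ _ _ (c \o gamma) (fun y => g c y i j)).
    by apply: continuous_comp; [exact: cg|exact: Defs.coord_continuous].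
  exact: continuous_gram.
apply: (@continuous_comp _ _ _ (fun r => \sum_j (\sum_i v r 0 i * g c (c (gamma r)) i j) * v r 0 j) Num.sqrt); last exact: sqrt_continuous.
apply: (@cvg_sumr R _ _ (nbhs t) _ _ xpredT (fun j r => (\sum_i v r 0 i * g c (c (gamma r)) i j) * v r 0 j)) => j _.
apply: cvgM; last exact: cv.
apply: (@cvg_sumr R _ _ (nbhs t) _ _ xpredT (fun i r => v r 0 i * g c (c (gamma r)) i j)) => i _.
by apply: cvgM; [exact: cv|exact: cG].
Qed.

Lemma speed_measurable gamma : C1_curve gamma -> measurable_fun setT (speed g gamma : R -> R).
Proof. by move=> /speed_continuous; exact: continuous_measurable_fun. Qed.

(* Cauchy-Schwarz for the metric, applied to [v] and [e_k g^-1]. *)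
Lemma coord_le_metric c y (v : 'rV[R]_n) k : atlas c -> chart_image c y ->
  v 0 k ^+ 2 <= (v *m g c y *m v^T) 0 0 * invmx (g c y) k k.
Proof.
move=> ac cy; have uG := gram_unit g ac cy.
have sG : (g c y)^T = g c y by exact: gram_sym.
have := posdef_cauchy_schwarz v ((delta_mx 0 k : 'rV[R]_n) *m invmx (g c y)) sG (gram_posdefP g ac cy).
have -> : (v *m g c y *m ((delta_mx 0 k : 'rV[R]_n) *m invmx (g c y))^T) 0 0 = v 0 k.
  rewrite trmx_mul gram_inv_sym// mulmxA mulmxK// mxE (bigD1 k)//= big1 ?addr0 => [|i ik].
    by rewrite !mxE !eqxx mulr1.
  by rewrite !mxE (negbTE ik) andbF mulr0.
suff -> : ((delta_mx 0 k : 'rV[R]_n) *m invmx (g c y) *m g c y *m ((delta_mx 0 k : 'rV[R]_n) *m invmx (g c y))^T) 0 0 =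
    invmx (g c y) k k by [].
rewrite mulmxKV// trmx_mul gram_inv_sym// -rowE !mxE (bigD1 k)//= big1 ?addr0 => [|i ik].
  by rewrite !mxE !eqxx mulr1.
by rewrite !mxE (negbTE ik) andbF mulr0.
Qed.

(** Each squared coordinate is at most the quadratic form times a diagonal entry of the inverse Gram
    matrix, and these entries are bounded near the point by continuity. *)
Lemma norm_le_metric c x : atlas c -> chart_dom c x -> exists2 L : R, 0 <= L &
  \forall y \near c x, forall v : 'rV[R]_n, `|v| <= L * Num.sqrt ((v *m g c y *m v^T) 0 0).
Proof.
move=> ac cx; have cy := chart_imageE cx; have oc := @open_chart_image _ _ _ c.
pose S := \sum_k (`|invmx (g c (c x)) k k| + 1).
have S0 : 0 <= S by apply: sumr_ge0 => k _; rewrite addr_ge0.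
exists (Num.sqrt S); first exact: sqrtr_ge0.
have H1 : \forall y \near c x, forall k, `|invmx (g c y) k k| <= `|invmx (g c (c x)) k k| + 1.
  apply: (filter_forall (nbhs_filter (c x)) (f := fun k y => `|invmx (g c y) k k| <= `|invmx (g c (c x)) k k| + 1)) => k.
  exact: norm_near_le (C1_continuous oc (gram_inv_C1 g k k ac) cy).
have H2 := near_image cy.
apply: filterS2 H1 H2 => y Hy ciy v.
have q0 := posdef_ge0 v (gram_posdefP g ac ciy).
apply: norm_le_coord => [|k]; first by rewrite mulr_ge0// sqrtr_ge0.
rewrite -sqrtr_sqr -sqrtrM// ler_sqrt; last exact: mulr_ge0.
apply: le_trans (coord_le_metric v k ac ciy) _; rewrite mulrC ler_wpM2r//.
apply: le_trans (ler_norm _) _; apply: le_trans (Hy k) _.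
by rewrite /S (bigD1 k)//= lerDl sumr_ge0// => i _; rewrite addr_ge0.
Qed.

Lemma metric_le_norm c x : atlas c -> chart_dom c x -> exists2 L : R, 0 <= L &
  \forall y \near c x, forall v : 'rV[R]_n, Num.sqrt ((v *m g c y *m v^T) 0 0) <= L * `|v|.
Proof.
move=> ac cx; have cy := chart_imageE cx; have oc := @open_chart_image _ _ _ c.
pose S := \sum_j \sum_i (`|g c (c x) i j| + 1).
have S0 : 0 <= S by apply: sumr_ge0 => i _; apply: sumr_ge0 => j _; rewrite addr_ge0.
exists (Num.sqrt S); first exact: sqrtr_ge0.
have H1 : \forall y \near c x, forall k : 'I_n * 'I_n, `|g c y k.1 k.2| <= `|g c (c x) k.1 k.2| + 1.
  apply: (filter_forall (nbhs_filter (c x)) (f := fun (k : 'I_n * 'I_n) y => `|g c y k.1 k.2| <= `|g c (c x) k.1 k.2| + 1)) => k.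
  exact: norm_near_le (C1_continuous oc (gram_C1 g k.1 k.2 ac) cy).
apply: filterS H1 => y Hy v.
have -> : Num.sqrt S * `|v| = Num.sqrt (S * `|v| ^+ 2).
  by rewrite sqrtrM// sqrtr_sqr normr_id.
rewrite ler_sqrt; last by rewrite mulr_ge0// sqr_ge0.
rewrite quad_sum /S mulr_suml.
apply: le_trans (ler_norm _) _; apply: le_trans (ler_norm_sum _ _ _) _.
apply: ler_sum => j _; rewrite normrM.
apply: le_trans (ler_wpM2r (normr_ge0 _) (ler_norm_sum _ _ _)) _.
rewrite !mulr_suml; apply: ler_sum => i _; rewrite normrM.
rewrite expr2 mulrA [_ * `|g c y i j|]mulrC.
apply: ler_pM; rewrite ?mulr_ge0//.
  apply: ler_pM => //; [exact: (Hy (i, j))|exact: coord_le_norm].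
exact: coord_le_norm.
Qed.

End Curves.

Section Distance.
Context {R : realType} {n : nat} {M : manifold R n} (g : metric M).
Implicit Types (c : chart R n M) (x : M) (f h w psi : M -> R) (gamma : R -> M).

(** A Lipschitz bound along curves, in the form consumed by [increment_le_integral]; the term e
    leaves room where the speed is zero. *)
Definition curve_slope_le (k : R) psi x := forall gamma (t : R), C1_curve gamma -> gamma t = x ->
  forall e : R, 0 < e -> \forall r \near t,
    `|psi (gamma r) - psi (gamma t)| <= k * (speed g gamma t + e) * `|r - t|.

Lemma lipM_curve_slope psi x : lipM psi -> exists2 k : R, 0 <= k &
  \forall z \near x, forall k', k <= k' -> curve_slope_le k' psi z.
Proof.
move=> lpsi; set c := chart_at x.
have ac : atlas c := chart_at_atlas x; have cx : chart_dom c x := chart_at_dom x.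
have [L L0 [[A B] /= [Ax Bx] AB]] := lpsi c x ac cx.
have [S S0 HS] := norm_le_metric g ac cx.
(* With S + 1 in place of S, the bound S speed + e is at most (S + 1)(speed + e). *)
exists (L * (S + 1)); first by rewrite mulr_ge0// addr_ge0.
have H1 : \forall y \near c x, nbhs y (A `&` B) by apply: nbhs_interior; exact: filterI.
have H2 := near_chart cx H1; have H3 := near_chart cx HS; have H4 := near_dom cx.
apply: filterS3 H2 H3 H4 => z zAB zS cz k kL gamma t Cg gt e e0.
have [cg dg] := Cg; have ct : chart_dom c (gamma t) by rewrite gt.
have [dc _] := dg c t ac ct.
set v := derive1 (c \o gamma) t.
have sv : `|v| <= S * speed g gamma t.
  rewrite (speed_chart g ac ct (cg t) dc) gt; exact: zS.
have dc' : differentiable (c \o gamma) t by exact/derivable1_diffP.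
have G1 : \forall r \near t, `|c (gamma r) - c (gamma t)| <= (`|v| + e) * `|r - t|.
  have := diff_epsE dc' e0; rewrite (near_shift t) /= sub0r.
  apply: filterS => r; rewrite /= subrK => H.
  have E : 'd (c \o gamma) t (r - t) = (r - t) *: v.
    by rewrite /v derive1E' // -[r - t in LHS]mulr1 [LHS]linearZ.
  rewrite E in H; rewrite mulrDl.
  rewrite -[c (gamma r) - c (gamma t)](subrK ((r - t) *: v)).
  by apply: le_trans (ler_normD _ _) _; rewrite addrC lerD// normrZ mulrC.
have G2 : \forall r \near t, chart_dom c (gamma r) by exact: (cg t _ (near_dom ct)).
have G3 : \forall r \near t, (A `&` B) (c (gamma r)).
  have ccg := @continuous_comp _ _ _ gamma c t (cg t) (Defs.coord_continuous ct).
  by apply: (ccg (A `&` B)); rewrite /= gt.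
apply: filterS3 G1 G2 G3 => r h1 h2 [h3 _].
have zB : B (c (gamma t)) by have [] := nbhs_singleton zAB; rewrite gt.
have := AB (c (gamma r), c (gamma t)) (conj h3 zB); rewrite /= !coordK// => H.
apply: le_trans H _.
have s0 := speed_ge0 g gamma t.
apply: (@le_trans _ _ (L * ((`|v| + e) * `|r - t|))); first exact: ler_wpM2l.
rewrite mulrA ler_wpM2r//; apply: (@le_trans _ _ (L * (S + 1) * (speed g gamma t + e))).
  by rewrite -mulrA ler_wpM2l//; nra.
by rewrite ler_wpM2r// addr_ge0// ltW.
Qed.

(* The uniform constant comes from compactness; integrating the slope bound along
   curves turns it into a Lipschitz bound for the distance. *)
Lemma lipM_lipschitz psi (K : set M) : compact K -> (forall z, ~ K z -> psi z = 0) -> lipM psi ->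
  lipschitz_in g setT psi.
Proof.
move=> cK psi0 lpsi; have clK := compact_closedM cK.
have : \forall k \near +oo, K `<=` curve_slope_le k psi.
  move/compact_near_coveringP : cK; apply => x Kx.
  have [k k0 H] := lipM_curve_slope x lpsi.
  exists ([set z | forall k', k <= k' -> curve_slope_le k' psi z], [set k' | k <= k']) => /=.
    by split => //; apply: nbhs_pinfty_ge; exact: num_real.
  by move=> [z k'] /= [Hz kk']; exact: Hz.
move=> HK; have [k [k0 kP]] : exists k : R, 0 < k /\ K `<=` curve_slope_le k psi.
  have : \forall k \near +oo, 0 < k /\ K `<=` curve_slope_le k psi.
    by near=> k; split; near: k; [apply: nbhs_pinfty_gt; exact: num_real|].
  by move=> /filter_ex [k kP]; exists k.
have kP' z : curve_slope_le k psi z.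
  have [/kP//|Kz] := pselect (K z).
  move=> gamma t [cg _] gt e e0; have := off_closed_near0 clK psi0 Kz; rewrite -gt => H.
  have : \forall r \near t, psi (gamma r) = 0 by exact: (cg t _ H).
  apply: filterS => r ->; rewrite (nbhs_singleton H) subrr normr0.
  by rewrite !mulr_ge0// ?addr_ge0 ?speed_ge0// ltW.
exists k => // x y _ _.
(* Dividing by k turns the claim into a lower bound for every curve length, hence for the infimum,
   including when no curve joins the points. *)
suff H : (k^-1%:E * `|psi x - psi y|%:E <= dist g x y)%E.
  have kk : (k%:E * (k^-1%:E * `|psi x - psi y|%:E) = `|psi x - psi y|%:E)%E.
    by rewrite -!EFinM mulrA mulfV ?lt0r_neq0// mul1r.
  by rewrite -kk lee_wpmul2l// lee_fin ltW.
apply: le_ereal_inf_tmp => _ [gamma [Cg g0 g1] <-].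
have := @increment_le_integral R (psi \o gamma) (speed g gamma) k (ltW k0) (speed_continuous Cg)
  (fun t _ => kP' _ gamma t Cg erefl).
rewrite /= g0 g1 distrC => H.
have kV : (0 <= k^-1%:E)%E by rewrite lee_fin invr_ge0 ltW.
have kI (I : \bar R) : (k^-1%:E * (k%:E * I) = I)%E.
  by rewrite muleA -EFinM mulVf ?lt0r_neq0// mul1e.
by have := lee_wpmul2l kV H; rewrite kI.
Unshelve. all: by end_near. Qed.

(** Curves are defined on the whole line. This smooth function goes from 0 to 1 on the unit interval
    and has all its values in it, so the reparametrized segment never leaves a convex coordinate
    ball. *)
Let theta (t : R) : R := (1 - cos (pi * t)) / 2.

Let theta_derive (t : R) : is_derive t 1 theta (pi * sin (pi * t) / 2).
Proof. by apply: is_derive_eq; rewrite /GRing.scale /=; field. Qed.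

Let theta_bounds (t : R) : 0 <= theta t <= 1.
Proof.
by rewrite /theta; have := cos_geN1 (pi * t); have := cos_le1 (pi * t) => h1 h2; apply/andP; split; lra.
Qed.

(** The coordinate segment run through by [theta] has speed at most S pi times the coordinate
    distance, since the derivative of [theta] is bounded by pi. *)
Lemma dist_le_chart c x : atlas c -> chart_dom c x -> exists2 k : R, 0 <= k &
  \forall p \near (c x, c x), (dist g (param c p.1) (param c p.2) <= (k * `|p.1 - p.2|)%:E)%E.
Proof.
move=> ac cx; have [S S0 HS] := metric_le_norm g ac cx.
have H1 := near_image (chart_imageE cx).
have : nbhs (c x) (chart_image c `&` [set y | forall v : 'rV[R]_n, Num.sqrt ((v *m g c y *m v^T) 0 0) <= S * `|v|]).
  exact: filterI.
move=> /nbhs_ballP [r /= r0 rP].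
exists (S * pi); first by rewrite mulr_ge0// pi_ge0.
exists (ball (c x) r, ball (c x) r) => /=; first by split; exact: nbhsx_ballx.
move=> [y1 y2] /= [b1 b2].
pose line t := y1 + theta t *: (y2 - y1).
have lineP t : ball (c x) r (line t).
  move: b1 b2; rewrite -!ball_normE /= !(distrC (c x)) => b1 b2.
  exact: ball_convex (theta_bounds t) b1 b2.
have lc t : chart_image c (line t) by have [] := rP _ (lineP t).
pose gamma t := param c (line t).
pose d := y2 - y1; pose th' (t : R) := pi * sin (pi * t) / 2.
have dline (t : R) : is_derive t 1 line (th' t *: d).
  have D (i : 'I_1) (j : 'I_n) : is_derive t 1 (fun s => line s i j) (th' t * d i j).
    have -> : (fun s => line s i j) = fun s => y1 i j + theta s * d i j.
      by apply/funext => s; rewrite !mxE.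
    have D1 : is_derive t 1 (fun s => theta s * d i j) (th' t * d i j).
      apply: (is_derive_eq (is_deriveM (theta_derive t) (is_derive_cst (d i j) t 1))).
      by rewrite scaler0 add0r [LHS]mulrC.
    exact: (is_derive_eq (is_deriveD (is_derive_cst (y1 i j) t 1) D1) (add0r _)).
  have dl : derivable line t 1 by apply/derivable_mxP => i j; have [] := D i j.
  split => //; rewrite derive_mx//; apply/matrixP => i j; rewrite !mxE.
  by have [_] := D i j; rewrite !mxE.
have cline (t : R) : {for t, continuous line}.
  have [H _] := dline t.
  by apply: differentiable_continuous; exact/derivable1_diffP.
have line1 (t : R) : derive1 line t = th' t *: d by rewrite derive1E; have [] := dline t.
have cgE : c \o gamma = line by apply/funext => t; rewrite /= paramK.
have cg : continuous gamma.
  move=> t; apply: (@continuous_comp _ _ _ line (param c)); first exact: cline.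
  exact: (param_continuous (lc t)).
have gd (t : R) : chart_dom c (gamma t) by exact: param_dom.
have gdc (t : R) : derivable (c \o gamma) t 1 by rewrite cgE; have [H _] := dline t; exact: H.
(* The definition quantifies over all charts: the velocity in c' is the velocity in c times [jac],
   and both factors are continuous along the segment. *)
have Cg : C1_curve gamma.
  split; first exact cg.
  move=> c' t ac' c't.
  have [V1 _] := velocity_change ac ac' (gd t) c't (cg t) (gdc t).
  split; first exact V1.
  apply: (@near_eq_continuous _ _ _ (fun s => (th' s *: d) *m jac c c' (line s))).
    have H : \forall s \near t, chart_dom c' (gamma s) by exact: (cg t _ (near_dom c't)).
    apply: filterS H => s c's.
    have [_ ->] := velocity_change ac ac' (gd s) c's (cg s) (gdc s).
    by rewrite cgE line1 /gamma paramK.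
  apply: (@cvg_row _ _ _ (nbhs t)) => k.
  have -> : (fun s => ((th' s *: d) *m jac c c' (line s)) 0 k) = fun s =>
      \sum_i (th' s * d 0 i) * partial i (fun z => c' (param c z) 0 k) (line s).
    by apply/funext => s; rewrite mxE; apply: eq_bigr => i _; rewrite !mxE.
  have -> : ((th' t *: d) *m jac c c' (line t)) 0 k =
      \sum_i (th' t * d 0 i) * partial i (fun z => c' (param c z) 0 k) (line t).
    by rewrite mxE; apply: eq_bigr => i _; rewrite !mxE.
  apply: (@cvg_sumr R _ _ (nbhs t) _ _ xpredT (fun i s => (th' s * d 0 i) * partial i (fun z => c' (param c z) 0 k) (line s))) => i _.
  have oy : overlap c c' (line t) by apply/overlapE; split.
  have cth : {for t, continuous (fun s => th' s * d 0 i)}.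
    apply: continuousM; last exact: cst_continuous.
    apply: continuousM; last exact: cst_continuous.
    apply: continuousM; first exact: cst_continuous.
    apply: (@continuous_comp _ _ _ (fun s => pi * s) sin); last exact: continuous_sin.
    by apply: continuousM; [exact: cst_continuous|move=> ?; exact].
  have cp : {for t, continuous (fun s => partial i (fun z => c' (param c z) 0 k) (line s))}.
    apply: (@continuous_comp _ _ _ line (partial i (fun z => c' (param c z) 0 k))) => //.
    by have [] := transition_C1 k ac ac' oy i.
  exact: (continuousM cth cp).
have sp (t : R) : speed g gamma t <= S * pi * `|y1 - y2|.
  rewrite (speed_chart g ac (gd t) (cg t) (gdc t)) cgE line1.
  have [_ /(_ (th' t *: d))] := rP _ (lineP t); rewrite /gamma paramK//.
  move=> /le_trans; apply; rewrite -mulrA ler_wpM2l// normrZ [`|y1 - y2|]distrC ler_wpM2r//.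
  rewrite /th' normrM normrM (ger0_norm (pi_ge0 R)).
  have s1 : `|sin (pi * t)| <= 1 by rewrite ler_norml sin_geN1 sin_le1.
  have p0 := pi_ge0 R.
  rewrite [`|2^-1|]ger0_norm ?invr_ge0//; nra.
apply: (@le_trans _ _ (curve_length g gamma)).
  apply: ereal_inf_lbound; exists gamma => //; split => //.
    by rewrite /gamma /line /theta mulr0 cos0 subrr mul0r scale0r addr0.
  rewrite /gamma /line /theta mulr1 cospi opprK -[1 + 1]/(2%:R) divff// scale1r.
  by rewrite addrC subrK.
apply: (@le_trans _ _ (\int[lebesgue_measure]_(t in `[0%R, 1%R]) (S * pi * `|y1 - y2|)%:E)%E).
  apply: ge0_le_integral => //=.
  - by move=> t _; rewrite lee_fin speed_ge0.
  - by apply/measurable_EFinP; apply: measurable_funTS; exact: speed_measurable.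
  - by move=> t _; rewrite lee_fin.
rewrite integral_cst//= lebesgue_measure_itv /= lte_fin ltr01 oppr0 adde0 mule1.
by [].
Qed.

Lemma locally_lipschitz_lipM f : locally_lipschitz g f -> lipM f.
Proof.
move=> lf c x ac cx; have [U Ux [K K0 UK]] := lf x.
have [k k0 dk] := dist_le_chart ac cx.
exists (K * k); first by rewrite mulr_ge0// ltW.
have H := near_param cx Ux.
have H1 := near_fst H; have H2 := near_snd H.
apply: filterS3 dk H1 H2 => p dp U1 U2.
rewrite -lee_fin; apply: le_trans (UK _ _ U1 U2) _.
by rewrite -mulrA EFinM lee_wpmul2l// lee_fin ltW.
Qed.

End Distance.

(** * The affine Laplacian *)

Section WeightedDivergence.
Context {R : realType} {n : nat} {M : manifold R n} (g : metric M).
Implicit Types (c : chart R n M) (x : M) (f h w phi A u : M -> R).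

Lemma gdiv_expand A phi x : C1M A -> smooth phi ->
  gdiv g A phi x = A x * laplacian g phi x + pair g A phi x.
Proof.
move=> CA sp; rewrite /gdiv wdivE /laplacian /div_in; set c := chart_at x.
have ac : atlas c := chart_at_atlas x; have cx : chart_dom c x := chart_at_dom x.
have oc := @open_chart_image _ _ _ c; have cy := chart_imageE cx.
have s0 := vol_density_gt0 g ac cy.
pose F i y := vol_density g c y * grad_in g c phi y 0 i.
have CF i : C1_on (chart_image c) (F i).
  by apply: C1_onM => //; [exact: vol_density_C1|exact: grad_in_C1].
have PE i : partial i (flux g c A phi i) (c x) =
    A x * partial i (F i) (c x) + F i (c x) * partial i (A \o param c) (c x).
  have -> : flux g c A phi i = (A \o param c) * F i.
    apply/funext => y; rewrite /flux /F.
    by rewrite -[RHS]/((A \o param c) y * (vol_density g c y * grad_in g c phi y 0 i)) /= mulrCA.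
  rewrite /partial deriveM; [by rewrite /= coordK|by have [] := CA c ac _ cy i|by have [] := CF i _ cy i].
rewrite (eq_bigr _ (fun i _ => PE i)) big_split /= mulrDr -mulr_sumr mulrCA; congr (_ + _).
have dphi := smooth_chart_differentiable ac sp cy.
rewrite pairC (pair_chart g ac cx (smooth_mdiff x sp) (C1M_mdiff x CA)) mxE mulr_sumr.
apply: eq_bigr => i _; rewrite /F (grad_inE g dphi) !mxE mulrA mulrA mulVf ?gt_eqF// mul1r.
by [].
Qed.

Lemma gdiv_off_support A phi (K : set M) x : closed K -> (forall z, ~ K z -> phi z = 0) -> ~ K x ->
  gdiv g A phi x = 0.
Proof.
move=> cK phi0 Kx; rewrite /gdiv wdivE; set c := chart_at x.
have cx : chart_dom c x := chart_at_dom x.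
(* The divergence differentiates a gradient, so phi has to vanish near every point close to x. *)
have : \forall y \near c x, nbhs y [set z | (phi \o param c) z = 0].
  exact: nbhs_interior (near_param cx (off_closed_near0 cK phi0 Kx)).
move=> H; rewrite big1 ?mulr0// => i _.
have E : {near c x, flux g c A phi i =1 fun=> 0}.
  apply: filterS H => y Hy; rewrite /flux /grad_in; case: ifP => _; last by rewrite mxE !mulr0.
  rewrite [X in X *m _](_ : _ = 0) ?mul0mx ?mxE ?mulr0//.
  apply/rowP => j; rewrite !mxE /partial.
  have -> : 'D_(delta_mx 0 j) (phi \o param c) y = 'D_(delta_mx 0 j) (fun _ : 'rV[R]_n => 0 : R) y.
    exact: near_eq_derive.
  exact: derive_cst.
rewrite /partial (near_eq_derive _ E); exact: derive_cst.
Qed.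

Lemma mdiff_expR f x : mdiff f x -> mdiff (fun z => expR (f z)) x.
Proof. by move=> df; apply: (differentiable_comp df); exact/derivable1_diffP/derivable_expR. Qed.

Lemma grad_expR f x : mdiff f x -> grad g (fun z => expR (f z)) x = expR (f x) *: grad g f x.
Proof.
move=> df; rewrite !grad_dvec//; last exact: mdiff_expR.
rewrite scalemxAl; congr (_ *m _); apply/rowP => i; rewrite !mxE.
have [dp pE] := is_derive_expR ((f \o param (chart_at x)) (chart_at x x)).
have [_] := partial_comp i df dp; rewrite derive1E pE /= coordK//; exact: chart_at_dom.
Qed.

Lemma V_gt0 u x : 0 < V u x. Proof. exact: expR_gt0. Qed.

Lemma V_powR_C1M u p : smooth u -> C1M (fun x => V u x `^ p).
Proof.
move=> su c ac; have oc := @open_chart_image _ _ _ c.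
apply: (@C1_on_powR _ _ p (chart_image c) (fun y => expR (u (param c y))) oc).
  by move=> y _; exact: expR_gt0.
by apply: C1_on_expR => //; exact: (smooth_C1M su).
Qed.

Lemma powR_mul_self (a p : R) : 0 < a -> a `^ (p - 1) * a = a `^ p.
Proof.
move=> a0; rewrite -[X in _ * X]powRr1 ?ltW// -powRD ?subrK//.
by apply/implyP => _; rewrite gt_eqF.
Qed.

Lemma pair_V_powR u p phi x : smooth u ->
  pair g (fun z => V u z `^ p) phi x = p * V u x `^ p * inner g x (grad g u x) (grad g phi x).
Proof.
move=> su; have du := smooth_mdiff x su.
rewrite /pair grad_powR; [|exact: mdiff_expR|exact: V_gt0].
rewrite grad_expR// scalerA innerZl -/(V u x) -[p * _ * _]mulrA powR_mul_self//; exact: V_gt0.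
Qed.

(** This is V^tau Delta^D phi = div(V^tau grad^D phi): the exponent tau + mu - lambda equals 2 mu +
    n lambda, the coefficient of the first-order term of the affine Laplacian. *)
Lemma gdiv_affine_laplacian u lambda mu phi x : smooth u -> smooth phi ->
  gdiv g (fun z => V u z `^ (tau n lambda mu + (mu - lambda))) phi x =
  V u x `^ tau n lambda mu * affine_laplacian g u lambda mu phi x.
Proof.
move=> su sp; rewrite gdiv_expand//; last exact: V_powR_C1M.
rewrite pair_V_powR// /affine_laplacian mulrA -powRD; last by rewrite (gt_eqF (V_gt0 u x)) implybT.
have -> : tau n lambda mu + (mu - lambda) = 2 * mu + n%:R * lambda.
  by rewrite /tau -natr1; ring.
ring.
Qed.

End WeightedDivergence.

(** * The weighted Rellich inequality *)

Section Rellich.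
Context {R : realType} {n : nat} {M : manifold R n} (g : metric M).
Implicit Types (x : M) (phi : M -> R).

Lemma compact_support_outside (f : M -> R) x : ~ closure [set z | f z != 0] x -> f x = 0.
Proof.
by move=> fx; apply/eqP; rewrite -[_ == _]negbK; apply/negP => h; apply: fx; exact: subset_closure.
Qed.

(* Where rho is not differentiable [grad] is 0, which the eikonal equation excludes. *)
Lemma eikonal_null_set u lambda mu (vol : {measure set (borel M) -> \bar R}) (rho : M -> R) :
  affine_eikonal g u lambda mu vol rho ->
  exists N : set (borel M), [/\ measurable N, vol N = 0 & forall x, ~ N x ->
    mdiff rho x /\ V u x `^ (mu - lambda) ^+ 2 * pair g rho rho x = 1].
Proof.
move=> [_ [N [mN N0 Nbad]]]; exists N; split => // x Nx.
have e1 : tnorm g x (affine_grad g u lambda mu rho x) = 1.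
  by apply: contrapT => h; apply: Nx; exact: Nbad.
have e2 : V u x `^ (mu - lambda) ^+ 2 * pair g rho rho x = 1.
  rewrite /pair expr2 -mulrA -innerZl mulrC -[RHS]mulr1 -{2}e1 -[in RHS]e1 -expr2 sqr_sqrtr ?inner_ge0//.
  by rewrite /affine_grad innerZr mulrC.
split => //; apply: contrapT => nd; move: e2.
rewrite /pair /grad /grad_in asboolF// /inner !mul0mx mxE mulr0 => /eqP.
by rewrite eq_sym oner_eq0.
Qed.

(** Here s is rho, r is rho^(alpha-4), w is V^(tau+lambda-mu) and a is V^(mu-lambda), while pff,
    pfr, prr are the inner products of grad phi and grad rho. The factor C - 1 matches the cross
    terms, because (alpha - 2) + (C - 1) = 2b. *)
Lemma rellich_pointwise (s r w a L phi pff pfr prr b C alpha k : R) :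
  b = (C + alpha - 3) / 2 -> k = b * (C - alpha + 1) / 2 -> 0 <= k ->
  0 < r -> 0 < w -> a ^+ 2 * prr = 1 ->
  0 <= s ^+ 2 * pff + 2 * b * s * phi * pfr + b ^+ 2 * phi ^+ 2 * prr ->
  k ^+ 2 * (r * phi ^+ 2 * w) <=
    r * s ^+ 4 * L ^+ 2 * (w * a ^+ 2) +
    2 * k * (w * a ^+ 2 * (r * s ^+ 2 * pff + phi * ((alpha - 2) * (r * s)) * pfr) +
      r * s ^+ 2 * phi * (w * a * L)) +
    k * (C - 1) * (C * (r * phi ^+ 2 * w) +
      a * (2 * r * s * phi * pfr + phi ^+ 2 * ((alpha - 3) * r) * prr) * (w * a)).
Proof.
move=> bE kE k0 r0 w0 e Q; rewrite -subr_ge0.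
set D := (X in 0 <= X).
(* The last term collects the occurrences of a^2 prr and vanishes by the eikonal equation; the two
   others are the weighted squares. *)
suff -> : D = r * w * (s ^+ 2 * a * L + k * phi) ^+ 2 +
    2 * k * r * w * a ^+ 2 * (s ^+ 2 * pff + 2 * b * s * phi * pfr + b ^+ 2 * phi ^+ 2 * prr) +
    r * w * phi ^+ 2 * (k * (C - 1) * (alpha - 3) - 2 * k * b ^+ 2) * (a ^+ 2 * prr - 1).
  rewrite e subrr mulr0 addr0; apply: addr_ge0.
    by apply: mulr_ge0; [rewrite mulr_ge0// ltW|exact: sqr_ge0].
  apply: mulr_ge0 => //; apply: mulr_ge0; last exact: sqr_ge0.
  by rewrite !mulr_ge0// ltW.
by rewrite /D kE bE; field.
Qed.

Lemma grad_powR_mul p (f h : M -> R) x : mdiff f x -> mdiff h x -> 0 < f x ->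
  grad g (fun z => f z `^ p * h z) x =
    f x `^ p *: grad g h x + (h x * (p * f x `^ (p - 1))) *: grad g f x.
Proof.
move=> df dh f0; rewrite (gradM g (mdiff_powR p df f0) dh) (grad_powR g p df f0).
by rewrite scalerA.
Qed.

Lemma pair_lincomb_ge0 (f h : M -> R) (s q : R) x :
  0 <= s ^+ 2 * pair g f f x + 2 * s * q * pair g f h x + q ^+ 2 * pair g h h x.
Proof.
rewrite /pair; move: (grad g f x) (grad g h x) => a b.
have := inner_ge0 g x (s *: a + q *: b).
rewrite innerDl !innerDr !innerZl !innerZr [inner g x b a]innerC.
move: (inner g x a a) (inner g x a b) (inner g x b b) => aa ab bb.
by congr (0 <= _); ring.
Qed.

Lemma pair_powR_mul p (f h : M -> R) x : mdiff f x -> mdiff h x -> 0 < f x ->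
  pair g (fun z => f z `^ p * h z) h x =
    f x `^ p * pair g h h x + h x * (p * f x `^ (p - 1)) * pair g h f x.
Proof.
move=> df dh f0; rewrite /pair (grad_powR_mul p df dh f0).
move: (grad g f x) (grad g h x) => a b.
by rewrite innerDl !innerZl [inner g x a b]innerC.
Qed.

Lemma pair_powR_sqr p (f h : M -> R) x : mdiff f x -> mdiff h x -> 0 < f x ->
  pair g (fun z => f z `^ p * h z * h z) f x =
    2 * f x `^ p * h x * pair g h f x + h x ^+ 2 * (p * f x `^ (p - 1)) * pair g f f x.
Proof.
move=> df dh f0; rewrite /pair (gradM g (mdiffM (mdiff_powR p df f0) dh) dh) (grad_powR_mul p df dh f0).
move: (grad g f x) (grad g h x) => a b; rewrite scalerDr !innerDl !innerZl.
by move: (inner g x b a) (inner g x a a) => ba aa; ring.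
Qed.

Lemma rellich_constant_ge0 (C alpha : R) : 1 < C -> alpha < 2 -> 0 < C + alpha - 3 ->
  0 <= (C + alpha - 3) / 2 * (C - alpha + 1) / 2.
Proof. by move=> *; apply: mulr_ge0 => //; apply: mulr_ge0; lra. Qed.

Variables (vol : {measure set (borel M) -> \bar R}) (leb : {measure set (borel 'rV[R]_n) -> \bar R}).
Hypothesis hleb : is_lebesgue leb.
Hypothesis hvol : forall (c : chart R n M) (A : set (borel M)),
    atlas c -> measurable A -> A `<=` chart_dom c ->
    vol A = (\int[leb]_(y in c @` A) (vol_density g c y)%:E)%E.
Variables (u : M -> R) (lambda mu : R) (rho : M -> R) (C alpha : R).
Variables (N : set (borel M)) (K : set M) (phi : M -> R).
Hypotheses (mN : measurable N) (N0 : vol N = 0).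
Hypotheses (su : smooth u) (lrho : lipM rho).
Hypothesis rhoN : forall x, ~ N x ->
  mdiff rho x /\ V u x `^ (mu - lambda) ^+ 2 * pair g rho rho x = 1.
Hypothesis rho_gt0 : forall x, K x -> 0 < rho x.
Hypotheses (cK : compact K) (sp : smooth phi) (phi0 : forall x, ~ K x -> phi x = 0).

Local Notation t := (tau n lambda mu).
Local Notation w := (fun x => V u x `^ (t + lambda - mu)).

(** Any real p is allowed: rho is positive on K, and off K the product vanishes in a
    neighbourhood. *)
Lemma weighted_cutoff p : admissible N K (fun x => rho x `^ p * phi x).
Proof.
have clK := compact_closedM cK.
have off z : ~ K z -> rho z `^ p * phi z = 0 by move=> Kz; rewrite phi0// mulr0.
have lphi := C1M_lip (smooth_C1M sp).
split => // [|z Nz].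
  apply/lipMP => z; have [Kz|Kz] := pselect (K z).
    apply: lipxM; last by move/lipMP: lphi; exact.
    by apply: lipx_powR; [move/lipMP: lrho; exact|exact: rho_gt0].
  by apply: (lipx_eq (h := fun=> 0)); [exact: off_closed_near0 clK off Kz|exact: lipx_cst].
have [Kz|Kz] := pselect (K z).
  apply: mdiffM; last exact: smooth_mdiff.
  by apply: mdiff_powR; [have [] := rhoN Nz|exact: rho_gt0].
by apply: (mdiff_eq (h := fun=> 0)); [exact: off_closed_near0 clK off Kz|exact: mdiff_cst].
Qed.

Lemma nice_powR p x : K x -> nice N (fun z => rho z `^ p) x.
Proof.
move=> Kx; apply: (@nice_continuous _ _ _ N _ x [set z | 0 < rho z]).
- apply: (@open_comp _ _ rho [set s | 0 < s]); last exact: open_gt.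
  by move=> z _; exact: lipM_continuous.
- exact: rho_gt0.
- move=> z /= z0; have [dp _] := is_derive1_powR p z0.
  apply: (@continuous_comp _ _ _ rho (fun s : R => s `^ p)); first exact: lipM_continuous.
  by apply: differentiable_continuous; exact/derivable1_diffP.
Qed.

Lemma nice_V p x : nice N (fun z => V u z `^ p) x.
Proof. exact/nice_lip/C1M_lip/V_powR_C1M. Qed.

(** In this form the affine Laplacian inherits the local regularity and the support property of
    [gdiv]. *)
Lemma affine_laplacian_gdiv x : affine_laplacian g u lambda mu phi x =
  V u x `^ (- t) * gdiv g (fun z => V u z `^ (t + (mu - lambda))) phi x.
Proof.
by rewrite gdiv_affine_laplacian// mulrA -powRD ?addNr ?powRr0 ?mul1r// (gt_eqF (V_gt0 u x)) implybT.
Qed.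

Let weight x : R := rho x `^ (alpha - 4) * phi x ^+ 2 * w x.
Let energy x : R := rho x `^ alpha * affine_laplacian g u lambda mu phi x ^+ 2 *
  V u x `^ (t + mu - lambda).
Let eta x := rho x `^ (alpha - 2) * phi x.
Let psi x := rho x `^ (alpha - 3) * phi x * phi x.
Let flow x : R := inner g x (grad g psi x) (affine_grad g u lambda mu rho x) * V u x `^ t.
Let A x : R := V u x `^ (t + (mu - lambda)).

Lemma psi_admissible : admissible N K psi.
Proof.
have [l d o] := weighted_cutoff (alpha - 3); split.
- by apply: lipM_M => //; exact/C1M_lip/smooth_C1M.
- by move=> z Nz; apply: mdiffM; [exact: d|exact: smooth_mdiff].
- by move=> z Kz; rewrite /psi o// mul0r.
Qed.

Lemma weight_integrable : vol.-integrable (~` N) (EFin \o weight : borel M -> \bar R).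
Proof.
apply: (nice_integrable hleb hvol mN cK) => x Kx; last by rewrite /weight phi0// expr0n mulr0 mul0r.
have lphi : nice N phi x by exact/nice_lip/C1M_lip/smooth_C1M.
exact (niceM mN (niceM mN (nice_powR (alpha - 4) Kx) (niceM mN lphi lphi)) (nice_V _ x)).
Qed.

Lemma flow_integrable : vol.-integrable (~` N) (EFin \o flow : borel M -> \bar R).
Proof.
have [l d o] := psi_admissible.
have E x : flow x = V u x `^ (mu - lambda) * pair g psi rho x * V u x `^ t.
  by rewrite /flow /affine_grad innerZr.
apply: (nice_integrable hleb hvol mN cK) => x Kx.
  rewrite (funext E).
  apply: (niceM mN _ (nice_V _ x)); apply: (niceM mN (nice_V _ x)).
  by apply: nice_pair => // z /rhoN[].
move=> _; rewrite E pair_near0 ?mulr0 ?mul0r//.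
exact: off_closed_near0 (compact_closedM cK) o Kx.
Qed.

Lemma energy_integrable : vol.-integrable (~` N) (EFin \o energy : borel M -> \bar R).
Proof.
apply: (nice_integrable hleb hvol mN cK) => x Kx.
  have nL : nice N (affine_laplacian g u lambda mu phi) x.
    rewrite (funext affine_laplacian_gdiv); apply: (niceM mN (nice_V _ x)).
    exact (nice_gdiv hleb hvol mN x (V_powR_C1M _ su) sp).
  exact (niceM mN (niceM mN (nice_powR alpha Kx) (niceM mN nL nL)) (nice_V _ x)).
move=> _; rewrite /energy affine_laplacian_gdiv.
by rewrite (gdiv_off_support _ _ (compact_closedM cK) phi0 Kx) mulr0 expr0n mulr0 mul0r.
Qed.

Lemma weighted_rellich_pointwise k x : 1 < C -> alpha < 2 -> 0 < C + alpha - 3 ->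
  k = (C + alpha - 3) / 2 * (C - alpha + 1) / 2 -> ~ N x ->
  k ^+ 2 * weight x <= energy x + 2 * k * ibp_integrand g A phi eta x +
    k * (C - 1) * (C * weight x + flow x).
Proof.
move=> C1 a2 Ca kE Nx; have [dr e] := rhoN Nx; have clK := compact_closedM cK.
(* Off K both sides are 0: phi and the cutoffs vanish in a neighbourhood, hence so do the gradients
   and the divergence. *)
have [Kx|Kx] := pselect (K x); last first.
  have [_ _ eta0] := weighted_cutoff (alpha - 2); have [_ _ psi0] := psi_admissible.
  rewrite /weight /energy /ibp_integrand /flow affine_laplacian_gdiv.
  rewrite (gdiv_off_support _ _ clK phi0 Kx) pair_near0; last exact: off_closed_near0 clK eta0 Kx.
  rewrite grad_near0; last exact: off_closed_near0 clK psi0 Kx.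
  by rewrite /inner phi0// !mul0mx mxE !(mulr0,mul0r,expr0n,addr0).
have r0 := rho_gt0 Kx; have v0 := V_gt0 u x; have df := smooth_mdiff x sp.
have vD p q : V u x `^ (p + q) = V u x `^ p * V u x `^ q.
  by rewrite powRD// (gt_eqF v0) implybT.
have rS p : rho x `^ p = rho x `^ (p - 1) * rho x by rewrite powR_mul_self.
(* All powers of rho are written with rho^(alpha-4) and rho, all powers of V with V^(tau+lambda-mu)
   and V^(mu-lambda); the claim then becomes polynomial. *)
set r := rho x `^ (alpha - 4).
have r3 : rho x `^ (alpha - 3) = r * rho x by rewrite rS; congr (_ `^ _ * _); ring.
have r2 : rho x `^ (alpha - 2) = r * rho x ^+ 2.
  by rewrite rS expr2 mulrA -r3; congr (_ `^ _ * _); ring.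
have rA : rho x `^ alpha = r * rho x ^+ 4.
  rewrite rS rS; have -> : alpha - 1 - 1 = alpha - 2 by ring.
  by rewrite r2; ring.
have wA : A x = w x * V u x `^ (mu - lambda) ^+ 2.
  by rewrite /A expr2 -!vD; congr (_ `^ _); ring.
have wE : V u x `^ (t + mu - lambda) = w x * V u x `^ (mu - lambda) ^+ 2 by rewrite -addrA.
have wt : V u x `^ t = w x * V u x `^ (mu - lambda) by rewrite -vD; congr (_ `^ _); ring.
have etaE : pair g eta phi x = rho x `^ (alpha - 2) * pair g phi phi x +
    phi x * ((alpha - 2) * (r * rho x)) * pair g phi rho x.
  rewrite (pair_powR_mul _ dr df r0); have -> : alpha - 2 - 1 = alpha - 3 by ring.
  by rewrite r3.
have flowE : flow x = V u x `^ (mu - lambda) * (2 * r * rho x * phi x * pair g phi rho x +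
    phi x ^+ 2 * ((alpha - 3) * r) * pair g rho rho x) * V u x `^ t.
  rewrite /flow /affine_grad innerZr -/(pair g psi rho x) (pair_powR_sqr _ dr df r0).
  have -> : alpha - 3 - 1 = alpha - 4 by ring.
  by rewrite r3 mulrA.
have := @rellich_pointwise (rho x) r (w x) (V u x `^ (mu - lambda))
  (affine_laplacian g u lambda mu phi x) (phi x) (pair g phi phi x) (pair g phi rho x)
  (pair g rho rho x) ((C + alpha - 3) / 2) C alpha k erefl kE.
rewrite /weight /energy /ibp_integrand gdiv_affine_laplacian// flowE etaE /eta -/(A x) wA wE wt rA r2 -/r.
apply.
- by rewrite kE; exact: rellich_constant_ge0.
- exact (powR_gt0 _ r0).
- exact (powR_gt0 _ v0).
- exact e.
- have := pair_lincomb_ge0 phi rho (rho x) ((C + alpha - 3) / 2 * phi x) x.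
  move: (pair g phi phi x) (pair g phi rho x) (pair g rho rho x) (phi x) (rho x) => pff pfr prr f s.
  by congr (0 <= _); ring.
Qed.

Lemma weighted_rellich : 1 < C -> alpha < 2 -> 0 < C + alpha - 3 ->
  (\int[vol]_(x in ~` N) (C * weight x)%:E <= - \int[vol]_(x in ~` N) (flow x)%:E)%E ->
  ((((C + alpha - 3) / 2 * (C - alpha + 1) / 2) ^+ 2)%:E * \int[vol]_(x in ~` N) (weight x)%:E <=
    \int[vol]_(x in ~` N) (energy x)%:E)%E.
Proof.
move=> C1 a2 Ca test; have mNC : measurable (~` N) by exact: measurableC.
set k := (C + alpha - 3) / 2 * (C - alpha + 1) / 2.
have k0 : 0 <= k by exact: rellich_constant_ge0.
have wI := weight_integrable; have fI := flow_integrable; have eI := energy_integrable.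
have CA : C1M A := V_powR_C1M _ su.
have bI := ibp_integrable hleb hvol mN cK CA sp (weighted_cutoff (alpha - 2)).
have b0 := weighted_integration_by_parts hleb hvol mN N0 cK CA sp (weighted_cutoff (alpha - 2)).
rewrite -/eta in bI b0.
have scale (a : R) (h : M -> R) : vol.-integrable (~` N) (EFin \o h : borel M -> \bar R) ->
    vol.-integrable (~` N) (EFin \o (fun x => a * h x) : borel M -> \bar R).
  by move=> hI; exact (integrableZl mNC a hI).
have add (h h' : M -> R) : vol.-integrable (~` N) (EFin \o h : borel M -> \bar R) ->
    vol.-integrable (~` N) (EFin \o h' : borel M -> \bar R) ->
    vol.-integrable (~` N) (EFin \o (fun x => h x + h' x) : borel M -> \bar R).
  by move=> hI h'I; exact (integrableD mNC hI h'I).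
have intZ (a : R) (h : M -> R) : vol.-integrable (~` N) (EFin \o h : borel M -> \bar R) ->
    (\int[vol]_(x in ~` N) (a * h x)%:E = a%:E * \int[vol]_(x in ~` N) (h x)%:E)%E.
  by move=> hI; exact (integralZl mNC hI a).
have intD (h h' : M -> R) : vol.-integrable (~` N) (EFin \o h : borel M -> \bar R) ->
    vol.-integrable (~` N) (EFin \o h' : borel M -> \bar R) ->
    (\int[vol]_(x in ~` N) (h x + h' x)%:E =
      \int[vol]_(x in ~` N) (h x)%:E + \int[vol]_(x in ~` N) (h' x)%:E)%E.
  by move=> hI h'I; exact (integralD_EFin mNC hI h'I).
have TI := add _ _ (scale C _ wI) fI.
have bI' := scale (2 * k) _ bI; have TI' := scale (k * (C - 1)) _ TI.
have sI := add _ _ eI bI'.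
rewrite -(intZ _ _ wI).
apply: (@le_trans _ _ (\int[vol]_(x in ~` N) (energy x + 2 * k * ibp_integrand g A phi eta x +
    k * (C - 1) * (C * weight x + flow x))%:E)%E).
  apply: (le_integral mNC (scale (k ^+ 2) _ wI) (add _ _ sI TI')) => x /[!inE] Nx.
  by rewrite lee_fin; exact: weighted_rellich_pointwise.
(* Integration by parts contributes 0. Beyond the energy there remains k(C - 1) >= 0 times the
   tested integral, which is nonpositive. *)
rewrite (intD _ _ sI TI') (intD _ _ eI bI') (intZ _ _ bI) (intZ _ _ TI) b0 mule0 adde0.
rewrite -[leRHS]adde0 leeD2l// mule_ge0_le0//; first by rewrite lee_fin mulr_ge0// subr_ge0 ltW.
(* Finiteness allows the integral of [flow] to cancel against its opposite in the tested
   inequality. *)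
have ff : (\int[vol]_(x in ~` N) (flow x)%:E)%E \is a fin_num by exact: (integrable_fin_num mNC fI).
rewrite (intD _ _ (scale C _ wI) fI).
by apply: le_trans (leeD2r _ test) _; rewrite addeC subee.
Qed.

End Rellich.

Theorem theorem4p1 (R : realType) (n : nat) (M : manifold R n) (g : metric M)
    (vol : {measure set (borel M) -> \bar R})
    (u : M -> R) (lambda mu : R) (rho : M -> R) (C alpha : R) :
  is_riemannian_volume g vol ->
  complete_metric g ->
  ~ compact [set: M] ->
  smooth u ->
  (forall x : M, 0 <= rho x) ->
  affine_eikonal g u lambda mu vol rho ->
  affine_laplacian_ge g u lambda mu vol C rho ->
  1 < C -> alpha < 2 -> 0 < C + alpha - 3 ->
  forall phi : M -> R, smooth phi ->
    compact_support_in (~` (rho @^-1` [set 0])) phi ->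
    (((C + alpha - 3) ^+ 2 * (C - alpha + 1) ^+ 2 / 16)%:E *
       \int[vol]_x (rho x `^ (alpha - 4) * phi x ^+ 2 *
                    V u x `^ (tau n lambda mu + lambda - mu))%:E
     <= \int[vol]_x (rho x `^ alpha * affine_laplacian g u lambda mu phi x ^+ 2 *
                     V u x `^ (tau n lambda mu + mu - lambda))%:E)%E.
Proof.
move=> [leb hleb hvol] _ _ su hrho heik hge C1 a2 Ca phi sp [cK K0].
have [lrho _] := heik; have {}lrho := locally_lipschitz_lipM lrho.
have [N [mN N0 rhoN]] := eikonal_null_set heik.
set K := closure [set x | phi x != 0] in cK K0.
have phi0 x : ~ K x -> phi x = 0 by exact: compact_support_outside.
have rho_gt0 x : K x -> 0 < rho x.
  by move=> /K0 /= /eqP rx; rewrite lt_neqAle eq_sym rx hrho.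
have toN (h : M -> \bar R) : (\int[vol]_x h x = \int[vol]_(x in ~` N) h x)%E.
  by rewrite (integral_setD_null _ _ mN N0) setTD.
pose psi x := rho x `^ (alpha - 3) * phi x * phi x.
have apsi := psi_admissible alpha lrho rhoN rho_gt0 cK sp phi0.
have [lpsi _ psi0] := apsi.
have test : (\int[vol]_x (C / rho x * psi x * V u x `^ (tau n lambda mu + lambda - mu))%:E
     <= - \int[vol]_x
           (inner g x (grad g psi x) (affine_grad g u lambda mu rho x) * V u x `^ tau n lambda mu)%:E)%E.
  apply: hge.
  - by move=> x; rewrite /psi -mulrA mulr_ge0 ?powR_ge0// -expr2 sqr_ge0.
  - exact: lipM_lipschitz cK psi0 lpsi.
  - have sub : closure [set x | psi x != 0] `<=` K.
      by apply: closure_subset => x /=; apply: contraNN => /eqP h; rewrite /psi h mulr0.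
    by split; [exact: subclosed_compact (@closed_closure _ _) cK sub|exact: subset_trans sub K0].
rewrite !toN in test.
have := weighted_rellich hleb hvol mN N0 su lrho rhoN rho_gt0 cK sp phi0 C1 a2 Ca.
rewrite !toN.
have -> : (C + alpha - 3) ^+ 2 * (C - alpha + 1) ^+ 2 / 16 =
  ((C + alpha - 3) / 2 * (C - alpha + 1) / 2) ^+ 2 by field.
apply; apply: le_trans test.
(* On K, psi / rho is rho^(alpha-4) phi^2 since rho > 0; off K both integrands are 0. *)
rewrite le_eqVlt; apply/orP; left; apply/eqP/eq_integral => x _; congr (_%:E).
have [Kx|Kx] := pselect (K x); last by rewrite /psi phi0// !(expr0n,mulr0,mul0r).
have := @powR_mul_self R (rho x) (alpha - 3) (rho_gt0 x Kx).
have -> : alpha - 3 - 1 = alpha - 4 by ring.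
move=> E; rewrite /psi -E; have := rho_gt0 x Kx => r0; field.
by rewrite gt_eqF.
Qed.
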